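(* Let $D\subsetneq\mathbb{C}$ be a simply connected domain and let $\mathfrak{U}$ be a topologically closed semigroup of holomorphic self-maps of $D$. Let $(w_{s,t})_{(s,t)\in\Delta(I)}$ be an absolutely continuous evolution family, or an absolutely continuous reverse evolution family, in $D$ over the interval $I$, with associated Herglotz vector field $\phi$. Then the following two conditions are equivalent: (i) $w_{s,t}\in\mathfrak{U}$ for all $(s,t)\in\Delta(I)$; (ii) $\phi(\cdot,t)\in\mathcal{G}(\mathfrak{U})$ for a.e. $t\in I$.
   Context: For a domain $D\subset\mathbb{C}$ and $E\subset\mathbb{C}$, $\mathsf{Hol}(D,E)$ is the set of all holomorphic $f$ in $D$ with $f(D)\subset E$, with the topology of locally uniform convergence. A semigroup of holomorphic self-maps of $D$ is a set $\mathfrak{U}\subset\mathsf{Hol}(D,D)$ containing $\mathrm{id}_D$ and closed under composition; it is topologically closed if it is relatively closed in $\mathsf{Hol}(D,D)$. A one-parameter semigroup in $\mathfrak{U}$ is a family $(v_t)_{t\ge0}\subset\mathfrak{U}$ with $v_0=\mathrm{id}_D$, $v_s\circ v_t=v_{s+t}$ for $s,t\ge0$, and $v_t\to\mathrm{id}_D$ in $\mathsf{Hol}(D,D)$ as $t\to0^+$. Its infinitesimal generator is $\phi:=\lim_{t\to0^+}(\mathrm{id}_D-v_t)/t\in\mathsf{Hol}(D,\mathbb{C})$ (the limit always exists, and $\phi$ determines $(v_t)$). $\mathcal{G}(\mathfrak{U})$ is the set of all infinitesimal generators of one-parameter semigroups contained in $\mathfrak{U}$. $I\subset\mathbb{R}$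 is an interval of the form $[0,T]$ with $T\in(0,+\infty)$ or $[0,T)$ with $T\in(0,+\infty]$; $\Delta(I):=\{(s,t)\colon s,t\in I,\ s\le t\}$; $I_s:=I\cap[s,+\infty)$; $L^1_{\mathrm{loc}}(I)$ is the class of measurable functions on $I$ integrable on each compact subinterval of $I$. An absolutely continuous evolution family in $D$ over $I$ is a family $(w_{s,t})_{(s,t)\in\Delta(I)}\subset\mathsf{Hol}(D,D)$ such that: EF1: $w_{s,s}=\mathrm{id}_D$ for all $s\in I$; EF2: $w_{s,u}=w_{t,u}\circ w_{s,t}$ whenever $s\le t\le u$ in $I$; EF3: for each $z\in D$ there is a non-negative $f_z\in L^1_{\mathrm{loc}}(I)$ with $|w_{s,u}(z)-w_{s,t}(z)|\le\int_t^u f_z(r)\,\mathrm{d}r$ whenever $s\le t\le u$ in $I$. An absolutely continuous reverse evolution family $(v_{s,t})_{(s,t)\in\Delta(I)}\subset\mathsf{Hol}(D,D)$ is defined by the same conditions with EF2 replaced by $v_{s,u}=v_{s,t}\circ v_{t,u}$ whenever $s\le t\le u$ in $I$. A Herglotz vector field in $D$ is a function $\phi\colon D\times I\to\mathbb{C}$ such that: $\phi(\cdot,t)\in\mathcal{G}(\mathsf{Hol}(D,D))$ for any $t\in I$; $\phi(z,\cdot)$ is measurable on $I$ for any $z\in D$; and for any compact $K\subset D$ there is a non-negative $M_K\in L^1_{\mathrm{loc}}(I)$ with $\max_{z\in K}|\phi(z,t)|\le M_K(t)$ for a.e. $t\in I$. Two Herglotz vector fields $\phi,\psi$ are identified if $\phi(\cdot,t)=\psi(\cdot,t)$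 for a.e. $t\in I$. It is known that each absolutely continuous evolution family $(w_{s,t})$ has a unique associated Herglotz vector field $\phi$, characterized by: for any $z\in D$ and any $s\in[0,T)$, $I_s\ni t\mapsto w(t)=w_{s,t}(z)$ is a solution (locally absolutely continuous) of $\frac{\mathrm{d}w}{\mathrm{d}t}+\phi(w,t)=0$ for a.e. $t\in I_s$, $w(s)=z$. Likewise, each absolutely continuous reverse evolution family $(v_{s,t})$ has a unique associated Herglotz vector field $\phi$, characterized by: for any $z\in D$ and $t\in I\setminus\{0\}$, $[0,t]\ni s\mapsto v(s)=v_{s,t}(z)$ is the unique solution of $\frac{\mathrm{d}v}{\mathrm{d}s}=\phi(v,s)$ for a.e. $s\in[0,t]$, $v(t)=z$. *)

(* Defs.v *)
(* MathComp-Analysis; the complex plane is R[i] from mathcomp-real-closed *)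
From HB Require Import structures.
From mathcomp Require Import all_boot all_order all_algebra.
From mathcomp Require Import complex.
From mathcomp Require Import all_classical all_reals all_analysis.

Set Implicit Arguments.
Unset Strict Implicit.
Unset Printing Implicit Defensive.

Import Order.TTheory GRing.Theory Num.Theory.
Import numFieldNormedType.Exports.

Local Open Scope classical_set_scope.
Local Open Scope complex_scope.
Local Open Scope ring_scope.

(* R[i] seen as a numClosedFieldType, from which it gets its topology and its
   structure of normed space over itself.  The norm and the order are those of
   R[i]: `|z| lies in R[i], and `|z| <= a%:C for a : R compares the modulus of
   z with a. *)
Definition Cplane (R : realType) : numClosedFieldType := R[i].

(* Maps on D are total functions whose values off D are irrelevant:
   they are only ever constrained on D. Likewise, families indexed by real
   times are total in the time variables. *)

Section HolomorphicMaps.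
Context {R : realType}.
Local Notation C := (Cplane R).

Definition domain (D : set C) := [/\ D !=set0, open D & connected D].

Definition simply_connected (D : set C) :=
  connected D /\
  forall g : R -> C,
    {within `[0, 1], continuous g} -> (forall x : R, x \in `[0, 1] -> D (g x)) ->
    g 0 = g 1 ->
    exists H : R * R -> C,
      [/\ {within `[0, 1] `*` `[0, 1], continuous H},
          forall s x : R, s \in `[0, 1] -> x \in `[0, 1] -> D (H (s, x)),
          forall x : R, x \in `[0, 1] -> H (0, x) = g x /\ H (1, x) = g 0 &
          forall s : R, s \in `[0, 1] -> H (s, 0) = g 0 /\ H (s, 1) = g 0].

(* [derivable f z 1] is differentiability over the field C. *)
Definition Hol (D E : set C) : set (C -> C) :=
  [set f | (forall z, D z -> derivable f z 1) /\ f @` D `<=` E].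

(* D being open in C, locally uniform convergence in D is uniform convergence
   on the members of this family. *)
Definition compacts_in (D : set C) : set (set C) :=
  [set K | compact K /\ K `<=` D].

Definition semigroup (D : set C) (U : set (C -> C)) :=
  [/\ U `<=` Hol D D, U id & forall f g, U f -> U g -> U (f \o g)].

(* Since functions agreeing on D are not separated by the topology, this
   implies that membership in U depends only on the restriction to D. *)
Definition topologically_closed (D : set C) (U : set (C -> C)) :=
  closure (U : set {family compacts_in D, C -> C}) `&` Hol D D `<=` U.

Definition one_parameter_semigroup (D : set C) (U : set (C -> C))
    (v : R -> C -> C) :=
  [/\ forall t : R, 0 <= t -> U (v t),
      forall z, D z -> v 0 z = z,
      forall (s t : R) z, 0 <= s -> 0 <= t -> D z -> v s (v t z) = v (s + t) z &
      {family compacts_in D, v @ 0^'+ --> (id : C -> C)}].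

Definition infinitesimal_generator (D : set C) (v : R -> C -> C)
    (p : C -> C) :=
  Hol D setT p /\
  {family compacts_in D, (fun t z => (z - v t z) / t%:C) @ 0^'+ --> p}.

Definition generators (D : set C) (U : set (C -> C)) : set (C -> C) :=
  [set p | exists v, one_parameter_semigroup D U v /\
                     infinitesimal_generator D v p].

End HolomorphicMaps.

Section EvolutionFamilies.
Context {R : realType}.
Local Notation C := (Cplane R).
(* Lebesgue measure on the Lebesgue (not only the Borel) measurable sets *)
Local Notation mu := (@completed_lebesgue_measure R).
Local Notation lebesgueType := (caratheodory_type (@wlength R idfun)^*%mu).

(* I = [0, T] with T finite, or I = [0, T) with T possibly infinite *)
Definition time_interval (T : \bar R) (I : set R) :=
  (0 < T)%E /\
  ((T < +oo)%E /\ I = [set t | 0 <= t /\ (t%:E <= T)%E] \/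
   I = [set t | 0 <= t /\ (t%:E < T)%E]).

Definition lebesgue_measurable (I : set R) (f : R -> R) :=
  measurable_fun (I : set lebesgueType) (f : lebesgueType -> R).

Definition L1loc (I : set R) (f : R -> R) :=
  lebesgue_measurable I f /\
  forall a b : R, `[a, b] `<=` I -> mu.-integrable `[a, b] (EFin \o f).

(* Condition EF3, common to evolution and reverse evolution families *)
Definition ac_in_time (D : set C) (I : set R) (w : R -> R -> C -> C) :=
  forall z, D z -> exists f : R -> R,
    [/\ forall r, I r -> 0 <= f r, L1loc I f &
        forall s t u, I s -> I t -> I u -> s <= t -> t <= u ->
          `|w s u z - w s t z| <= (\int[mu]_(r in `[t, u]) f r)%:C].

Definition evolution_family (D : set C) (I : set R) (w : R -> R -> C -> C) :=
  [/\ forall s t, I s -> I t -> s <= t -> Hol D D (w s t),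
      forall s z, I s -> D z -> w s s z = z,
      forall s t u z, I s -> I t -> I u -> s <= t -> t <= u -> D z ->
        w s u z = w t u (w s t z) &
      ac_in_time D I w].

Definition reverse_evolution_family (D : set C) (I : set R)
    (w : R -> R -> C -> C) :=
  [/\ forall s t, I s -> I t -> s <= t -> Hol D D (w s t),
      forall s z, I s -> D z -> w s s z = z,
      forall s t u z, I s -> I t -> I u -> s <= t -> t <= u -> D z ->
        w s u z = w s t (w t u z) &
      ac_in_time D I w].

Definition herglotz_vector_field (D : set C) (I : set R) (p : C -> R -> C) :=
  [/\ forall t, I t -> generators D (Hol D D) (p ^~ t),
      forall z, D z -> lebesgue_measurable I (fun t => complex.Re (p z t)) /\
                       lebesgue_measurable I (fun t => complex.Im (p z t)) &
      forall K, compact K -> K `<=` D -> exists M : R -> R,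
        [/\ forall t, I t -> 0 <= M t, L1loc I M &
            {ae mu, forall t, I t -> forall z, K z -> `|p z t| <= (M t)%:C}]].

Definition absolutely_continuous (a b : R) (u : R -> C) :=
  forall e : R, 0 < e -> exists2 d : R, 0 < d &
    forall (n : nat) (x y : 'I_n -> R),
      (forall i, [/\ a <= x i, x i <= y i & y i <= b]) ->
      trivIset setT (fun i => [set` `]x i, y i[]) ->
      \sum_(i < n) (y i - x i) < d ->
      \sum_(i < n) `|u (y i) - u (x i)| < e%:C.

Definition locally_absolutely_continuous (J : set R) (u : R -> C) :=
  forall a b : R, `[a, b] `<=` J -> absolutely_continuous a b u.

(* l is the derivative at t of u, a function of a real variable *)
Definition has_derivative (u : R -> C) (t : R) (l : C) :=
  (fun h : R => (u (t + h) - u t) / h%:C) @ 0^' --> l.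

(* u is a Caratheodory solution in D, over the interval J, of u' = F(u, t)
   with u(t0) = z. The values of u off J only affect the derivative at the
   endpoints of J, a null set. *)
Definition solution (D : set C) (J : set R) (F : C -> R -> C) (t0 : R) (z : C)
    (u : R -> C) :=
  [/\ forall t, J t -> D (u t),
      locally_absolutely_continuous J u,
      {ae mu, forall t, J t -> has_derivative u t (F (u t) t)} &
      u t0 = z].

Definition associated_field (D : set C) (T : \bar R) (I : set R)
    (w : R -> R -> C -> C) (p : C -> R -> C) :=
  herglotz_vector_field D I p /\
  forall z s, D z -> 0 <= s -> (s%:E < T)%E ->
    solution D [set t | I t /\ s <= t] (fun x t => - p x t) s z
      (fun t => w s t z).

Definition reverse_associated_field (D : set C) (I : set R)
    (w : R -> R -> C -> C) (p : C -> R -> C) :=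
  herglotz_vector_field D I p /\
  forall z t, D z -> I t -> t != 0 ->
    solution D `[0, t] p t z (fun s => w s t z) /\
    forall u, solution D `[0, t] p t z u -> forall s : R, s \in `[0, t] ->
      u s = w s t z.

End EvolutionFamilies.

(* Main.v *)
(* Since D is simply connected and proper, a branch of sqrt (z - a) gives a
   bounded univalent function on D.  Together with Cauchy's estimates this makes
   d(z, w) = sup {|f z - f w| : f holomorphic on D, |f| <= 1}
   a metric on D, locally equivalent to the Euclidean one, which holomorphic
   self-maps of D do not increase.  Consequently the errors made in replacing
   the factors of a composition of self-maps only add up.

   For almost every t, w(t, t + h) = id - h phi(., t) + o(h) locally uniformly on
   D, and the one-parameter semigroup v^t generated by phi(., t) has the same
   expansion.  If the w(s, t) are in U, then v^t(x) is the limit of the n-th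
   iterates of w(t, t + x / n), hence is in U.  Conversely, let E(x) be the
   distance for d, uniform on a compact set, from w(s, x) to U.  Composing an
   almost optimal element of U with v^x(h) shows that the upper right derivative
   of E is nonpositive at almost every x; as E is absolutely continuous and
   E(s) = 0, it vanishes. *)
Require Import Defs.
From mathcomp Require Import all_boot all_order all_algebra.
From mathcomp Require Import complex.
From mathcomp Require Import all_classical all_reals all_analysis.
From mathcomp Require Import measurable_realfun ring lra.
Set Implicit Arguments.
Unset Strict Implicit.
Unset Printing Implicit Defensive.
Import Order.TTheory GRing.Theory Num.Theory.
Import numFieldNormedType.Exports.
Local Open Scope classical_set_scope.
Local Open Scope complex_scope.
Local Open Scope ring_scope.

(** The associated equation is known only along trajectories and outside null sets that depend on
    the starting point and time, whereas the argument needs the expansion of w(t, t + h) on all of a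
    compact set at one [t]. Countably many rational starting data give a single null set. A
    trajectory started slightly before [t] passes close to any prescribed point at time [t], and
    Cauchy's estimate for the holomorphic difference quotients carries the expansion over to that
    point, uniformly in [h]. The analysis is kept elementary. Cauchy's estimate comes from Goursat's
    bisection of midpoint sums, with a lower bound for the sums of 1/(w - p) in place of 2 pi i. The
    branch of the square root comes from a sign that is constant along a homotopy. Monotonicity from
    almost everywhere Dini derivatives comes from an open cover of the exceptional null set. Reverse
    families become forward ones under t |-> c - t. *)

Section Modulus.
Context {R : realType}.
Local Notation C := (Cplane R).
Implicit Types z w : C.

(** The modulus as a real number: the norm of [C] takes values in [C] itself, which real arithmetic
    cannot handle directly. *)
Definition nm z : R := ComplexField.Normc.normc z.

Lemma normE z : `|z| = (nm z)%:C. Proof. by []. Qed.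

Lemma nm_ge0 z : 0 <= nm z.
Proof. by case: z => x y; rewrite /nm /= sqrtr_ge0. Qed.

Lemma nm0 : nm 0 = 0. Proof. exact: ComplexField.Normc.normc0. Qed.

Lemma nm_eq0 z : nm z = 0 -> z = 0.
Proof. exact: ComplexField.Normc.eq0_normc. Qed.

Lemma nmD z w : nm (z + w) <= nm z + nm w.
Proof. exact: (@le_normcD R). Qed.

Lemma nmN z : nm (- z) = nm z.
Proof. exact: (@normcN R). Qed.

Lemma nmB z w : nm (z - w) <= nm z + nm w.
Proof. by rewrite -(nmN w); exact: nmD. Qed.

Lemma nmC z w : nm (z - w) = nm (w - z).
Proof. by rewrite -nmN opprB. Qed.

Lemma nm_tri y z w : nm (z - w) <= nm (z - y) + nm (y - w).
Proof.
by have -> : z - w = (z - y) + (y - w); [rewrite addrA subrK|exact: nmD].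
Qed.

Lemma nmM z w : nm (z * w) = nm z * nm w.
Proof. exact: ComplexField.Normc.normcM. Qed.

Lemma nmV z : nm z^-1 = (nm z)^-1.
Proof. exact: ComplexField.Normc.normcV. Qed.

Lemma nm_gt0 z : z != 0 -> 0 < nm z.
Proof.
move=> z0; rewrite lt_neqAle nm_ge0 andbT eq_sym.
by apply: contra z0 => /eqP/nm_eq0 ->.
Qed.

Lemma nmR (x : R) : nm (x%:C : C) = `|x|.
Proof. by rewrite /nm /= expr0n /= addr0 sqrtr_sqr. Qed.

Lemma nmi : nm ('i : C) = 1.
Proof. by rewrite /nm /= expr0n /= add0r expr1n sqrtr1. Qed.

Lemma nm_Re z : `|complex.Re z| <= nm z.
Proof.
case: z => x y; rewrite /nm /= -sqrtr_sqr ler_sqrt ?addr_ge0 ?sqr_ge0//.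
by rewrite lerDl sqr_ge0.
Qed.

Lemma nm_Im z : `|complex.Im z| <= nm z.
Proof.
case: z => x y; rewrite /nm /= -sqrtr_sqr ler_sqrt ?addr_ge0 ?sqr_ge0//.
by rewrite lerDr sqr_ge0.
Qed.

Lemma nm_le_ReIm z : nm z <= `|complex.Re z| + `|complex.Im z|.
Proof.
rewrite [X in nm X]complexE (le_trans (nmD _ _))// nmM nmi mul1r !nmR.
by [].
Qed.

Lemma nbhsC z (A : set C) :
  nbhs z A <-> exists2 e : R, 0 < e & forall y, nm (y - z) < e -> A y.
Proof.
split.
  move=> /nbhs_ballP[e /= e0 eA]; have er : (complex.Re e)%:C = e.
    by apply: RRe_real; rewrite realE (ltW e0).
  have e0' : 0 < complex.Re e by move: e0; rewrite -er ltcR.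
  exists (complex.Re e) => // y yz; apply: eA; rewrite /ball/= -er normE ltcR.
  by rewrite nmC.
move=> [e e0 eA]; apply/nbhs_ballP; exists e%:C; first by rewrite /= ltcR.
by move=> y; rewrite /ball/= normE ltcR nmC => /eA.
Qed.

Lemma nbhs_nm z (e : R) : 0 < e -> nbhs z [set y | nm (y - z) < e].
Proof. by move=> e0; apply/nbhsC; exists e. Qed.

Lemma open_nm (D : set C) z : open D -> D z ->
  exists2 e : R, 0 < e & forall y, nm (y - z) < e -> D y.
Proof. by move=> oD Dz; apply/nbhsC; exact: open_nbhs_nbhs. Qed.

Lemma open_nmP (D : set C) :
  (forall z, D z -> exists2 e : R, 0 < e & forall y, nm (y - z) < e -> D y) ->
  open D.
Proof. by move=> h; rewrite openE => z /h/nbhsC. Qed.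

(** Complex differentiability at [z] with derivative [l], cleared of the division by [y - z] so that
    [y = z] is no exception. *)
Definition hd (f : C -> C) z (l : C) := forall e : R, 0 < e ->
  exists2 d : R, 0 < d & forall y, nm (y - z) < d ->
    nm (f y - f z - l * (y - z)) <= e * nm (y - z).

Lemma derivable_hd (f : C -> C) z : derivable f z 1 <-> exists l, hd f z l.
Proof.
split=> [/cvg_ex[l fl]|[l fl]].
  exists l => e e0.
  have := fl _ (nbhs_nm l e0); rewrite /nbhs /= /dnbhs /within /= => /nbhsC[d d0 dP].
  exists d => // y yd; have [->|yz] := eqVneq y z.
    by rewrite !subrr mulr0 subrr nm0 mulr0.
  have yz0 : y - z != 0 by rewrite subr_eq0.
  have := dP (y - z); rewrite subr0 => /(_ yd yz0).
  rewrite -[(y - z) *: 1]/((y - z) * 1) mulr1 subrK -[_ *: _]/(_ * _) => lt.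
  have -> : f y - f z - l * (y - z) =
      ((y - z)^-1 * (f y - f z) - l) * (y - z).
    by rewrite mulrBl mulrAC mulVf// mul1r.
  by rewrite nmM ler_wpM2r ?nm_ge0// ltW.
apply/cvg_ex; exists l => A /nbhsC[e e0 eA].
have e20 : 0 < e / 2 by rewrite divr_gt0.
have [d d0 dP] := fl _ e20.
rewrite /nbhs /= /dnbhs /within /=; apply/nbhsC; exists d => // h.
rewrite subr0 => hd h0; apply: eA.
have := dP (h + z); rewrite addrK => /(_ hd) le.
rewrite -[h *: 1]/(h * 1) mulr1 -[_ *: _]/(_ * _).
have -> : h^-1 * (f (h + z) - f z) - l = (f (h + z) - f z - l * h) / h.
  by rewrite mulrBl mulfK// mulrC.
rewrite nmM nmV ltr_pdivrMr ?nm_gt0//.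
by rewrite (le_lt_trans le)// ltr_pM2r ?nm_gt0// ltr_pdivrMr// ltr_pMr// ltr1n.
Qed.

Lemma hd_cont (f : C -> C) z l : hd f z l -> forall e : R, 0 < e ->
  exists2 d : R, 0 < d & forall y, nm (y - z) < d -> nm (f y - f z) < e.
Proof.
move=> fl e e0; have [d d0 dP] := fl 1 ltr01.
pose k := nm l + 1.
have k0 : 0 < k by rewrite ltr_wpDl// nm_ge0.
exists (Num.min d (e / k)); first by rewrite lt_min d0 divr_gt0.
move=> y; rewrite lt_min => /andP[/dP yd ye].
have -> : f y - f z = (f y - f z - l * (y - z)) + l * (y - z) by rewrite subrK.
rewrite (le_lt_trans (nmD _ _))// nmM (le_lt_trans (lerD yd (lexx _)))//.
by rewrite -mulrDl addrC mulrC -ltr_pdivlMr.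
Qed.

Lemma derivable_cont (f : C -> C) z : derivable f z 1 -> forall e : R, 0 < e ->
  exists2 d : R, 0 < d & forall y, nm (y - z) < d -> nm (f y - f z) < e.
Proof. by move=> /derivable_hd[l]; exact: hd_cont. Qed.

Lemma derivable_comp (f g : C -> C) z : derivable f z 1 ->
  derivable g (f z) 1 -> derivable (g \o f) z 1.
Proof.
move=> /derivable1_diffP df /derivable1_diffP dg; apply/derivable1_diffP.
exact: (@differentiable_comp C C C C f g z df dg).
Qed.

End Modulus.

Section DerivableAlgebra.
Context {R : realType}.
Local Notation C := (Cplane R).
Implicit Types (f g : C -> C) (z c : C).

Lemma derivable_cstC c z : derivable (fun _ : C => c) z 1.
Proof. exact: (@derivable_cst C C C c z 1). Qed.

Lemma derivable_idC z : derivable (fun w : C => w) z 1.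
Proof. exact: (@derivable_id C C z 1). Qed.

Lemma derivable_subC f g z : derivable f z 1 -> derivable g z 1 ->
  derivable (fun w => f w - g w) z 1.
Proof. exact: (@derivableB C C C f g z 1). Qed.

Lemma derivable_addC f g z : derivable f z 1 -> derivable g z 1 ->
  derivable (fun w => f w + g w) z 1.
Proof. exact: (@derivableD C C C f g z 1). Qed.

Lemma derivable_mulC f g z : derivable f z 1 -> derivable g z 1 ->
  derivable (fun w => f w * g w) z 1.
Proof. exact: (@derivableM C C f g z 1). Qed.

Lemma derivable_invC f z : f z != 0 -> derivable f z 1 ->
  derivable (fun w => (f w)^-1) z 1.
Proof. exact: (@derivableV C C f z 1). Qed.

End DerivableAlgebra.

Arguments derivable_idC {R} z.
Arguments derivable_cstC {R} c z.
Arguments derivable_subC {R f g z}.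
Arguments derivable_addC {R f g z}.
Arguments derivable_mulC {R f g z}.
Arguments derivable_invC {R f z}.

(** * Compact sets and locally uniform approximation *)

Section Compactness.
Context {R : realType}.
Local Notation C := (Cplane R).

(** If [Phi K] failed, the sets [B] with [Phi (K \ B)] would form a proper filter containing [K],
    and the local hypothesis at a cluster point would contradict it. All finite subcover arguments
    below take this form. *)
Lemma compact_induction (T : topologicalType) (Phi : set T -> Prop) (K : set T) :
  compact K -> Phi set0 -> (forall A B, Phi A -> Phi B -> Phi (A `|` B)) ->
  (forall A B, A `<=` B -> Phi B -> Phi A) ->
  (forall x, K x -> exists2 V, nbhs x V & Phi (V `&` K)) -> Phi K.
Proof.
move=> cK P0 PU PS Pl; apply: contrapT => nPK.
pose F := [set B | Phi (K `\` B)].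
have FF : ProperFilter F.
  split=> [|]; first by rewrite /F /= setD0.
  split=> [|A B|A B AB]; rewrite /F /=.
  - by rewrite setDT.
  - by move=> PA PB; rewrite setDIr; exact: PU.
  - by apply: PS; exact: setDS.
have FK : F K by rewrite /F /= setDv.
have [x [Kx clx]] := cK F FF FK.
have [V Vx PV] := Pl x Kx.
have FV : F (~` V) by rewrite /F /= setDE setCK setIC.
by have [y []] := clx _ _ FV Vx.
Qed.

(** Squares serve as compact neighbourhoods instead of discs, being continuous images of products of
    two segments. *)
Definition Sq (c : C) (r : R) : set C :=
  [set z | `|complex.Re (z - c)| <= r /\ `|complex.Im (z - c)| <= r].

Lemma Sq_nm c r z : nm (z - c) <= r -> Sq c r z.
Proof.
by move=> h; split; rewrite (le_trans _ h)// ?nm_Re ?nm_Im.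
Qed.

Lemma nm_Sq c r z : Sq c r z -> nm (z - c) <= 2 * r.
Proof.
move=> [h1 h2]; rewrite (le_trans (nm_le_ReIm _))// mulrDl mul1r.
exact: lerD.
Qed.

Lemma compact_Sq c r : compact (Sq c r).
Proof.
pose f (p : R * R) : C := c + (p.1%:C + 'i * p.2%:C).
have -> : Sq c r = f @` (`[- r, r] `*` `[- r, r]).
  apply/seteqP; split=> z /=.
    move=> [h1 h2]; exists (complex.Re (z - c), complex.Im (z - c)).
      by split; rewrite /= in_itv /= -ler_norml.
    by rewrite /f /= -complexE addrC subrK.
  move=> [[x y] [/= hx hy] <-]; rewrite /Sq /= /f /= addrC addKr.
  have -> : complex.Re (x%:C + 'i * y%:C : C) = x.
    by rewrite /= ; ring.
  have -> : complex.Im (x%:C + 'i * y%:C : C) = y.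
    by rewrite /= ; ring.
  by rewrite !ler_norml; move: hx hy; rewrite !in_itv.
apply: continuous_compact; last first.
  by apply: compact_setX; exact: segment_compact.
apply: continuous_subspaceT => -[x y] A /nbhsC[e e0 eA].
have e20 : 0 < e / 2 by rewrite divr_gt0.
exists ([set u | `|u - x| < e / 2], [set u | `|u - y| < e / 2]) => /=.
  split; apply/nbhs_ballP; exists (e / 2) => // u; rewrite /ball /= distrC //.
move=> [u v] [/= hu hv]; apply: eA; rewrite /f /=.
have -> : c + (u%:C + 'i * v%:C) - (c + (x%:C + 'i * y%:C)) =
   (u - x)%:C + 'i * (v - y)%:C :> C.
  by rewrite !rmorphB /=; ring.
rewrite (le_lt_trans (nmD _ _))// nmM nmi mul1r !nmR.
by rewrite [e]splitr ltrD.
Qed.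

Lemma open_Sq (D : set C) z : open D -> D z ->
  exists2 r : R, 0 < r & Sq z r `<=` D.
Proof.
move=> oD /(open_nm oD)[e e0 eD]; exists (e / 4); first by rewrite divr_gt0.
move=> y /nm_Sq h; apply: eD; rewrite (le_lt_trans h)//.
by have : 0 < e by []; lra.
Qed.

Lemma compact_nm (K : set C) (Phi : set C -> Prop) :
  compact K -> Phi set0 -> (forall A B, Phi A -> Phi B -> Phi (A `|` B)) ->
  (forall A B, A `<=` B -> Phi B -> Phi A) ->
  (forall z, K z -> exists2 e : R, 0 < e & Phi [set y | nm (y - z) < e]) ->
  Phi K.
Proof.
move=> cK P0 PU PS Pl; apply: (compact_induction cK P0 PU PS) => z /Pl[e e0 Pe].
exists [set y | nm (y - z) < e]; first exact: nbhs_nm.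
by apply: PS Pe; exact: subIsetl.
Qed.

Lemma compact_nbhd (D K : set C) : open D -> compact K -> K `<=` D ->
  exists K' : set C, [/\ compact K', K' `<=` D &
    exists2 r : R, 0 < r & forall z y, K z -> nm (y - z) <= r -> K' y].
Proof.
move=> oD cK KD.
apply: (@compact_nm _ (fun A => exists K' : set C, [/\ compact K', K' `<=` D &
    exists2 r : R, 0 < r & forall z y, A z -> nm (y - z) <= r -> K' y])) => //.
- by exists set0; split=> //; [exact: compact0|exists 1].
- move=> A B [K1 [c1 D1 [r1 r10 h1]]] [K2 [c2 D2 [r2 r20 h2]]].
  exists (K1 `|` K2); split; first exact: compactU.
    by move=> z [/D1|/D2].
  exists (Num.min r1 r2); first by rewrite lt_min r10.
  by move=> z y [Az|Bz]; rewrite le_min => /andP[zy1 zy2];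
    [left; apply: h1 Az _|right; apply: h2 Bz _].
- move=> A B AB [K1 [c1 D1 [r1 r10 h1]]]; exists K1; split=> //.
  by exists r1 => // z y /AB; exact: h1.
- move=> z /KD Dz; have [r r0 rD] := open_Sq oD Dz.
  exists (r / 2); first by rewrite divr_gt0.
  exists (Sq z r); split => //; first exact: compact_Sq.
  exists (r / 2); first by rewrite divr_gt0.
  move=> u y /= uz yu; apply: Sq_nm; rewrite (le_trans (nm_tri u _ _))//.
  by rewrite [r]splitr lerD// ltW.
Qed.

Lemma family_cvg_nm (D : set C) (F : R -> C -> C) (f : C -> C) :
  {family compacts_in D, F @ 0^'+ --> f} ->
  forall (K : set C) (e : R), compact K -> K `<=` D -> 0 < e ->
  exists2 d : R, 0 < d & forall t, 0 < t -> t < d -> forall z, K z ->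
    nm (F t z - f z) < e.
Proof.
move=> cvF K e cK KD e0.
have e0' : 0 < (e%:C : C) by rewrite ltcR.
have KK : compacts_in D K by split.
have := cvF _ (fam_nbhs (f : {family compacts_in D, C -> C})
                        (@entourage_ball _ C (PosNum e0')) KK).
rewrite /nbhs /= /at_right /within /= => /nbhs_ballP[d /= d0 dP].
exists d => // t t0 td z Kz.
have := dP t; rewrite /ball /= sub0r normrN gtr0_norm// => /(_ td t0 z Kz).
by rewrite /ball /= normE ltcR nmC.
Qed.

(** The members of [U] that are [e]-close to [f] on [K], for varying [K] and [e], form a base of a
    proper filter on [U] that converges to [f]. Closedness of [U] enters the proof only through this
    lemma. *)
Lemma closure_nm (D : set C) (U : set (C -> C)) (f : C -> C) :
  topologically_closed D U -> Hol D D f ->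
  (forall (K : set C) (e : R), compact K -> K `<=` D -> 0 < e ->
    exists2 F, U F & forall z, K z -> nm (F z - f z) < e) -> U f.
Proof.
move=> clU hf app; apply: clU; split => //.
rewrite closureEcvg.
pose B (i : set C * R) := [set g : C -> C | U g /\ forall z, i.1 z -> nm (g z - f z) < i.2].
pose I := [set i : set C * R | [/\ compact i.1, i.1 `<=` D & 0 < i.2]].
have FF : ProperFilter (filter_from I B).
  apply: filter_from_proper; last first.
    by move=> [K e] [/= cK KD e0]; have [F UF Fe] := app K e cK KD e0; exists F.
  apply: filter_from_filter.
    by exists (set0, 1); split => //=; exact: compact0.
  move=> [K1 e1] [K2 e2] [/= c1 D1 e10] [/= c2 D2 e20].
  exists (K1 `|` K2, Num.min e1 e2).
    split => /=; last by rewrite lt_min e10.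
      exact: compactU.
    by move=> z [/D1|/D2].
  move=> g [/= Ug gz]; split; split => //= z Kz;     move: (gz z); rewrite lt_min.
    by move=> /(_ (or_introl Kz))/andP[].
    by move=> /(_ (or_intror Kz))/andP[].
exists (filter_from I B) => //; split.
  apply/fam_cvgP => K [cK KD]; 
  move=> P /uniform_nbhs[E [entE EP]].
  have [e /= e0 eE] : exists2 e : C, 0 < e & [set xy | ball xy.1 e xy.2] `<=` E.
    by move: entE; rewrite entourageE_subproof.
  have er : (complex.Re e)%:C = e by apply: RRe_real; rewrite realE (ltW e0).
  have e0' : 0 < complex.Re e by move: e0; rewrite -er ltcR.
  exists (K, complex.Re e) => // g [/= Ug gz]; apply: EP => y Ky; apply: eE.
  by rewrite /ball /= -er normE ltcR nmC; exact: gz.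
by move=> A AU; exists (set0, 1); [split => //=; exact: compact0|move=> g [/AU]].
Qed.

End Compactness.

(** * Cauchy estimates from Goursat's argument *)

Section SegmentSums.
Context {R : realType}.
Local Notation C := (Cplane R).
Implicit Types (f g : C -> C) (a b z L p : C).

(* Riemann sum of the integral of f along [a, b] over 2^n equal pieces, f being
   evaluated at the midpoints.  The rule is additive under bisection and exact
   on affine maps, so that Goursat's argument applies to it without limits. *)
Fixpoint seg f n a b : C :=
  if n is m.+1 then seg f m a ((a + b) / 2) + seg f m ((a + b) / 2) b
  else (b - a) * f ((a + b) / 2).

Lemma seg_opp f n a b : seg f n b a = - seg f n a b.
Proof.
elim: n a b => [|n IH] a b /=; first by rewrite (addrC b a) -mulNr opprB.
rewrite (addrC b a) (IH ((a + b) / 2) b) (IH a ((a + b) / 2)).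
by rewrite opprD addrC.
Qed.

Lemma segB f g n a b :
  seg (fun z => f z - g z) n a b = seg f n a b - seg g n a b.
Proof.
elim: n a b => [|n IH] a b /=; first by rewrite mulrBr.
by rewrite !IH; ring.
Qed.

Lemma segZ c f n a b : seg (fun z => c * f z) n a b = c * seg f n a b.
Proof.
elim: n a b => [|n IH] a b /=; first by rewrite mulrCA.
by rewrite !IH; ring.
Qed.

Lemma seg_affine c d n a b :
  seg (fun z => c + d * z) n a b = (b - a) * (c + d * ((a + b) / 2)).
Proof. by elim: n a b => [//|n IH] a b /=; rewrite !IH; field. Qed.

Lemma seg_halves a b (t : R) :
  (a + t%:C * ((a + b) / 2 - a) = a + (t / 2)%:C * (b - a)) /\
  ((a + b) / 2 + t%:C * (b - (a + b) / 2) = a + ((t + 1) / 2)%:C * (b - a)).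
Proof.
rewrite !rmorphM /= rmorphD /= fmorphV /= rmorph_nat rmorph1.
by split; field.
Qed.

Lemma nm_half : nm (2^-1 : C) = 2^-1.
Proof.
have -> : (2^-1 : C) = (2^-1 : R)%:C by rewrite fmorphV /= rmorph_nat.
by rewrite nmR ger0_norm// invr_ge0.
Qed.

Lemma seg_bound f n a b (B : R) :
  (forall t : R, 0 <= t -> t <= 1 -> nm (f (a + t%:C * (b - a))) <= B) ->
  nm (seg f n a b) <= B * nm (b - a).
Proof.
elim: n a b => [|n IH] a b fB /=.
  rewrite nmM mulrC ler_wpM2r ?nm_ge0//.
  have := fB (2^-1); rewrite fmorphV /= rmorph_nat.
  have -> : a + 2^-1 * (b - a) = (a + b) / 2 by field.
  by apply; lra.
have h1 : nm ((a + b) / 2 - a) = nm (b - a) / 2.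
  have -> : (a + b) / 2 - a = (b - a) * 2^-1 by field.
  by rewrite nmM nm_half.
have h2 : nm (b - (a + b) / 2) = nm (b - a) / 2.
  have -> : b - (a + b) / 2 = (b - a) * 2^-1 by field.
  by rewrite nmM nm_half.
rewrite (le_trans (nmD _ _))// [nm (b - a)]splitr -{1}h1 -h2 mulrDr lerD//.
  apply: IH => t t0 t1; rewrite (seg_halves a b t).1; apply: fB; lra.
by apply: IH => t t0 t1; rewrite (seg_halves a b t).2; apply: fB; lra.
Qed.

(** Meant for [(w - p)^-1]: bounding the imaginary part from below on each side of a square replaces
    the computation of a winding number. *)
Lemma seg_Im f n a b (c : R) :
  (forall t : R, 0 <= t -> t <= 1 ->
    c <= complex.Im ((b - a) * f (a + t%:C * (b - a)))) ->
  c <= complex.Im (seg f n a b).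
Proof.
have ImD (x y : C) : complex.Im (x + y) = complex.Im x + complex.Im y.
  by case: x; case: y.
have Im2 (x : C) : complex.Im (2^-1 * x) = complex.Im x / 2.
  have -> : (2^-1 : C) = (2^-1 : R)%:C by rewrite fmorphV /= rmorph_nat.
  by case: x => x y /=; rewrite mul0r addr0 mulrC.
elim: n a b c => [|n IH] a b c fB /=.
  have := fB (2^-1); rewrite fmorphV /= rmorph_nat.
  have -> : a + 2^-1 * (b - a) = (a + b) / 2 by field.
  by apply; lra.
rewrite ImD [c]splitr lerD//; apply: IH => t t0 t1.
  rewrite (seg_halves a b t).1.
  have -> : (a + b) / 2 - a = 2^-1 * (b - a) by field.
  by rewrite -mulrA Im2 ler_pM2r ?invr_gt0//; apply: fB; lra.
rewrite (seg_halves a b t).2.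
have -> : b - (a + b) / 2 = 2^-1 * (b - a) by field.
by rewrite -mulrA Im2 ler_pM2r ?invr_gt0//; apply: fB; lra.
Qed.

(* z is the lower left corner and L the side, which may be any complex number:
   the square is then rotated. *)
Definition sq f n z L : C :=
  seg f n z (z + L) + seg f n (z + L) (z + L + 'i * L)
  + seg f n (z + L + 'i * L) (z + 'i * L) + seg f n (z + 'i * L) z.

(** The four inner sides are traversed twice, in opposite directions, and cancel by [seg_opp].
    Bisecting the square costs one level of depth. *)
Lemma sqS f n z L : let H := L / 2 in
  sq f n.+1 z L = sq f n z H + sq f n (z + H) H + sq f n (z + H + 'i * H) H
                  + sq f n (z + 'i * H) H.
Proof.
move=> H; rewrite /sq /=.
have -> : L = H + H by rewrite /H; field.
have -> : (z + (z + (H + H))) / 2 = z + H by field.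
have -> : (z + (H + H) + (z + (H + H) + 'i * (H + H))) / 2 = z + H + H + 'i * H.
  by field.
have -> : (z + (H + H) + 'i * (H + H) + (z + 'i * (H + H))) / 2 =
   z + H + 'i * H + 'i * H by field.
have -> : (z + 'i * (H + H) + z) / 2 = z + 'i * H by field.
have -> : z + (H + H) = z + H + H by ring.
have -> : z + H + H + 'i * (H + H) = z + H + 'i * H + H + 'i * H by ring.
have -> : z + 'i * (H + H) = z + 'i * H + 'i * H by ring.
have -> : z + H + H + 'i * H = z + H + 'i * H + H by ring.
have -> : z + 'i * H + H = z + H + 'i * H by ring.
rewrite (seg_opp _ _ (z + H) (z + H + 'i * H)).
rewrite (seg_opp _ _ (z + H + 'i * H) (z + H + 'i * H + H)).
rewrite (seg_opp _ _ (z + H + 'i * H) (z + H + 'i * H + 'i * H)).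
rewrite (seg_opp _ _ (z + 'i * H) (z + H + 'i * H)).
ring.
Qed.

Definition inSq z L p := exists x y : R, [/\ 0 <= x <= 1, 0 <= y <= 1 &
  p = z + L * (x%:C + 'i * y%:C)].

Definition bdSq z L p := exists x y : R, [/\ 0 <= x <= 1, 0 <= y <= 1,
  (x == 0) || (x == 1) || (y == 0) || (y == 1) &
  p = z + L * (x%:C + 'i * y%:C)].

Lemma sq_bound f n z L (B : R) : (forall p, bdSq z L p -> nm (f p) <= B) ->
  nm (sq f n z L) <= 4 * (B * nm L).
Proof.
move=> fB; rewrite /sq.
have E a c b : b = a + c -> nm L = nm c ->
  (forall t : R, 0 <= t -> t <= 1 -> bdSq z L (a + t%:C * c)) ->
  nm (seg f n a b) <= B * nm L.
  move=> -> -> h; have {2}-> : c = a + c - a by rewrite addrC addKr.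
  apply: seg_bound => t t0 t1; apply: fB.
  have -> : a + c - a = c by rewrite addrC addKr.
  exact: h.
have -> : 4 * (B * nm L) = B * nm L + B * nm L + B * nm L + B * nm L by ring.
rewrite (le_trans (nmD _ _))// lerD//; last first.
  apply: (E _ (- ('i * L))); [by ring|by rewrite nmN nmM nmi mul1r|].
  move=> t t0 t1; exists 0, (1 - t); split; rewrite ?eqxx ?orbT//; [lra|lra|].
  by rewrite rmorphB /= rmorph1 rmorph0; ring.
rewrite (le_trans (nmD _ _))// lerD//; last first.
  apply: (E _ (- L)); [by ring|by rewrite nmN|].
  move=> t t0 t1; exists (1 - t), 1; split; rewrite ?eqxx ?orbT//; [lra|lra|].
  by rewrite rmorphB /= rmorph1; ring.
rewrite (le_trans (nmD _ _))// lerD//.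
  apply: (E _ L) => // t t0 t1; exists t, 0.
  split; rewrite ?eqxx ?orbT//; [lra|lra|].
  by rewrite rmorph0; ring.
apply: (E _ ('i * L)) => //; first by rewrite nmM nmi mul1r.
move=> t t0 t1; exists 1, t; split; rewrite ?eqxx ?orbT//; [lra|lra|].
by rewrite rmorph1; ring.
Qed.

Lemma sqB f g n z L : sq (fun z => f z - g z) n z L = sq f n z L - sq g n z L.
Proof. by rewrite /sq !segB; ring. Qed.

Lemma sqZ c f n z L : sq (fun z => c * f z) n z L = c * sq f n z L.
Proof. by rewrite /sq !segZ; ring. Qed.

Lemma sq_affine c d n z L : sq (fun z => c + d * z) n z L = 0.
Proof. by rewrite /sq !seg_affine; field. Qed.

(** The difference has the bound [0] on the boundary, so [sq_bound] applies with [B = 0]. Integrands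
    may therefore be rewritten by identities that break down at an interior pole. *)
Lemma sq_ext f g n z L : (forall p, bdSq z L p -> f p = g p) ->
  sq f n z L = sq g n z L.
Proof.
move=> fg; apply/eqP; rewrite -subr_eq0 -sqB; apply/eqP/nm_eq0/eqP.
rewrite eq_le nm_ge0 andbT.
rewrite (le_trans (@sq_bound _ _ _ _ 0 _)) ?mul0r ?mulr0// => p /fg ->.
by rewrite subrr nm0.
Qed.

End SegmentSums.

(** * Goursat's theorem by bisection *)

Section Goursat.
Context {R : realType}.
Local Notation C := (Cplane R).
Implicit Types (f g : C -> C) (a b z L p : C).

Lemma half_pow_lt (e : R) : 0 < e -> exists k, (2^-1 : R) ^+ k < e.
Proof.
move=> e0; exists (Num.bound e^-1).
rewrite exprVn -[ltRHS]invrK ltf_pV2 ?posrE ?exprn_gt0 ?invr_gt0//.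
rewrite (lt_trans (archi_boundP _)) ?invr_ge0 ?ltW//.
by rewrite -natrX ltr_nat ltn_expl.
Qed.

Lemma nested_halves (X : nat -> R) :
  (forall k, X k <= X k.+1 <= X k + 2^-1 ^+ k.+1) ->
  exists x, forall k, X k <= x <= X k + 2^-1 ^+ k.
Proof.
move=> hX.
have up k j : X k <= X (k + j)%N.
  elim: j => [|j IH]; first by rewrite addn0.
  by rewrite addnS (le_trans IH)//; have /andP[] := hX (k + j)%N.
have dn k j : X (k + j)%N + 2^-1 ^+ (k + j) <= X k + 2^-1 ^+ k.
  elim: j => [|j IH]; first by rewrite addn0.
  rewrite addnS (le_trans _ IH)//; have /andP[_] := hX (k + j)%N.
  rewrite -(lerD2r (2^-1 ^+ (k + j).+1)) => /le_trans; apply.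
  by rewrite -addrA lerD2l exprS; set u := _ ^+ _; lra.
have pos k : 0 <= 2^-1 ^+ k :> R by rewrite exprn_ge0.
have ub j k : X j <= X k + 2^-1 ^+ k.
  have [/subnKC <-|/ltnW /subnKC <-] := leqP k j.
    by apply: le_trans (dn _ (j - k)%N); rewrite lerDl.
  by rewrite (le_trans (up j (k - j)%N))// lerDl.
have hs : has_sup (range X).
  split; first by exists (X 0%N); exists 0%N.
  by exists (X 0%N + 2^-1 ^+ 0) => _ [j _ <-]; exact: ub.
exists (sup (range X)) => k; apply/andP; split.
  by apply: ub_le_sup; [exact: hs.2|exists k].
by apply: ge_sup; [exact: hs.1|move=> _ [j _ <-]; exact: ub].
Qed.

(** Plays the role of a bound [e] on the modulus of a contour integral. The bound is asked at all
    large depths because passing to a quarter shifts the depth. *)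
Definition sq_small f z L (e : R) :=
  exists N, forall n, (N <= n)%N -> nm (sq f n z L) <= e.

Lemma sq_small4 f z L (e : R) : let H := L / 2 in
  sq_small f z H e -> sq_small f (z + H) H e ->
  sq_small f (z + H + 'i * H) H e -> sq_small f (z + 'i * H) H e ->
  sq_small f z L (4 * e).
Proof.
move=> H [N1 h1] [N2 h2] [N3 h3] [N4 h4].
exists (maxn (maxn N1 N2) (maxn N3 N4)).+1 => -[//|n].
rewrite ltnS !geq_max => /andP[/andP[/h1 l1 /h2 l2] /andP[/h3 l3 /h4 l4]].
rewrite sqS -/H.
have -> : 4 * e = e + e + e + e by ring.
rewrite (le_trans (nmD _ _))// lerD// (le_trans (nmD _ _))// lerD//.
by rewrite (le_trans (nmD _ _))// lerD.
Qed.

(** A failing square has a failing quarter; the nested failing squares shrink to a point [p]. Near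
    [p], [f] is affine up to a small multiple of the distance, and affine maps have zero sums, so a
    small enough square cannot fail. *)
Theorem goursat f z L : (forall p, inSq z L p -> derivable f p 1) ->
  forall e : R, 0 < e -> sq_small f z L e.
Proof.
move=> df e e0; apply: contrapT => nsmall.
pose s k : R := 2^-1 ^+ k.
have s0 k : 0 < s k by rewrite exprn_gt0.
have sS k : s k.+1 = s k / 2 by rewrite /s exprS mulrC.
pose corner (q : R * R) : C := z + L * (q.1%:C + 'i * q.2%:C).
(* The tolerance is proportional to the area, so that four quarters meeting theirs add up to the
   tolerance of the whole. In [nxt] badness of [q] is a premise, which makes the choice of a
   successor total. *)
pose Bad k q := ~ sq_small f (corner q) (L * (s k)%:C) (e * s k ^+ 2).
pose nxt k (q q' : R * R) := Bad k q -> Bad k.+1 q' /\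
  (q.1 <= q'.1 <= q.1 + s k.+1) /\ (q.2 <= q'.2 <= q.2 + s k.+1).
have step k q : exists q', nxt k q q'.
  apply: contrapT => /forallNP no; have [B|nB] := pselect (Bad k q); last first.
    by apply: (no q) => /nB.
  have sm (a b : R) : 0 <= a <= s k.+1 -> 0 <= b <= s k.+1 ->
      sq_small f (corner (q.1 + a, q.2 + b)) (L * (s k.+1)%:C) (e * s k.+1 ^+ 2).
    move=> ha hb; apply: contrapT => Bq; apply: (no (q.1 + a, q.2 + b)).
    by move=> _; split => //=; lra.
  have s1 := ltW (s0 k.+1).
  apply: B; have -> : e * s k ^+ 2 = 4 * (e * s k.+1 ^+ 2) by rewrite sS; field.
  have E : L * (s k)%:C / 2 = L * (s k.+1)%:C.
    by rewrite sS rmorphM /= fmorphV /= rmorph_nat; ring.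
  have S1 := sm 0 0; have S2 := sm (s k.+1) 0.
  have S3 := sm (s k.+1) (s k.+1); have S4 := sm 0 (s k.+1).
  rewrite ?lexx s1 /= in S1 S2 S3 S4.
  have {}S1 := S1 isT isT; have {}S2 := S2 isT isT.
  have {}S3 := S3 isT isT; have {}S4 := S4 isT isT.
  apply: sq_small4; rewrite E.
  - by move: S1; rewrite !addr0; case: (q).
  - move: S2; rewrite /corner /= addr0 rmorphD /=.
    by congr sq_small; ring.
  - move: S3; rewrite /corner /= !rmorphD /=.
    by congr sq_small; ring.
  - move: S4; rewrite /corner /= addr0 !rmorphD /=.
    by congr sq_small; ring.
have [F FP] := choice (fun kq : nat * (R * R) => step kq.1 kq.2).
pose Q := fix Q k := if k is j.+1 then F (j, Q j) else (0, 0).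
have BQ k : Bad k (Q k).
  elim: k => [|k IH]; last by have [] := FP (k, Q k) IH.
  rewrite /Bad /corner /= rmorph0 mulr0 addr0 mulr0 addr0 /s !expr0 rmorph1.
  by rewrite expr1n !mulr1.
have QS k : (Q k).1 <= (Q k.+1).1 <= (Q k).1 + s k.+1 /\
            (Q k).2 <= (Q k.+1).2 <= (Q k).2 + s k.+1.
  by have [_ []] := FP (k, Q k) (BQ k).
have [x hx] := @nested_halves (fun k => (Q k).1) (fun k => (QS k).1).
have [y hy] := @nested_halves (fun k => (Q k).2) (fun k => (QS k).2).
pose p := corner (x, y).
have pin : inSq z L p.
  exists x, y; split => //.
    by have := hx 0%N; rewrite /= expr0 add0r.
  by have := hy 0%N; rewrite /= expr0 add0r.
have /derivable_hd[l hl] := df p pin.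
pose m := nm L.
have m0 : 0 <= m by exact: nm_ge0.
(* At scale [s k], [sq_bound] gives four sides of length [m * s k], with a remainder of at most
   [e' * (2 * m * s k)] on them: [8 * m ^+ 2 * e' * s k ^+ 2] in all. The [1] covers [m = 0]. *)
pose e' := e / (8 * m ^+ 2 + 1).
have den0 : 0 < 8 * m ^+ 2 + 1 by rewrite ltr_wpDl// mulr_ge0// sqr_ge0.
have e'0 : 0 < e' by rewrite divr_gt0.
have [d d0 dP] := hl e' e'0.
have [k hk] : exists k, s k < d / (2 * m + 1).
  by apply: half_pow_lt; rewrite divr_gt0// ltr_wpDl// mulr_ge0.
have close w : bdSq (corner (Q k)) (L * (s k)%:C) w -> nm (w - p) <= 2 * m * s k.
  move=> [u [v [hu hv _ ->]]].
  have -> : corner (Q k) + L * (s k)%:C * (u%:C + 'i * v%:C) - p =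
      L * (((Q k).1 + s k * u - x)%:C + 'i * ((Q k).2 + s k * v - y)%:C).
    by rewrite /p /corner /= !rmorphB !rmorphD !rmorphM /=; ring.
  rewrite nmM mulrAC mulrC -/m ler_wpM2r//.
  rewrite (le_trans (nmD _ _))// nmM nmi mul1r !nmR.
  have /andP[x1 x2] := hx k; have /andP[y1 y2] := hy k.
  have su : 0 <= s k * u <= s k.
    by case/andP: hu => u0 u1; apply/andP; split;
      [exact: mulr_ge0 (ltW (s0 k)) u0|rewrite ler_piMr// ltW].
  have sv : 0 <= s k * v <= s k.
    by case/andP: hv => v0 v1; apply/andP; split;
      [exact: mulr_ge0 (ltW (s0 k)) v0|rewrite ler_piMr// ltW].
  rewrite mulrDl mul1r lerD// ler_norml; move: x1 x2 y1 y2; rewrite -/(s k); lra.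
apply: (BQ k); exists 0%N => n _.
pose r w := f w - (f p - l * p + l * w).
have -> : sq f n (corner (Q k)) (L * (s k)%:C) = sq r n (corner (Q k)) (L * (s k)%:C).
  by rewrite /r sqB sq_affine subr0.
have hb : nm (sq r n (corner (Q k)) (L * (s k)%:C)) <=
     4 * ((e' * (2 * m * s k)) * nm (L * (s k)%:C)).
  apply: sq_bound => w hw.
  have wp := close w hw.
  have -> : r w = f w - f p - l * (w - p) by rewrite /r; ring.
  apply: le_trans (dP w _) _; last by rewrite ler_wpM2l// ltW.
  apply: le_lt_trans wp _.
  move: hk; rewrite ltr_pdivlMr; last by rewrite ltr_wpDl// mulr_ge0.
  by apply: le_lt_trans; rewrite mulrDr mulr1 mulrC lerDl ltW.
apply: le_trans hb _; rewrite nmM nmR (ger0_norm (ltW (s0 k))) -/m.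
have -> : 4 * (e' * (2 * m * s k) * (m * s k)) = e' * (8 * m ^+ 2) * s k ^+ 2 by ring.
rewrite ler_wpM2r ?sqr_ge0// /e' mulrAC ler_pdivrMr//.
by apply: ler_wpM2l; [exact: ltW|rewrite lerDl].
Qed.

End Goursat.

(** The supremum of the times up to which [P] holds throughout is again such a time by the first
    hypothesis, and by the second it cannot stop short. At [t = a] the premise of the first
    hypothesis is vacuous, so that hypothesis also contains the base case. *)
Lemma real_induction (R : realType) (a b : R) (P : R -> Prop) :
  (forall t, a <= t <= b -> (forall s, a <= s < t -> P s) -> P t) ->
  (forall t, a <= t < b -> (forall s, a <= s <= t -> P s) ->
    exists2 d, 0 < d & forall s, t < s < t + d -> s <= b -> P s) ->
  forall t, a <= t <= b -> P t.
Proof.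
move=> Pl Pr t0 ht0; apply: contrapT => nP.
pose S := [set t | a <= t <= b /\ forall s, a <= s <= t -> P s].
have Sa : S a.
  split; first by rewrite lexx; case/andP: ht0 => h1 h2; exact: le_trans h2.
  move=> s /le_anti <-; apply: Pl.
    by rewrite lexx; case/andP: ht0 => h1 h2; exact: le_trans h2.
  by move=> s' /andP[h1 /(le_lt_trans h1)]; rewrite ltxx.
have uS : ubound S t0.
  move=> t [ht h]; rewrite leNgt; apply/negP => tt.
  by apply: nP; apply: h; case/andP: ht0 => -> _; exact: ltW.
have hS : has_sup S by split; [exists a|exists t0].
pose m := sup S.
have am : a <= m by apply: ub_le_sup; [exact: hS.2|].
have mt : m <= t0 by apply: ge_sup; [exact: hS.1|].
have Pm' s : a <= s < m -> P s.
  case/andP => h1 h2.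
  have ms : 0 < m - s by rewrite subr_gt0.
  have [t [_ ht] st] := sup_adherent ms hS.
  by apply: ht; rewrite h1 ltW// (le_lt_trans _ st)// opprB addrC subrK.
have mb : m <= b by rewrite (le_trans mt)//; case/andP: ht0.
have Pm : P m by apply: Pl => //; rewrite am.
have Pm2 s : a <= s <= m -> P s.
  case/andP => h1; rewrite le_eqVlt => /orP[/eqP->//|h2].
  by apply: Pm'; rewrite h1.
have mt0 : m < t0.
  by rewrite lt_neqAle mt andbT; apply/eqP => e; apply: nP; rewrite -e.
have mb' : m < b by rewrite (lt_le_trans mt0)//; case/andP: ht0.
have [|d d0 hd] := Pr m _ Pm2; first by rewrite am.
pose t := Num.min (m + d / 2) b.
have mlt : m < t by rewrite lt_min mb' ltrDl divr_gt0.
suff : S t by move=> /(ub_le_sup hS.2); rewrite leNgt mlt.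
split; first by rewrite (le_trans am (ltW mlt)) ge_min lexx orbT.
move=> s /andP[h1 h2]; have [sm|ms] := leP s m; first by apply: Pm2; rewrite h1.
move: h2; rewrite le_min => /andP[h2 h3]; apply: hd => //.
by rewrite ms (le_lt_trans h2)// ltrD2l ltr_pdivrMr// ltr_pMr// ltr1n.
Qed.

(** * Shrinking a square around an interior singularity *)

Section Cauchy.
Context {R : realType}.
Local Notation C := (Cplane R).
Implicit Types (f g k : C -> C) (p w l : C) (L : R).

(* p lies at one third of the side: it is never on a side of a square obtained
   by successive bisections, and two bisections reproduce the picture at the
   scale 1/4. *)
Definition crn p L : C := p - (L / 3)%:C * (1 + 'i).

Lemma inSq_crn p L w : inSq (crn p L) L%:C w <-> exists x y : R,
  [/\ - 3^-1 <= x <= 2 / 3, - 3^-1 <= y <= 2 / 3 &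
      w = p + L%:C * (x%:C + 'i * y%:C)].
Proof.
split=> [[x [y [hx hy ->]]]|[x [y [hx hy ->]]]].
  exists (x - 3^-1), (y - 3^-1); split; [lra|lra|].
  by rewrite /crn !rmorphB !rmorphM /= fmorphV /= rmorph_nat; ring.
exists (x + 3^-1), (y + 3^-1); split; [lra|lra|].
by rewrite /crn !rmorphD !rmorphM /= fmorphV /= rmorph_nat; ring.
Qed.

Lemma bdSq_crn p L w : 0 < L -> bdSq (crn p L) L%:C w ->
  L / 3 <= nm (w - p) <= 2 * L.
Proof.
move=> L0 [x [y [hx hy xy ->]]].
have -> : crn p L + L%:C * (x%:C + 'i * y%:C) - p =
    L%:C * ((x - 3^-1)%:C + 'i * (y - 3^-1)%:C).
  by rewrite /crn !rmorphB !rmorphM /= fmorphV /= rmorph_nat; ring.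
rewrite nmM nmR gtr0_norm//; set q := _ + _.
have qR : complex.Re q = x - 3^-1 by rewrite /q /=; ring.
have qI : complex.Im q = y - 3^-1 by rewrite /q /=; ring.
rewrite [2 * L]mulrC ler_pM2l// ler_pM2l//; apply/andP; split; last first.
  rewrite (le_trans (nm_le_ReIm _))// qR qI.
  have -> : 2 = 1 + 1 :> R by [].
  by rewrite lerD// ler_norml; lra.
have h1 := nm_Re q; have h2 := nm_Im q; rewrite qR in h1; rewrite qI in h2.
case/orP: xy => [/orP[/orP[]|]|] /eqP e; [rewrite (le_trans _ h1)//|rewrite (le_trans _ h1)//
   |rewrite (le_trans _ h2)//|rewrite (le_trans _ h2)//];
  rewrite e ler_normr; apply/orP; [right|left|right|left]; lra.
Qed.

(** In coordinates centred at [p] and scaled by [L], the subsquare is [u, u+h] x [v, v+h]. The last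
    hypothesis says that it misses the origin, so that [goursat] applies even though [k] may be
    singular at [p]. *)
Lemma sq_small_off k p L (u v h e : R) : 0 < L -> 0 < e -> 0 < h ->
  (forall w, w != p -> inSq (crn p L) L%:C w -> derivable k w 1) ->
  - 3^-1 <= u -> u + h <= 2 / 3 -> - 3^-1 <= v -> v + h <= 2 / 3 ->
  [|| 0 < u, u + h < 0, 0 < v | v + h < 0] ->
  sq_small k (p + L%:C * (u%:C + 'i * v%:C)) (L * h)%:C e.
Proof.
move=> L0 e0 h0 dk u1 u2 v1 v2 off; apply: goursat => // w [x [y [hx hy ->]]].
have -> : p + L%:C * (u%:C + 'i * v%:C) + (L * h)%:C * (x%:C + 'i * y%:C) =
   p + L%:C * ((u + h * x)%:C + 'i * (v + h * y)%:C).
  by rewrite !rmorphD !rmorphM /=; ring.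
case/andP: hx => x0 x1; case/andP: hy => y0 y1.
have hx0 : 0 <= h * x by rewrite mulr_ge0// ltW.
have hx1 : h * x <= h by rewrite ler_piMr// ltW.
have hy0 : 0 <= h * y by rewrite mulr_ge0// ltW.
have hy1 : h * y <= h by rewrite ler_piMr// ltW.
apply: dk; last by apply/inSq_crn; exists (u + h * x), (v + h * y); split; [lra|lra|].
rewrite -subr_eq0 addrC addKr mulf_eq0 negb_or.
have -> : L%:C != 0 :> C by rewrite -(rmorph0 (real_complex R)) (inj_eq (@complexI R)) gt_eqF.
apply/eqP => /(congr1 (fun z => (complex.Re z, complex.Im z))) /= [] e1 e2.
have {}e1 : u + h * x = 0 by rewrite -[RHS]e1; ring.
have {}e2 : v + h * y = 0 by rewrite -[RHS]e2; ring.
by case/or4P: off; lra.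
Qed.

(** One stage bisects twice: [p] lies in the lower left half-size square, at two thirds of its side,
    and then in the upper right quarter of that, again at one third. The six other squares avoid [p]
    and are negligible. Two bisections per stage explain the depth [n + j.*2]. *)
Lemma sq_crn_descend k p (j : nat) L (e : R) : 0 < L -> 0 < e ->
  (forall w, w != p -> inSq (crn p L) L%:C w -> derivable k w 1) ->
  exists N, forall n, (N <= n)%N ->
    nm (sq k (n + j.*2) (crn p L) L%:C) <=
    nm (sq k n (crn p (L / 4 ^+ j)) (L / 4 ^+ j)%:C) + e.
Proof.
elim: j L e => [|j IH] L e L0 e0 dk.
  by exists 0%N => n _; rewrite addn0 expr0 divr1 lerDl ltW.
(* Half of [e] goes to the remaining stages; the six discarded squares take [e / 14] each, which is
   less than the other half. *)
have e20 : 0 < e / 2 by rewrite divr_gt0.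
have e70 : 0 < e / 14 by rewrite divr_gt0.
have L40 : 0 < L / 4 by rewrite divr_gt0.
have [w wp hw|N1 h1] := IH (L / 4) (e / 2) L40 e20.
  apply: dk => //; move/inSq_crn : hw => [x [y [hx hy ->]]]; apply/inSq_crn.
  exists (x / 4), (y / 4); split; [lra|lra|].
  by rewrite !rmorphM /= fmorphV /= rmorph_nat; field.
have S (u v h : R) z : 0 < h -> - 3^-1 <= u -> u + h <= 2 / 3 ->
    - 3^-1 <= v -> v + h <= 2 / 3 ->
    [|| 0 < u, u + h < 0, 0 < v | v + h < 0] ->
    z = p + L%:C * (u%:C + 'i * v%:C) -> sq_small k z (L * h)%:C (e / 14).
  by move=> h0 ? ? ? ? ? ->; exact: sq_small_off.
have EH : L%:C / 2 = (L * 2^-1)%:C by rewrite rmorphM /= fmorphV /= rmorph_nat.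
have EK : L%:C / 2 / 2 = (L * 4^-1)%:C.
  by rewrite rmorphM /= fmorphV /= rmorph_nat; field.
have [A1 a1] : sq_small k (crn p L + L%:C / 2) (L * 2^-1)%:C (e / 14).
  apply: (@S (6^-1) (- 3^-1)); [lra..|by apply/orP; left; lra|].
  by rewrite /crn rmorphN !rmorphM /= !fmorphV /= !rmorph_nat; field.
have [A2 a2] : sq_small k (crn p L + L%:C / 2 + 'i * (L%:C / 2)) (L * 2^-1)%:C (e / 14).
  apply: (@S (6^-1) (6^-1)); [lra..|by apply/orP; left; lra|].
  by rewrite /crn !rmorphM /= !fmorphV /= !rmorph_nat; field.
have [A3 a3] : sq_small k (crn p L + 'i * (L%:C / 2)) (L * 2^-1)%:C (e / 14).
  apply: (@S (- 3^-1) (6^-1)); [lra..|by apply/or4P; apply: Or43; lra|].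
  by rewrite /crn rmorphN !rmorphM /= !fmorphV /= !rmorph_nat; field.
have [A4 a4] : sq_small k (crn p L) (L * 4^-1)%:C (e / 14).
  apply: (@S (- 3^-1) (- 3^-1)); [lra..|by apply/or4P; apply: Or42; lra|].
  by rewrite /crn rmorphN !rmorphM /= !fmorphV /= !rmorph_nat; field.
have [A5 a5] : sq_small k (crn p L + L%:C / 2 / 2) (L * 4^-1)%:C (e / 14).
  apply: (@S (- 12^-1) (- 3^-1)); [lra..|by apply/or4P; apply: Or44; lra|].
  by rewrite /crn !rmorphN !rmorphM /= !fmorphV /= !rmorph_nat; field.
have [A6 a6] : sq_small k (crn p L + 'i * (L%:C / 2 / 2)) (L * 4^-1)%:C (e / 14).
  apply: (@S (- 3^-1) (- 12^-1)); [lra..|by apply/or4P; apply: Or42; lra|].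
  by rewrite /crn !rmorphN !rmorphM /= !fmorphV /= !rmorph_nat; field.
exists (maxn N1 (maxn (maxn A1 (maxn A2 A3)) (maxn A4 (maxn A5 A6)))) => n.
rewrite !geq_max => /and3P[/h1 l1 /and3P[n1 n2 n3] /and3P[n4 n5 n6]].
rewrite doubleS !addnS sqS /= [sq k _.+1 (crn p L) _]sqS /= EK EH.
have -> : crn p L + (L * 4^-1)%:C + 'i * (L * 4^-1)%:C = crn p (L / 4).
  by rewrite /crn !rmorphM /= !fmorphV /= !rmorph_nat; field.
have {}a1 := a1 (n + j.*2).+1 (leq_trans n1 (leq_trans (leq_addr _ _) (leqnSn _))).
have {}a2 := a2 (n + j.*2).+1 (leq_trans n2 (leq_trans (leq_addr _ _) (leqnSn _))).
have {}a3 := a3 (n + j.*2).+1 (leq_trans n3 (leq_trans (leq_addr _ _) (leqnSn _))).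
have {}a4 := a4 (n + j.*2)%N (leq_trans n4 (leq_addr _ _)).
have {}a5 := a5 (n + j.*2)%N (leq_trans n5 (leq_addr _ _)).
have {}a6 := a6 (n + j.*2)%N (leq_trans n6 (leq_addr _ _)).
rewrite EK EH in a1 a2 a3 a4 a5 a6.
have -> : L / 4 ^+ j.+1 = L / 4 / 4 ^+ j by rewrite exprS invfM mulrA.
set q := sq k n _ _ in l1 *.
set s1 := sq k _ _ _ in a1; set s2 := sq k _ _ _ in a2.
set s3 := sq k _ _ _ in a3; set s4 := sq k _ _ _ in a4.
set s5 := sq k _ _ _ in a5; set s6 := sq k _ _ _ in a6.
set s0 := sq k _ _ _ in l1.
set bigsum := (X in nm X <= _).
have -> : bigsum = s0 + (s4 + s5 + s6 + s1 + s2 + s3).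
  by rewrite /bigsum -/s0 -/s1 -/s2 -/s3 -/s4 -/s5 -/s6; ring.
have := nmD s0 (s4 + s5 + s6 + s1 + s2 + s3).
have := nmD (s4 + s5 + s6 + s1 + s2) s3.
have := nmD (s4 + s5 + s6 + s1) s2.
have := nmD (s4 + s5 + s6) s1.
have := nmD (s4 + s5) s6.
have := nmD s4 s5.
lra.
Qed.

End Cauchy.

(** * Cauchy's estimate for the derivative and the resulting Lipschitz bound *)

Section CauchyEstimate.
Context {R : realType}.
Local Notation C := (Cplane R).
Implicit Types (f g k : C -> C) (p w l : C) (L : R).

Lemma invc_xy (x y : R) : (x%:C + 'i * y%:C : C)^-1 =
  (x / (x ^+ 2 + y ^+ 2))%:C - 'i * (y / (x ^+ 2 + y ^+ 2))%:C.
Proof.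
have -> : x%:C + 'i * y%:C = x +i* y :> C by rewrite [RHS]complexE.
by rewrite [LHS]complexE /= rmorphN mulrN.
Qed.

(** Each of the four sides contributes at least 1/2 to the imaginary part. In units of [L] the side
    is at distance x = 1/3 or 2/3 from [p] and y ranges within [-1/3, 2/3], so that x / (x^2 + y^2)
    is at least 3/5 or 3/4. *)
Lemma nm_sq_inv n p L : 0 < L ->
  2 <= nm (sq (fun w => (w - p)^-1) n (crn p L) L%:C).
Proof.
move=> L0.
have Ln0 : L%:C != 0 :> C.
  by rewrite -(rmorph0 (real_complex R)) (inj_eq (@complexI R)) gt_eqF.
have crnE (x y : R) : crn p L + L%:C * (x%:C + 'i * y%:C) - p =
    L%:C * ((x - 3^-1)%:C + 'i * (y - 3^-1)%:C).
  by rewrite /crn !rmorphB !rmorphM /= fmorphV /= rmorph_nat; ring.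
have Q (x y : R) : (x = - 3^-1 \/ x = 2 / 3) -> - 3^-1 <= y -> y <= 2 / 3 ->
    2^-1 <= `|x| / (x ^+ 2 + y ^+ 2).
  move=> hx y1 y2; have yy : y ^+ 2 <= 4 / 9 by nra.
  have yy0 : 0 <= y ^+ 2 by exact: sqr_ge0.
  case: hx => ->; rewrite ?normrN gtr0_norm ?divr_gt0 ?invr_gt0// ler_pdivlMr.
  - by rewrite sqrrN; lra.
  - by rewrite sqrrN ltr_pwDl// exprn_gt0// invr_gt0.
  - by have -> : (2 / 3 : R) ^+ 2 = 4 / 9 by [field]; lra.
  - by rewrite ltr_pwDl// exprn_gt0// divr_gt0.
have I (x y : R) : complex.Im ((x%:C + 'i * y%:C : C)^-1) = - (y / (x ^+ 2 + y ^+ 2)).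
  by rewrite invc_xy /=; ring.
have I2 (x y : R) : complex.Im ('i * (x%:C + 'i * y%:C : C)^-1) = x / (x ^+ 2 + y ^+ 2).
  by rewrite invc_xy /=; ring.
have ImD (x y : C) : complex.Im (x + y) = complex.Im x + complex.Im y.
  by case: x; case: y.
have ImN (x : C) : complex.Im (- x) = - complex.Im x by case: x.
apply: le_trans (nm_Im _); apply: le_trans (ler_norm _).
have -> : 2 = 2^-1 + 2^-1 + 2^-1 + 2^-1 :> R by field.
rewrite /sq !ImD; apply: lerD; [apply: lerD; [apply: lerD|]|];
  apply: seg_Im => t t0 t1.
- have -> : crn p L + t%:C * (crn p L + L%:C - crn p L) - p =
     L%:C * ((t - 3^-1)%:C + 'i * (- 3^-1)%:C).
    by have := crnE t 0; rewrite rmorph0 sub0r => <-; ring.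
  rewrite addrAC subrr add0r invfM mulVKf// I.
  rewrite -mulNr opprK addrC -{1}(@ger0_norm _ 3^-1) ?invr_ge0// -normrN.
  by apply: Q; [left|lra|lra].
- have -> : crn p L + L%:C + t%:C * (crn p L + L%:C + 'i * L%:C - (crn p L + L%:C)) - p
     = L%:C * ((2 / 3)%:C + 'i * (t - 3^-1)%:C).
    have -> : 2 / 3 = 1 - 3^-1 :> R by field.
    by have := crnE 1 t; rewrite rmorph1 => <-; ring.
  rewrite addrAC subrr add0r invfM -mulrA mulVKf// I2 -{1}(@ger0_norm _ (2 / 3)) ?divr_ge0//.
  by apply: Q; [right|lra|lra].
- have -> : crn p L + L%:C + 'i * L%:C +
      t%:C * (crn p L + 'i * L%:C - (crn p L + L%:C + 'i * L%:C)) - p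
     = L%:C * ((2 / 3 - t)%:C + 'i * (2 / 3)%:C).
    have -> : 2 / 3 - t = (1 - t) - 3^-1 :> R by field.
    have -> : 2 / 3 = 1 - 3^-1 :> R by field.
    by have := crnE (1 - t) 1; rewrite rmorphB rmorph1 => <-; ring.
  have -> : crn p L + 'i * L%:C - (crn p L + L%:C + 'i * L%:C) = - L%:C by ring.
  rewrite invfM mulNr mulVKf// ImN I opprK.
  rewrite addrC -{1}(@ger0_norm _ (2 / 3)) ?divr_ge0//.
  by apply: Q; [right|lra|lra].
- have -> : crn p L + 'i * L%:C + t%:C * (crn p L - (crn p L + 'i * L%:C)) - p
     = L%:C * ((- 3^-1)%:C + 'i * (2 / 3 - t)%:C).
    have -> : 2 / 3 - t = (1 - t) - 3^-1 :> R by field.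
    by have := crnE 0 (1 - t); rewrite rmorphB rmorph1 rmorph0 sub0r => <-; ring.
  have -> : crn p L - (crn p L + 'i * L%:C) = - ('i * L%:C) by ring.
  rewrite invfM mulNr -mulrA mulVKf// ImN I2.
  rewrite -mulNr opprK -{1}(@ger0_norm _ 3^-1) ?invr_ge0// -normrN.
  by apply: Q; [left|lra|lra].
Qed.

(** Dividing f w - f p = l (w - p) + o(w - p) by (w - p)^2 splits [g] as [l] times 1/(w - p) plus
    [k]. The sums of [k] are small since [k] is o(1/|w - p|) on small squares; those of 1/(w - p)
    are at least 2 in modulus, and those of [g] are controlled by [M]. *)
Lemma derivative_bound f p l L (M : R) : 0 < L ->
  (forall w, nm (w - p) <= 2 * L -> derivable f w 1) ->
  (forall w, nm (w - p) <= 2 * L -> nm (f w) <= M) ->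
  hd f p l -> nm l <= 36 * M / L.
Proof.
move=> L0 df fM hl.
have inQ w : inSq (crn p L) L%:C w -> nm (w - p) <= 2 * L.
  move/inSq_crn => [x [y [hx hy ->]]].
  rewrite addrC addKr nmM nmR gtr0_norm// mulrC ler_pM2r//.
  rewrite (le_trans (nmD _ _))// nmM nmi mul1r !nmR.
  have -> : 2 = 1 + 1 :> R by [].
  by rewrite lerD// ler_norml; lra.
pose k w := (f w - f p - l * (w - p)) / (w - p) ^+ 2.
have dk w : w != p -> inSq (crn p L) L%:C w -> derivable k w 1.
  move=> wp /inQ /df dfw.
  have dB : derivable (fun w => w - p) w 1.
    exact (derivable_subC (derivable_idC w) (derivable_cstC p w)).
  apply: (@derivable_mulC _ (fun w => f w - f p - l * (w - p))
                            (fun w => ((w - p) * (w - p))^-1) w).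
    apply: (@derivable_subC _ (fun w => f w - f p) (fun w => l * (w - p)) w).
      exact (derivable_subC dfw (derivable_cstC (f p) w)).
    exact (derivable_mulC (derivable_cstC l w) dB).
  apply: (@derivable_invC _ (fun w => (w - p) * (w - p)) w).
    by rewrite mulf_neq0// subr_eq0.
  exact (derivable_mulC dB dB).
have ksmall (e : R) : 0 < e -> sq_small k (crn p L) L%:C e.
  move=> e0.
  (* On the boundary of the square of side [Lj] the distance to [p] is at least [Lj / 3], hence
     [nm (k w) <= e / 24 * (3 / Lj)]; the perimeter [4 * Lj] turns this into [e / 2]. *)
  have e24 : 0 < e / 24 by rewrite divr_gt0.
  have [d d0 dP] := hl _ e24.
  have [j hj] : exists j, (2^-1 : R) ^+ j < d / (2 * L).
    by apply: half_pow_lt; rewrite divr_gt0// mulr_gt0.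
  pose Lj := L / 4 ^+ j.
  have Lj0 : 0 < Lj by rewrite divr_gt0// exprn_gt0.
  have Ljd : 2 * Lj < d.
    move: hj; rewrite ltr_pdivlMr ?mulr_gt0//; apply: le_lt_trans.
    rewrite /Lj -exprVn.
    have -> : 2 * (L * 4^-1 ^+ j) = 4^-1 ^+ j * (2 * L) by ring.
    rewrite ler_pM2r ?mulr_gt0//; apply: lerXn2r; rewrite ?nnegrE ?invr_ge0//.
    by rewrite lef_pV2 ?posrE// ler_nat.
  have [N hN] := @sq_crn_descend R k p j L (e / 2) L0 ltac:(by rewrite divr_gt0) dk.
  exists (N + j.*2)%N => n nN.
  have jn : (j.*2 <= n)%N by rewrite (leq_trans _ nN)// leq_addl.
  rewrite -(subnK jn); apply: le_trans (hN _ _) _; first by rewrite leq_subRL// addnC.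
  rewrite [e in leRHS]splitr lerD2r -/Lj.
  have kb w : bdSq (crn p Lj) Lj%:C w -> nm (k w) <= e / 24 * (3 / Lj).
    move=> /(bdSq_crn Lj0) /andP[w1 w2].
    have wp0 : 0 < nm (w - p) by rewrite (lt_le_trans _ w1)// divr_gt0.
    have wd : nm (w - p) < d by rewrite (le_lt_trans w2).
    rewrite /k nmM nmV expr2 nmM ler_pdivrMr ?mulr_gt0//.
    apply: (le_trans (dP w wd)).
    set x := nm (w - p) in wp0 w1 *.
    have -> : e / 24 * (3 / Lj) * (x * x) = e / 24 * (3 / Lj * x) * x by ring.
    rewrite ler_pM2r// ler_peMr ?(ltW e24)//.
    by rewrite mulrAC ler_pdivlMr// mul1r; lra.
  apply: (le_trans (sq_bound _ kb)).
  by rewrite nmR gtr0_norm// -[_ * _ * Lj]mulrA divfK ?gt_eqF//; lra.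
(* Here 72 / L is the perimeter [4 * L] times the bound [2 * M * (9 / L ^+ 2)] for [g], without its
   factor [M]. *)
have main (e : R) : 0 < e -> nm l * 2 <= 72 * M / L + e.
  move=> e0; have [N hN] := ksmall e e0.
  have {hN} hN := hN N (leqnn _).
  pose g w := (f w - f p) / (w - p) ^+ 2.
  have E : l * sq (fun w => (w - p)^-1) N (crn p L) L%:C =
      sq g N (crn p L) L%:C - sq k N (crn p L) L%:C.
    rewrite -sqZ -sqB; apply: sq_ext => w /(bdSq_crn L0)/andP[w1 _].
    have wp0 : w - p != 0.
      by apply/eqP => z; move: w1; rewrite z nm0 leNgt divr_gt0.
    by rewrite /g /k; field.
  apply: le_trans (_ : nm l * nm (sq (fun w => (w - p)^-1) N (crn p L) L%:C) <= _).
    by rewrite ler_wpM2l ?nm_ge0// nm_sq_inv.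
  rewrite -nmM E (le_trans (nmB _ _))// lerD//.
  have M0 : 0 <= M.
    apply: le_trans (fM p _); first exact: nm_ge0.
    by rewrite subrr nm0 mulr_ge0// ltW.
  have gb w : bdSq (crn p L) L%:C w -> nm (g w) <= 2 * M * (9 / L ^+ 2).
    move=> hw; have /andP[w1 w2] := bdSq_crn L0 hw.
    have wp0 : 0 < nm (w - p) by rewrite (lt_le_trans _ w1)// divr_gt0.
    rewrite /g nmM nmV; apply: ler_pM; rewrite ?nm_ge0// ?invr_ge0 ?nm_ge0//.
      rewrite (le_trans (nmB _ _))// mulrDl mul1r lerD// fM//.
      by rewrite subrr nm0 mulr_ge0// ltW.
    rewrite -[leRHS]invrK lef_pV2 ?posrE ?invr_gt0 ?divr_gt0 ?exprn_gt0//; last first.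
      by rewrite expr2 nmM mulr_gt0.
    have -> : (9 / L ^+ 2)^-1 = (L / 3) * (L / 3).
      by field; rewrite gt_eqF.
    by rewrite expr2 nmM ler_pM// divr_ge0// ltW.
  apply: le_trans (sq_bound _ gb) _; rewrite nmR gtr0_norm//.
  rewrite le_eqVlt; apply/orP; left; apply/eqP; field.
  by rewrite gt_eqF.
suff : nm l * 2 <= 72 * M / L.
  by have -> : 72 * M / L = 36 * M / L * 2 by [ring]; rewrite ler_pM2r.
by apply/ler_addgt0Pr => e /main.
Qed.

(** Every point of the segment is the centre of a disc of radius [r / 2] inside the given one, so
    [derivative_bound] with [L = r / 4] yields the constant 144 = 36 * 4. The mean value inequality
    then follows by real induction along the segment. *)
Lemma cauchy_lipschitz f (c : C) (r M : R) : 0 < r ->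
  (forall w, nm (w - c) < r -> derivable f w 1) ->
  (forall w, nm (w - c) < r -> nm (f w) <= M) ->
  forall y1 y2, nm (y1 - c) < r / 2 -> nm (y2 - c) < r / 2 ->
    nm (f y1 - f y2) <= 144 * M / r * nm (y1 - y2).
Proof.
move=> r0 df fM y2 y1 h2 h1.
have M0 : 0 <= M.
  by apply: le_trans (fM c _); [exact: nm_ge0|rewrite subrr nm0].
set B := 144 * M / r.
pose v := y2 - y1.
pose y (t : R) := y1 + t%:C * v.
have yr t : 0 <= t <= 1 -> nm (y t - c) < r / 2.
  move=> /andP[t0 t1].
  have -> : y t - c = (1 - t)%:C * (y1 - c) + t%:C * (y2 - c).
    by rewrite /y /v rmorphB rmorph1; ring.
  rewrite (le_lt_trans (nmD _ _))// !nmM !nmR !ger0_norm ?subr_ge0//.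
  move: h1 h2; set a := nm _; set b := nm _ => h1 h2.
  have [->|tp] := eqVneq t 0; first by rewrite subr0 mul1r mul0r addr0.
  have {}tp : 0 < t by rewrite lt_neqAle eq_sym tp.
  have -> : r / 2 = (1 - t) * (r / 2) + t * (r / 2) by ring.
  by rewrite ler_ltD// ?ltr_pM2l// ler_wpM2l ?subr_ge0// ltW.
apply/ler_addgt0Pr => e e0.
have [v0|vn0] := eqVneq v 0.
  have -> : y2 = y1 by apply/eqP; rewrite -subr_eq0 -/v v0.
  by rewrite !subrr !nm0 mulr0 add0r ltW.
have nv : 0 < nm v by exact: nm_gt0.
(* The slope is raised slightly above [B] to absorb the error of the first order expansion; over the
   whole segment this costs [e]. *)
pose K := B + e / nm v.
have e'0 : 0 < e / nm v by rewrite divr_gt0.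
have B0 : 0 <= B by rewrite /B divr_ge0 ?mulr_ge0// ltW.
have K0 : 0 < K by rewrite ltr_wpDl.
have -> : B * nm v + e = K * 1 * nm v.
  by rewrite /K mulr1 mulrDl divfK// gt_eqF.
have y0E : y 0 = y1 by rewrite /y rmorph0 mul0r addr0.
have y1E : y 1 = y2 by rewrite /y rmorph1 mul1r /v addrC subrK.
have yB s t : nm (y s - y t) = `|s - t| * nm v.
  by rewrite /y opprD addrACA subrr add0r -mulrBl -rmorphB nmM nmR.
rewrite -y1E -y0E.
apply: (@real_induction R 0 1 (fun t => nm (f (y t) - f (y 0)) <= K * t * nm v)).
- move=> t ht IH.
  have [->|tn0] := eqVneq t 0.
    by rewrite subrr nm0 mulr0 mul0r.
  have tp : 0 < t by rewrite lt_neqAle eq_sym tn0; case/andP: ht.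
  apply/ler_addgt0Pr => a a0.
  have ytr := yr t ht.
  have dft : derivable f (y t) 1.
    by apply: df; rewrite (lt_trans ytr)// ltr_pdivrMr// ltr_pMr// ltr1n.
  have [d d0 dP] := derivable_cont dft a0.
  pose s := Num.max 0 (t - d / (2 * nm v)).
  have hs : 0 <= s < t.
    by rewrite le_max lexx /= gt_max tp ltrBlDr ltrDl divr_gt0// mulr_gt0.
  have sd : nm (y s - y t) < d.
    rewrite yB distrC ger0_norm; last by rewrite subr_ge0; case/andP: hs => _ /ltW.
    rewrite -ltr_pdivlMr// ltrBlDl -ltrBlDr.
    rewrite lt_max; apply/orP; right.
    rewrite ltrD2l ltrN2 ltr_pM2l// ltf_pV2 ?posrE ?mulr_gt0//.
    by rewrite ltr_pMl// ltr1n.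
  have h := IH s hs; have h' := dP _ sd.
  have := nm_tri (f (y s)) (f (y t)) (f (y 0)).
  rewrite nmC in h'.
  have : K * s * nm v <= K * t * nm v.
    by rewrite ler_pM2r// ler_pM2l// ltW//; case/andP: hs.
  lra.
- move=> t ht IH.
  have ht1 : 0 <= t <= 1 by case/andP: ht => -> /ltW.
  have ytr := yr t ht1.
  have rr w : nm (w - y t) <= 2 * (r / 4) -> nm (w - c) < r.
    move=> h; have := nm_tri (y t) w c; lra.
  have dft : derivable f (y t) 1.
    by apply: df; apply: rr; rewrite subrr nm0; lra.
  have /derivable_hd[l hl] := dft.
  have lB : nm l <= B.
    have -> : B = 36 * M / (r / 4) by rewrite /B; field; rewrite gt_eqF.
    apply: (@derivative_bound f (y t) l (r / 4) M _ _ _ hl).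
    - by rewrite divr_gt0.
    - by move=> w hw; apply: df; exact: rr.
    - by move=> w hw; apply: fM; exact: rr.
  have [d d0 dP] := hl _ e'0.
  exists (d / nm v); first by rewrite divr_gt0.
  move=> s /andP[ts sd] s1.
  have st0 : 0 <= s - t by rewrite subr_ge0 ltW.
  have sd' : nm (y s - y t) < d.
    by rewrite yB ger0_norm// -ltr_pdivlMr// ltrBlDl.
  have h := dP _ sd'.
  have k2 : nm (f (y s) - f (y t)) <= K * (s - t) * nm v.
    have -> : f (y s) - f (y t) = (f (y s) - f (y t) - l * (y s - y t)) + l * (y s - y t).
      by rewrite subrK.
    rewrite (le_trans (nmD _ _))// nmM -mulrA.
    rewrite -[(s - t) * nm v](_ : nm (y s - y t) = _); last by rewrite yB ger0_norm.
    by rewrite /K addrC mulrDl lerD// ler_wpM2r ?nm_ge0.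
  have k3 : nm (f (y t) - f (y 0)) <= K * t * nm v.
    by apply: IH; rewrite lexx andbT; case/andP: ht.
  have := nm_tri (f (y t)) (f (y s)) (f (y 0)).
  have : K * s * nm v = K * (s - t) * nm v + K * t * nm v by ring.
  lra.
- by rewrite ler01 lexx.
Qed.

End CauchyEstimate.

(** * A bounded univalent function on a simply connected domain *)

Section SquareRootPaths.
Context {R : realType}.
Local Notation C := (Cplane R).

(** Paths are continuous on the whole line, so that clamping the parameter with [Num.min] and
    [Num.max] gives concatenations without any gluing. *)
Definition path_cont (g : R -> C) := forall x (e : R), 0 < e ->
  exists2 d : R, 0 < d & forall y, `|y - x| < d -> nm (g y - g x) < e.

Lemma path_cont_within (g : R -> C) (A : set R) :
  path_cont g -> {within A, continuous g}.
Proof.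
move=> cg; apply: continuous_subspaceT => x B /nbhsC[e e0 eB].
have [d d0 dP] := cg x e e0.
apply/nbhs_ballP; exists d => // y; rewrite /ball /= distrC => /dP; exact: eB.
Qed.

(** This is the concatenation of [g] and [h] when [g 1 = h 0]: on each half of [0, 1] one of the two
    terms is constant and equal to [h 0], which the last term cancels. *)
Lemma path_cont_cat (g h : R -> C) : path_cont g -> path_cont h ->
  path_cont (fun x => g (Num.min (2 * x) 1) + h (Num.max (2 * x - 1) 0) - h 0).
Proof.
move=> cg ch x e e0; have e20 : 0 < e / 2 by rewrite divr_gt0.
have [d1 d10 h1] := cg (Num.min (2 * x) 1) _ e20.
have [d2 d20 h2] := ch (Num.max (2 * x - 1) 0) _ e20.
exists (Num.min d1 d2 / 2); first by rewrite divr_gt0// lt_min d10.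
move=> y; rewrite ltr_pdivlMr// lt_min => /andP[y1 y2].
have -> : g (Num.min (2 * y) 1) + h (Num.max (2 * y - 1) 0) - h 0 -
          (g (Num.min (2 * x) 1) + h (Num.max (2 * x - 1) 0) - h 0) =
  (g (Num.min (2 * y) 1) - g (Num.min (2 * x) 1)) +
  (h (Num.max (2 * y - 1) 0) - h (Num.max (2 * x - 1) 0)) by ring.
rewrite (le_lt_trans (nmD _ _))// [e]splitr ltrD//.
  apply: h1; apply: le_lt_trans y1; rewrite !minEle.
  by do 2 case: ifPn; rewrite -?ltNge => ? ?; rewrite ler_norml;
    have := ler_norm (y - x); have := ler_norm (- (y - x)); rewrite normrN; lra.
apply: h2; apply: le_lt_trans y2; rewrite !maxEle.
by do 2 case: ifPn; rewrite -?ltNge => ? ?; rewrite ler_norml;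
  have := ler_norm (y - x); have := ler_norm (- (y - x)); rewrite normrN; lra.
Qed.

(** Expanding around [c] leaves an error of at most 1/4 + 1/4 + 1/16 = 9/16 of |c|^2. Positivity
    says that the arguments of [u] and [v] differ by less than a right angle. *)
Lemma Re_mulJ_gt0 (c u v : C) : c != 0 -> nm (u - c) < nm c / 4 ->
  nm (v - c) < nm c / 4 -> 0 < complex.Re (u * conjc v).
Proof.
move=> c0 hu hv; have c1 := nm_gt0 c0.
have Jn (w : C) : nm (conjc w) = nm w by case: w => x y; rewrite /nm /= sqrrN.
have -> : u * conjc v = c * conjc c + ((u - c) * conjc c + c * conjc (v - c)
   + (u - c) * conjc (v - c)) by rewrite !rmorphB /=; ring.
have -> : forall x y : C, complex.Re (x + y) = complex.Re x + complex.Re y.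
  by move=> [? ?] [? ?].
have -> : complex.Re (c * conjc c) = nm c ^+ 2.
  case: c {hu hv c0 c1} => x y; rewrite /nm /= sqr_sqrtr ?addr_ge0 ?sqr_ge0//.
  by ring.
set w := (X in complex.Re X).
have := nm_Re w; rewrite ler_norml => /andP[h _].
have : nm w <= nm c ^+ 2 * (9 / 16).
  rewrite (le_trans (nmD _ _))//.
  have -> : nm c ^+ 2 * (9 / 16) = nm c ^+ 2 * (8 / 16) + nm c / 4 * (nm c / 4).
    by field.
  rewrite lerD//; last by rewrite nmM Jn ler_pM ?nm_ge0// ltW.
  rewrite (le_trans (nmD _ _))//.
  have -> : nm c ^+ 2 * (8 / 16) = nm c / 4 * nm c + nm c * (nm c / 4) by field.
  by rewrite !nmM !Jn lerD// ?ler_wpM2r ?ler_wpM2l ?nm_ge0// ltW.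
have : 0 < nm c ^+ 2 by rewrite exprn_gt0.
lra.
Qed.

Lemma Re_mulJ_unif (F : R * R -> C) :
  {within `[0, 1] `*` `[0, 1], continuous F} ->
  (forall s x : R, s \in `[0, 1] -> x \in `[0, 1] -> F (s, x) != 0) ->
  exists2 d : R, 0 < d & forall s x y : R, s \in `[0, 1] -> x \in `[0, 1] ->
    y \in `[0, 1] -> `|y - x| < d -> 0 < complex.Re (F (s, y) * conjc (F (s, x))).
Proof.
move=> cF nF.
suff [d d0 hd] : exists2 d : R, 0 < d & forall p, (`[0, 1] `*` `[0, 1]) p ->
    forall y : R, y \in `[0, 1] -> `|y - p.2| < d ->
    0 < complex.Re (F (p.1, y) * conjc (F p)).
  by exists d => // s x y hs hx hy; apply: (hd (s, x)).
apply: (@compact_induction _ (fun A => exists2 d : R, 0 < d & forall p, A p ->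
    forall y : R, y \in `[0, 1] -> `|y - p.2| < d ->
    0 < complex.Re (F (p.1, y) * conjc (F p))) (`[0, 1] `*` `[0, 1])).
- by apply: compact_setX; exact: segment_compact.
- by exists 1.
- move=> A B [d1 d10 h1] [d2 d20 h2]; exists (Num.min d1 d2).
    by rewrite lt_min d10.
  by move=> p [Ap|Bp] y hy; rewrite lt_min => /andP[y1 y2]; [exact: h1|exact: h2].
- by move=> A B AB [d d0 h]; exists d => // p /AB; exact: h.
- move=> [s x] sx; have [/= hs hx] := sx.
  have c0 := nF _ _ hs hx; have c1 := nm_gt0 c0.
  have c4 : 0 < nm (F (s, x)) / 4 by rewrite divr_gt0.
  have W : nbhs (s, x) [set p | (`[0, 1] `*` `[0, 1]) p ->
      nm (F p - F (s, x)) < nm (F (s, x)) / 4].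
    by move/subspace_continuousP : cF => /(_ _ sx) /(_ _ (nbhs_nm _ c4)).
  move/nbhs_ballP : W => [r /= r0 hr].
  have r20 : 0 < r / 2 by rewrite divr_gt0.
  exists (ball (s, x) (r / 2)); first exact: nbhsx_ballx.
  exists (r / 2) => // -[s' x'] [[/= b1 b2] [/= hs' hx']] y hy yx.
  have r2 : r / 2 <= r by rewrite ler_pdivrMr// ler_pMr// ler1n.
  move: b1 b2; rewrite /ball /= => b1 b2.
  apply: (Re_mulJ_gt0 c0).
    apply: hr; last by split.
    split; rewrite /ball /=; first exact: lt_le_trans b1 r2.
    rewrite (le_lt_trans (ler_distD x' _ _))// [r]splitr ltrD//.
    by rewrite distrC.
  by apply: hr; split => //; rewrite /ball /=;
    [exact: lt_le_trans b1 r2|exact: lt_le_trans b2 r2].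
Qed.

End SquareRootPaths.

(** * Sign change of a square root along a null-homotopic loop *)

Section SquareRootBranch.
Context {R : realType}.
Local Notation C := (Cplane R).

Definition cont01 (f : R -> C) (s : R) := forall e : R, 0 < e ->
  exists2 d : R, 0 < d & forall t : R, t \in `[0, 1] -> `|t - s| < d -> nm (f t - f s) < e.

Lemma cont01P (f : R -> C) (s : R) :
  cont01 f s <-> f @ within [set` `[0, 1]] (nbhs s) --> f s.
Proof.
split=> [cf A /nbhsC[e e0 eA]|cf e e0].
  have [d d0 dP] := cf e e0; apply/nbhs_ballP; exists d => // t.
  by rewrite /ball /= distrC => td t01; apply: eA; apply: dP.
have W : nbhs s [set t | t \in `[0, 1] -> nm (f t - f s) < e].
  exact: (cf _ (nbhs_nm _ e0)).
move/nbhs_ballP : W => [d /= d0 dP]; exists d => // t t01 td.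
by apply: dP => //; rewrite /ball /= distrC.
Qed.

Lemma cont01_mul (f g : R -> C) s : cont01 f s -> cont01 g s ->
  cont01 (fun t => f t * g t) s.
Proof.
move=> /cont01P cf /cont01P cg; apply/cont01P.
exact: (@cvgM C R (within [set` `[0, 1]] (nbhs s)) _ f g (f s) (g s) cf cg).
Qed.

Lemma cont01_add (f g : R -> C) s : cont01 f s -> cont01 g s ->
  cont01 (fun t => f t + g t) s.
Proof.
move=> cf cg e e0; have e20 : 0 < e / 2 by rewrite divr_gt0.
have [d1 d10 h1] := cf _ e20; have [d2 d20 h2] := cg _ e20.
exists (Num.min d1 d2); first by rewrite lt_min d10.
move=> t t01; rewrite lt_min => /andP[/h1 t1 /h2 t2].
rewrite opprD addrACA (le_lt_trans (nmD _ _))// [e]splitr ltrD//.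
  exact: t1.
exact: t2.
Qed.

Lemma cont01_conj (f : R -> C) s : cont01 f s -> cont01 (fun t => conjc (f t) : C) s.
Proof.
move=> cf e e0; have [d d0 h] := cf e e0; exists d => // t t01 td.
rewrite -rmorphB; apply: le_lt_trans (h t t01 td).
by case: (f t - f s) => x y; rewrite /nm /= sqrrN.
Qed.

Lemma cont01_norm (f : R -> C) s : cont01 f s -> cont01 (fun t => (nm (f t))%:C : C) s.
Proof.
move=> cf e e0; have [d d0 h] := cf e e0; exists d => // t t01 td.
rewrite -rmorphB nmR; apply: le_lt_trans (h t t01 td).
have := nm_tri 0 (f t) (f s); have h1 := nmD (f t - f s) (f s).
have h2 := nmD (f s - f t) (f t); rewrite !subrK in h1 h2 => _.
by rewrite nmC in h2; rewrite ler_norml; rewrite nmC; move: h1 h2; rewrite nmC; lra.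
Qed.

Lemma cont01_prod n (f : 'I_n -> R -> C) s : (forall i, cont01 (f i) s) ->
  cont01 (fun t => \prod_(i < n) f i t) s.
Proof.
elim: n f => [|n IH] f cf.
  move=> e e0; exists 1 => // t _ _; by rewrite !big_ord0 subrr nm0.
have -> : (fun t => \prod_(i < n.+1) f i t) =
   (fun t => (\prod_(i < n) f (widen_ord (leqnSn n) i) t) * f ord_max t).
  by apply/funext => t; rewrite big_ord_recr.
by apply: cont01_mul => //; apply: IH => i; exact: cf.
Qed.

(** The product of the [G i.+1] is [c] times that of the [G i], and the conjugates complete the
    latter to squared moduli. It is used with [c = 1] for a closed loop and [c = -1] for a path
    between opposite points. *)
Lemma prod_mulJ n (G : nat -> C) (c : C) : G 0%N != 0 -> G n = c * G 0%N ->
  \prod_(i < n) (G i.+1 * conjc (G i)) = c * (\prod_(i < n) nm (G i) ^+ 2)%:C.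
Proof.
move=> G0 Gn; rewrite big_split /=.
have -> : \prod_(i < n) G i.+1 = c * \prod_(i < n) G i.
  apply: (mulfI G0); rewrite mulrCA.
  transitivity (\prod_(i < n.+1) G i); first by rewrite big_ord_recl.
  by rewrite big_ord_recr /= Gn; ring.
rewrite -mulrA -big_split /= rmorph_prod; congr (_ * _); apply: eq_bigr => i _.
by rewrite -sqr_normc normE rmorphXn.
Qed.

Lemma sqr_eq_pos (z : C) (c : R) : 0 < c -> z ^+ 2 = c%:C ->
  complex.Im z = 0 /\ complex.Re z != 0.
Proof.
case: z => x y c0; rewrite expr2 => /eqP; rewrite eq_complex /= => /andP[/eqP h1 /eqP h2].
have xy : x * y = 0 by lra.
move/eqP : xy; rewrite mulf_eq0 => /orP[/eqP x0|/eqP y0].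
  by move: h1; rewrite x0; nra.
by split => //; apply/eqP => x0; move: h1; rewrite x0 y0; lra.
Qed.

(** When [w] has positive real part, [w + |w|] is a positive multiple of its principal square root:
    a square root up to scale, visibly continuous in [w]. *)
Lemma sqrD_norm (w : C) :
  (w + (nm w)%:C) ^+ 2 = w * (2 * (complex.Re w + nm w))%:C.
Proof.
have h : (nm w)%:C ^+ 2 = w * conjc w :> C by rewrite -normE sqr_normc.
have k := addcJ w.
have -> : (2 * (complex.Re w + nm w))%:C = 2 * (complex.Re w)%:C + 2 * (nm w)%:C :> C.
  by rewrite mulrDr rmorphD /= !rmorphM /= rmorph_nat.
transitivity (w * (2 * (complex.Re w)%:C) + 2 * w * (nm w)%:C).
  by rewrite -k; move: h; rewrite !expr2 => h; ring: h.
by ring.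
Qed.

(** If [g 1 = - g 0], then [g ^ 2 + a] is a loop in [D], contracted by some [H] while [F = H - a]
    avoids 0. Following the square root of [F (s, .)] around each loop gives a real nonzero number
    [N s] depending continuously on [s]. It is positive for the constant loop and negative for the
    initial one, against the intermediate value theorem. *)
Lemma no_antipodal_path (D : set C) (a : C) (g : R -> C) :
  simply_connected D -> ~ D a -> path_cont g ->
  (forall x : R, x \in `[0, 1] -> D (g x ^+ 2 + a)) -> g 1 <> - g 0.
Proof.
move=> [_ sc] Da cg gD g10.
have i0 : (0 : R) \in `[0, 1] by rewrite in_itv /= lexx ler01.
have i1 : (1 : R) \in `[0, 1] by rewrite in_itv /= lexx ler01.
pose h x := g x ^+ 2 + a.
have ch : path_cont h.
  move=> x e e0.
  have [d d0 dP] := derivable_cont (derivable_mulC (derivable_idC (g x)) (derivable_idC (g x))) e0.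
  have [d' d'0 d'P] := cg x d d0; exists d' => // y /d'P /dP.
  by rewrite /h !expr2 opprD addrACA subrr addr0.
have [|H [cH HD H0 Hs]] := sc h (@path_cont_within R h _ ch) gD.
  by rewrite /h g10 sqrrN.
pose F p := H p - a.
have FD s x : s \in `[0, 1] -> x \in `[0, 1] -> F (s, x) != 0.
  move=> hs hx; rewrite subr_eq0; apply/eqP => E; apply: Da; rewrite -E.
  exact: HD.
have cF : {within `[0, 1] `*` `[0, 1], continuous F}.
  apply/subspace_continuousP => p hp A /nbhsC[e e0 eA].
  have W : nbhs p [set q | (`[0, 1] `*` `[0, 1]) q -> nm (H q - H p) < e].
    by move/subspace_continuousP : cH => /(_ _ hp) /(_ _ (nbhs_nm _ e0)).
  move/nbhs_ballP : W => [d d0 dP]; apply/nbhs_ballP; exists d => // q hq sq.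
  by apply: eA; rewrite /F opprB addrA subrK; exact: dP.
have g0 x : x \in `[0, 1] -> g x != 0.
  by move=> hx; apply/eqP => E; apply: Da; move: (gD x hx); rewrite E expr0n /= add0r.
have cG : {within `[0, 1] `*` `[0, 1], continuous (fun p : R * R => g p.2)}.
  apply: continuous_subspaceT => -[s x] A /nbhsC[e e0 eA].
  have [d d0 dP] := cg x e e0.
  apply/nbhs_ballP; exists d => // -[s' x'] [_ /=].
  by rewrite /ball /= distrC => /dP; exact: eA.
have [d1 d10 P1] := Re_mulJ_unif cF FD.
have [d2 d20 P2] := Re_mulJ_unif cG (fun s x _ hx => g0 x hx).
pose n := (Num.bound (Num.min d1 d2)^-1).+1.
have dd0 : 0 < Num.min d1 d2 by rewrite lt_min d10.
have nd : (n%:R)^-1 < Num.min d1 d2.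
  rewrite -[ltRHS]invrK ltf_pV2 ?posrE ?invr_gt0 ?ltr0n//.
  by rewrite (lt_trans (archi_boundP _)) ?ltr_nat// invr_ge0 ltW.
pose t i : R := i%:R / n%:R.
have n0 : 0 < n%:R :> R by rewrite ltr0n.
have ti i : (i <= n)%N -> t i \in `[0, 1].
  by move=> ni; rewrite in_itv /= divr_ge0 ?ler0n//= ler_pdivrMr// mul1r ler_nat.
have tS i : `|t i.+1 - t i| < Num.min d1 d2.
  by rewrite /t -mulrBl -natrB// subSnn mul1r ger0_norm ?invr_ge0// ltW.
have t0 : t 0%N = 0 by rewrite /t mul0r.
have tn : t n = 1 by rewrite /t divff// gt_eqF.
(* [w s i] has the argument of the quotient of successive values of [F], and the corresponding
   factor of [N s] is its square root up to a positive scalar. The mesh is fine enough to keep every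
   [w s i] in the right half-plane. *)
pose w s i := F (s, t i.+1) * conjc (F (s, t i)).
pose N s := \prod_(i < n) (w s i + (nm (w s i))%:C).
have wpos s (i : 'I_n) : s \in `[0, 1] -> 0 < complex.Re (w s i).
  move=> hs; apply: P1 => //; [apply: ti; exact: ltnW|exact: ti|].
  by have := tS i; rewrite lt_min => /andP[].
have pos_prod (c : nat -> R) : (forall i : 'I_n, 0 < c i) -> 0 < \prod_(i < n) c i.
  by move=> hc; apply: prodr_gt0 => i _; exact: hc.
have Nsq s : s \in `[0, 1] -> complex.Im (N s) = 0 /\ complex.Re (N s) != 0.
  move=> hs.
  apply: (@sqr_eq_pos _ ((\prod_(i < n) nm (F (s, t i)) ^+ 2) *
     \prod_(i < n) (2 * (complex.Re (w s i) + nm (w s i))))).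
    apply: mulr_gt0.
      apply: (pos_prod (fun i => nm (F (s, t i)) ^+ 2)) => i.
      by rewrite exprn_gt0// nm_gt0//; exact: FD _ _ hs (ti _ (ltnW (ltn_ord i))).
    apply: (pos_prod (fun i => 2 * (complex.Re (w s i) + nm (w s i)))) => i.
    by rewrite mulr_gt0// ltr_wpDr ?nm_ge0// wpos.
  rewrite -prodrXl; under eq_bigr do rewrite sqrD_norm.
  rewrite big_split /= (@prod_mulJ n (fun i => F (s, t i)) 1).
  - by rewrite mul1r rmorphM; congr (_ * _); rewrite rmorph_prod.
  - exact: FD _ _ hs (ti 0%N (leq0n _)).
  - by rewrite mul1r tn t0 /F; have [-> ->] := Hs s hs.
have N1 : 0 < complex.Re (N 1).
  pose q : C := h 0 - a.
  have q0 : q != 0 by rewrite /q /h addrK expf_neq0// g0.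
  have w1 i : (i < n)%N -> w 1 i = (nm q ^+ 2)%:C.
    move=> ni; rewrite /w /F (H0 _ (ti _ ni)).2 (H0 _ (ti _ (ltnW ni))).2 -/q.
    by rewrite -sqr_normc normE rmorphXn.
  have -> : N 1 = (\prod_(i < n) (nm q ^+ 2 + `|nm q ^+ 2|))%:C.
    rewrite rmorph_prod; apply: eq_bigr => i _.
    by rewrite w1// nmR rmorphD.
  rewrite /=; apply: prodr_gt0 => i _.
  by rewrite ltr_wpDr// exprn_gt0// nm_gt0.
(* At [s = 0], [w 0 i] is the square of [x i], so the factor is [x i * (x i + conjc (x i))]: a
   positive multiple of [x i]. The product of the [x i] telescopes to a positive multiple of -1. *)
have N0 : complex.Re (N 0) < 0.
  pose x i := g (t i.+1) * conjc (g (t i)).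
  have xpos (i : 'I_n) : 0 < complex.Re (x i).
    apply: (P2 0) => //; [apply: ti; exact: ltnW|exact: ti|].
    by have := tS i; rewrite lt_min => /andP[].
  have w0 i : (i < n)%N -> w 0 i = x i ^+ 2.
    move=> ni; rewrite /w /F (H0 _ (ti _ ni)).1 (H0 _ (ti _ (ltnW ni))).1.
    by rewrite /h !addrK /x exprMn rmorphXn.
  have -> : N 0 = (- ((\prod_(i < n) nm (g (t i)) ^+ 2) *
                    \prod_(i < n) (2 * complex.Re (x i))))%:C.
    rewrite rmorphN rmorphM /= -mulNr -mulN1r.
    rewrite -(@prod_mulJ n (fun i => g (t i)) (-1)); last 2 first.
    - exact: (g0 _ (ti 0%N (leq0n _))).
    - by rewrite tn t0 g10 mulN1r.
    rewrite rmorph_prod -big_split /=; apply: eq_bigr => i _.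
    have J : (nm (x i))%:C * (nm (x i))%:C = x i * conjc (x i).
      by rewrite -expr2 -normE sqr_normc.
    by rewrite w0// -/(x i) expr2 nmM rmorphM /= J -mulrDr addcJ rmorphM /= rmorph_nat.
  rewrite /= oppr_lt0; apply: mulr_gt0.
    apply: (pos_prod (fun i => nm (g (t i)) ^+ 2)) => i.
    by rewrite exprn_gt0// nm_gt0//; exact: g0 _ (ti _ (ltnW (ltn_ord i))).
  by apply: (pos_prod (fun i => 2 * complex.Re (x i))) => i; rewrite mulr_gt0.
have cN s : s \in `[0, 1] -> cont01 N s.
  move=> hs.
  have cH1 (x : R) : x \in `[0, 1] -> cont01 (fun s => F (s, x)) s.
    move=> hx e e0.
    have W : nbhs (s, x) [set q | (`[0, 1] `*` `[0, 1]) q -> nm (F q - F (s, x)) < e].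
      have sx : (`[0, 1] `*` `[0, 1]) (s, x) by split.
      by move/subspace_continuousP : cF => /(_ _ sx) /(_ _ (nbhs_nm _ e0)).
    move/nbhs_ballP : W => [d /= d0 dP]; exists d => // y hy ys.
    by apply: dP; [split; rewrite /ball /= ?subrr ?normr0// distrC|split].
  apply: cont01_prod => i.
  have cw : cont01 (fun s => w s i) s.
    apply: cont01_mul; first by apply: cH1; apply: ti.
    by apply: cont01_conj; apply: cH1; apply: ti; exact: ltnW.
  by apply: cont01_add => //; exact: cont01_norm.
have cRe : {within `[0, 1], continuous (fun s => complex.Re (N s))}.
  apply/subspace_continuousP => s hs A /nbhs_ballP[e /= e0 eA].
  have [d d0 dP] := cN s hs e e0.
  apply/nbhs_ballP; exists d => // y; rewrite /ball /= distrC => ys hy.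
  apply: eA; rewrite /ball /= distrC; apply: le_lt_trans (dP y hy ys).
  by rewrite -raddfB nm_Re.
have [c hc Nc] : exists2 c : R, c \in `[0, 1] & complex.Re (N c) = 0.
  apply: (@IVT R (fun s => complex.Re (N s)) 0 1 0 ler01 cRe).
  by rewrite ge_min le_max (ltW N0) (ltW N1) orbT.
by have [_] := Nsq c hc; rewrite Nc eqxx.
Qed.

End SquareRootBranch.

(** * From the branch of the square root to a bounded univalent function *)

Section BoundedEmbedding.
Context {R : realType}.
Local Notation C := (Cplane R).
Context (D : set C) (a : C).
Context (oD : open D) (cD : connected D) (scD : simply_connected D) (Da : ~ D a).

(** The double cover of [D] on which the square root of z - a is the coordinate [s]. It is symmetric
    under [s |-> - s] and omits 0 because [a] is outside [D]. *)
Let P : set C := [set s | D (s ^+ 2 + a)].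

Let reach s s' := exists g : R -> C, [/\ path_cont g,
  forall x : R, x \in `[0, 1] -> P (g x), g 0 = s & g 1 = s'].

Let reach_trans s1 s2 s3 : reach s1 s2 -> reach s2 s3 -> reach s1 s3.
Proof.
move=> [g [cg Pg g0 g1]] [h [ch Ph h0 h1]].
exists (fun x => g (Num.min (2 * x) 1) + h (Num.max (2 * x - 1) 0) - h 0); split.
- exact: path_cont_cat.
- move=> x; rewrite in_itv /= => /andP[x0 x1].
  have [xh|xh] := leP (2 * x) 1.
    rewrite (@max_r _ _ (2 * x - 1) 0) ?subr_le0// addrK; apply: Pg.
    by rewrite in_itv /= mulr_ge0.
  rewrite g1 h0 addrC addKr max_l ?subr_ge0 ?ltW//; apply: Ph.
  by rewrite in_itv /=; lra.
- by rewrite mulr0 min_l ?ler01// sub0r max_r ?lerN10// addrK.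
- by rewrite mulr1 min_r ?ler1n// max_l; [|lra]; rewrite g1 h0 (_ : 2 - 1 = 1);
    [rewrite addrC addKr|lra].
Qed.

Let reach_opp s s' : reach s s' -> reach (- s') (- s).
Proof.
move=> [g [cg Pg g0 g1]]; exists (fun x => - g (1 - x)); split.
- move=> x e e0; have [d d0 dP] := cg (1 - x) e e0; exists d => // y yx.
  rewrite -opprD nmN; apply: dP.
  by have -> : 1 - y - (1 - x) = - (y - x) by [ring]; rewrite normrN.
- move=> x; rewrite in_itv /= => /andP[x0 x1]; rewrite /P /= sqrrN; apply: Pg.
  by rewrite in_itv /=; lra.
- by rewrite subr0 g1.
- by rewrite subrr g0.
Qed.

Let reach_ball (c s s' : C) (r : R) : (forall y, nm (y - c) < r -> P y) ->
  nm (s - c) < r -> nm (s' - c) < r -> reach s s'.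
Proof.
move=> Pr hs hs'; exists (fun x => s + x%:C * (s' - s)); split.
- move=> x e e0; pose v := nm (s' - s).
  have v0 : 0 < v + 1 by rewrite ltr_wpDl ?nm_ge0.
  exists (e / (v + 1)); first by rewrite divr_gt0.
  move=> y; rewrite ltr_pdivlMr// => yx.
  rewrite opprD addrACA subrr add0r -mulrBl -rmorphB nmM nmR.
  by apply: le_lt_trans yx; rewrite ler_wpM2l// lerDl.
- move=> x; rewrite in_itv /= => /andP[x0 x1]; apply: Pr.
  have -> : s + x%:C * (s' - s) - c = (1 - x)%:C * (s - c) + x%:C * (s' - c).
    by rewrite rmorphB rmorph1; ring.
  rewrite (le_lt_trans (nmD _ _))// !nmM !nmR !ger0_norm ?subr_ge0//.
  move: hs hs'; set u := nm _; set v := nm _ => h1 h2.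
  have [->|xp] := eqVneq x 0; first by rewrite subr0 mul1r mul0r addr0.
  have {}xp : 0 < x by rewrite lt_neqAle eq_sym xp.
  have -> : r = (1 - x) * r + x * r by ring.
  by rewrite ler_ltD// ?ltr_pM2l// ler_wpM2l ?subr_ge0// ltW.
- by rewrite rmorph0 mul0r addr0.
- by rewrite rmorph1 mul1r addrC subrK.
Qed.

Let P_opp s : P s -> P (- s).
Proof. by rewrite /P /= sqrrN. Qed.

Let P_neq0 s : P s -> s != 0.
Proof. by move=> Ps; apply/eqP => E; apply: Da; move: Ps; rewrite /P /= E expr0n /= add0r. Qed.

Let P_ball s : P s -> exists2 r : R, 0 < r & forall y, nm (y - s) < r -> P y.
Proof.
move=> Ps; have [e e0 eD] := open_nm oD Ps.
have [d d0 dP] := derivable_cont (derivable_mulC (derivable_idC s) (derivable_idC s)) e0.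
by exists d => // y /dP h; apply: eD; rewrite opprD addrACA subrr addr0.
Qed.

Let root_near (s t : C) (r : R) : 0 < r ->
  nm ((t ^+ 2 + a) - (s ^+ 2 + a)) < r ^+ 2 -> nm (t - s) < r \/ nm (t + s) < r.
Proof.
move=> r0; have -> : t ^+ 2 + a - (s ^+ 2 + a) = (t - s) * (t + s) by ring.
rewrite nmM => h; have [|h1] := ltP (nm (t - s)) r; first by left.
right; rewrite ltNge; apply/negP => h2; move: h.
by rewrite ltNge expr2 ler_pM// ltW.
Qed.

Let root_exists z : exists s : C, s ^+ 2 + a = z.
Proof. by exists (sqrtc (z - a)); rewrite sqr_sqrtc subrK. Qed.

(** The path component [A] of [s0] in [P] contains no two opposite points, and the set of points of
    [D] with a root in [A] is open and closed in [D]; taking that root defines the branch [sg]. A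
    disc around [s0] lies in [A], so [sg] misses the opposite disc around [- s0], and
    [r / (sg z + s0)] is bounded by 1. Solving for z gives the explicit left inverse [Psi]. *)
Lemma bounded_embedding_of (z0 : C) : D z0 -> exists g Psi : C -> C,
  [/\ forall z, D z -> derivable g z 1, forall z, D z -> nm (g z) <= 1 &
  forall z, D z -> Psi (g z) = z /\ derivable Psi (g z) 1].
Proof.
move=> Dz0; have [s0 s0E] := root_exists z0.
have P0 : P s0 by rewrite /P /= s0E.
pose A s := reach s0 s.
have AP s : A s -> P s.
  by move=> [g [_ Pg _ <-]]; apply: Pg; rewrite in_itv /= lexx ler01.
have A0 : A s0.
  have [r r0 rP] := P_ball P0.
  by apply: (reach_ball rP); rewrite subrr nm0.
have Aopp s : A s -> ~ A (- s).
  move=> As /reach_opp; rewrite opprK => /(reach_trans As)[g [cg Pg g0 g1]].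
  apply: (no_antipodal_path scD Da cg Pg).
  by rewrite g0 g1.
pose B := [set z | exists2 s, A s & s ^+ 2 + a = z].
have BD : B = D.
  apply: cD; first by exists z0, s0.
    exists B; last first.
      by apply/seteqP; split => [z [s As <-]|z []//]; split; [exact: AP|exists s].
    apply: open_nmP => _ [s As <-].
    have [r r0 rP] := P_ball (AP s As).
    exists (r ^+ 2); first by rewrite exprn_gt0.
    move=> y; have [t <-] := root_exists y => /(root_near r0) [h|h].
      exists t => //; apply: (reach_trans As); apply: (reach_ball rP) => //.
      by rewrite subrr nm0.
    exists (- t); last by rewrite sqrrN.
    apply: (reach_trans As); apply: (reach_ball rP).
      by rewrite subrr nm0.
    by rewrite -opprD nmN.
  (* Relative closedness: if a point of [D] near z had a root in [A], that root would be near [s] or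
     [- s], and one of these would lie in [A]. *)
  exists (~` (D `\` B)); last first.
    apply/seteqP; split => [z Bz|z [Dz]].
      split; last by case.
      by case: Bz => s As <-; exact: AP.
    by move/not_andP => [//|]; rewrite notK.
  apply: open_closedC; apply: open_nmP => z [Dz nBz].
  have [s sE] := root_exists z.
  have Ps : P s by rewrite /P /= sE.
  have [r r0 rP] := P_ball Ps.
  have [d d0 dD] := open_nm oD Dz.
  exists (Num.min d (r ^+ 2)); first by rewrite lt_min d0 exprn_gt0.
  move=> y; rewrite lt_min => /andP[/dD Dy yr]; split=> // -[t At tE].
  apply: nBz; move: yr; rewrite -tE -sE => /(root_near r0)[h|h].
    exists s; last by [].
    by apply: (reach_trans At); apply: (reach_ball rP) => //; rewrite subrr nm0.
  exists (- s); last by rewrite sqrrN.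
  have rP' y' : nm (y' - - s) < r -> P y'.
    by rewrite opprK -nmN opprD => /rP/P_opp; rewrite opprK.
  apply: (reach_trans At); apply: (reach_ball rP'); first by rewrite opprK.
  by rewrite subrr nm0.
have ex z : exists s, D z -> A s /\ s ^+ 2 + a = z.
  have [Dz|nD] := pselect (D z); last by exists 0.
  by move: (Dz); rewrite -BD => -[s As sE]; exists s.
have [sg sgP] := choice ex.
have sgd z : D z -> derivable sg z 1.
  move=> Dz; have [As sE] := sgP z Dz; set s := sg z in As sE *.
  have s_gt : 0 < nm s by rewrite nm_gt0// P_neq0//; exact: AP.
  have s0' : s != 0 by apply: P_neq0; exact: AP.
  have [r r0 rP] := P_ball (AP s As).
  have [d d0 dD] := open_nm oD Dz.
  pose q := Num.min r (nm s).
  have q0 : 0 < q by rewrite lt_min r0.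
  apply/derivable_hd; exists (2 * s)^-1 => e e0.
  (* The radius [q ^+ 2] forces the root at y close to [s], the neighbourhood of [- s] being
     excluded by [Aopp]. The remainder is (y - z)^2 / (2 s (t + s)^2) in modulus, and |t + s| >= |s|
     gives the third radius. *)
  exists (Num.min d (Num.min (q ^+ 2) (e * (2 * nm s ^+ 3)))).
    by rewrite !lt_min d0 exprn_gt0//= mulr_gt0// mulr_gt0// exprn_gt0.
  move=> y; rewrite !lt_min => /and3P[/dD Dy yq ye].
  have [At tE] := sgP y Dy; rewrite -/s; set t := sg y in At tE *.
  have ts : nm (t - s) < q.
    move: (yq); rewrite -tE -sE => /(root_near q0)[//|h].
    exfalso; apply: (Aopp t At); apply: (reach_trans As); apply: (reach_ball rP).
      by rewrite subrr nm0.
    by rewrite -opprD nmN (lt_le_trans h)// /q ge_min lexx.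
  have tps : nm s <= nm (t + s).
    have := nmB (t + s) (t - s); have -> : t + s - (t - s) = 2 * s by ring.
    have -> : 2 * s = s + s by ring.
    have -> : s + s = (2 : R)%:C * s by rewrite rmorph_nat; ring.
    rewrite nmM nmR ger0_norm//; move: ts; rewrite lt_min => /andP[_]; lra.
  have tp0 : t + s != 0.
    by apply/eqP => E; move: tps; rewrite E nm0 leNgt s_gt.
  have yz : y - z = (t - s) * (t + s) by rewrite -tE -sE; ring.
  have tsE : t - s = (y - z) / (t + s) by rewrite yz mulfK.
  have -> : t - s - (2 * s)^-1 * (y - z) = - ((t - s) ^+ 2 / (2 * s)).
    by rewrite yz; field.
  have n2 : nm (2 : C) = 2 by rewrite -(rmorph_nat (real_complex R)) nmR ger0_norm.
  rewrite nmN nmM nmV nmM n2 expr2 nmM tsE nmM nmV.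
  set x := nm (y - z) in ye *; have x0 : 0 <= x by exact: nm_ge0.
  set u := nm (t + s) in tps *; have u0 : 0 < u by exact: lt_le_trans tps.
  have -> : x / u * (x / u) / (2 * nm s) = x * (x / (2 * nm s * u ^+ 2)).
    by field; rewrite !gt_eqF.
  rewrite mulrC ler_wpM2r// ler_pdivrMr; last first.
    by rewrite mulr_gt0// ?mulr_gt0// exprn_gt0.
  apply: (le_trans (ltW ye)); apply: ler_wpM2l; first exact: ltW.
  have -> : 2 * nm s ^+ 3 = 2 * nm s * nm s ^+ 2 by ring.
  apply: ler_wpM2l; first by rewrite mulr_ge0// ltW.
  by rewrite lerXn2r// nnegrE ltW.
have [r r0 rP] := P_ball P0.
have sgs z : D z -> r <= nm (sg z + s0).
  move=> Dz; rewrite leNgt; apply/negP => h; have [As _] := sgP z Dz.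
  apply: (Aopp _ As); apply: (reach_ball rP); first by rewrite subrr nm0.
  by rewrite -opprD nmN.
have sg0 z : D z -> sg z + s0 != 0.
  by move=> /sgs h; apply/eqP => E; move: h; rewrite E nm0 leNgt r0.
have r0' : r%:C != 0 :> C.
  by rewrite -(rmorph0 (real_complex R)) (inj_eq (@complexI R)) gt_eqF.
exists (fun z => r%:C * (sg z + s0)^-1).
exists (fun q => (r%:C * q^-1 - s0) * (r%:C * q^-1 - s0) + a); split.
- move=> z Dz.
  apply: (@derivable_mulC R (fun _ => r%:C) (fun z => (sg z + s0)^-1) z).
    exact (derivable_cstC _ z).
  apply: (@derivable_invC R (fun z => sg z + s0) z); first exact: sg0.
  exact (derivable_addC (sgd z Dz) (derivable_cstC s0 z)).
- move=> z Dz; have h := sgs z Dz.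
  rewrite nmM nmR nmV gtr0_norm// ler_pdivrMr ?mul1r//.
  exact: lt_le_trans h.
- move=> z Dz; have [_ sE] := sgP z Dz; have h0 := sg0 z Dz.
  have q0 : r%:C * (sg z + s0)^-1 != 0 by rewrite mulf_neq0// invr_eq0.
  split.
    by rewrite invfM invrK mulVKf// addrK -expr2.
  move: q0; move: (r%:C * _ : C) => q q0.
  have dq : derivable (fun q : C => r%:C * q^-1 - s0 : C) q 1.
    apply: (@derivable_subC R (fun q : C => r%:C * q^-1) (fun _ => s0) q).
      apply: (@derivable_mulC R (fun _ => r%:C) (fun q : C => q^-1) q).
        exact (derivable_cstC _ q).
      exact (derivable_invC q0 (derivable_idC q)).
    exact (derivable_cstC s0 q).
  exact (derivable_addC (derivable_mulC dq dq) (derivable_cstC a q)).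
Qed.

End BoundedEmbedding.

Lemma bounded_embedding (R : realType) (D : set (Cplane R)) : domain D ->
  simply_connected D -> D != setT -> exists g Psi : Cplane R -> Cplane R,
  [/\ forall z, D z -> derivable g z 1, forall z, D z -> nm (g z) <= 1 &
  forall z, D z -> Psi (g z) = z /\ derivable Psi (g z) 1].
Proof.
move=> [[z0 Dz0] oD cD] scD DT.
have [a Da] : exists a, ~ D a.
  apply: contrapT => h; move/eqP : DT; apply; apply/seteqP; split => // z _.
  by apply: contrapT => nD; apply: h; exists z.
exact: (bounded_embedding_of oD cD scD Da Dz0).
Qed.

(** * A metric contracted by the holomorphic self-maps *)

Section TestDistance.
Context {R : realType}.
Local Notation C := (Cplane R).
Implicit Types (D K : set C) (f g F : C -> C) (z w y : C) (d e : R).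

Definition test D f :=
  (forall z, D z -> derivable f z 1) /\ forall z, D z -> nm (f z) <= 1.

(* z and w are at distance at most d for the metric
   sup {|f z - f w| : f holomorphic on D, |f| <= 1},
   which every holomorphic self-map of D contracts. *)
Definition Dle D z w d := forall f, test D f -> nm (f z - f w) <= d.

Lemma Dle_refl D z d : 0 <= d -> Dle D z z d.
Proof. by move=> d0 f _; rewrite subrr nm0. Qed.

Lemma Dle_sym D z w d : Dle D z w d -> Dle D w z d.
Proof. by move=> h f /h; rewrite nmC. Qed.

Lemma Dle_tri D y z w d e : Dle D z y d -> Dle D y w e -> Dle D z w (d + e).
Proof.
by move=> h k f tf; rewrite (le_trans (nm_tri (f y) _ _))// lerD// ?h ?k.
Qed.

Lemma Dle_le D z w d e : d <= e -> Dle D z w d -> Dle D z w e.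
Proof. by move=> de h f tf; rewrite (le_trans (h f tf)). Qed.

Lemma HolDD D F z : Hol D D F -> D z -> D (F z).
Proof. by move=> [_ FD] Dz; apply: FD; exists z. Qed.

Lemma Dle_contract D F z w d : Hol D D F -> Dle D z w d ->
  Dle D (F z) (F w) d.
Proof.
move=> hF h f [df f1]; apply: (h (f \o F)); split => x Dx /=.
  exact (derivable_comp (hF.1 _ Dx) (df _ (HolDD hF Dx))).
exact: f1 _ (HolDD hF Dx).
Qed.

(** [cauchy_lipschitz] with the common bound 1 gives a constant that depends only on the radius of
    the disc, hence is the same for all test functions. *)
Lemma Dle_lip D K : open D -> compact K -> K `<=` D ->
  exists r c : R, [/\ 0 < r, 0 < c & forall z y1 y2, K z ->
    nm (y1 - z) <= r -> nm (y2 - z) <= r ->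
    [/\ D y1, D y2 & Dle D y1 y2 (c * nm (y1 - y2))]].
Proof.
move=> oD cK KD.
apply: (@compact_nm _ _ (fun A => exists r c : R, [/\ 0 < r, 0 < c &
    forall z y1 y2, A z ->
    nm (y1 - z) <= r -> nm (y2 - z) <= r ->
    [/\ D y1, D y2 & Dle D y1 y2 (c * nm (y1 - y2))]]) cK).
- by exists 1, 1; split.
- move=> A B [r1 [c1 [r10 c10 h1]]] [r2 [c2 [r20 c20 h2]]].
  exists (Num.min r1 r2), (Num.max c1 c2); split.
  + by rewrite lt_min r10.
  + by rewrite lt_max c10.
  + move=> z y1 y2 [Az|Bz]; rewrite !le_min => /andP[a1 a2] /andP[b1 b2].
      have [D1 D2 l] := h1 z y1 y2 Az a1 b1; split=> //; apply: Dle_le l.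
      by rewrite ler_wpM2r ?nm_ge0// le_max lexx.
    have [D1 D2 l] := h2 z y1 y2 Bz a2 b2; split=> //; apply: Dle_le l.
    by rewrite ler_wpM2r ?nm_ge0// le_max lexx orbT.
- move=> A B AB [r [c [r0 c0 h]]]; exists r, c; split=> // z y1 y2 /AB.
  exact: h.
- move=> z0 /KD Dz0; have [e e0 eD] := open_nm oD Dz0.
  exists (e / 4); first by rewrite divr_gt0.
  exists (e / 8), (144 * 1 / e); split; rewrite ?divr_gt0// ?mulr_gt0//.
  move=> z y1 y2 /= hz h1 h2.
  have k1 : nm (y1 - z0) < e / 2 by have := nm_tri z y1 z0; lra.
  have k2 : nm (y2 - z0) < e / 2 by have := nm_tri z y2 z0; lra.
  split; [apply: eD; lra|apply: eD; lra|].
  move=> f [df f1]; apply: (@cauchy_lipschitz _ f z0 e 1) => //.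
    by move=> w /eD; exact: df.
  by move=> w /eD; exact: f1.
Qed.

(** The bounded univalent function is itself a test function, and continuity of its inverse at
    [g z0] turns closeness of values into closeness of points. The point y ranges over all of [D],
    so nothing has to be known beforehand about where it lies. *)
Lemma Dle_sep D K e : domain D -> simply_connected D -> D != setT ->
  compact K -> K `<=` D -> 0 < e ->
  exists2 d : R, 0 < d & forall z y, K z -> D y -> Dle D z y d -> nm (y - z) < e.
Proof.
move=> domD scD DT cK KD e0.
have [g [Psi [dg g1 gP]]] := bounded_embedding domD scD DT.
have [_ oD _] := domD.
have e20 : 0 < e / 2 by rewrite divr_gt0.
apply: (@compact_nm _ _ (fun A => exists2 d : R, 0 < d & forall z y, A z ->
   D y -> Dle D z y d -> nm (y - z) < e) cK).
- by exists 1.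
- move=> A B [d1 d10 h1] [d2 d20 h2]; exists (Num.min d1 d2).
    by rewrite lt_min d10.
  move=> z y [Az|Bz] Dy h; [apply: h1 => //|apply: h2 => //]; apply: Dle_le h;
  by rewrite ge_min lexx ?orbT.
- by move=> A B AB [d d0 h]; exists d => // z y /AB; exact: h.
- move=> z0 /KD Dz0; have [pz dP] := gP z0 Dz0.
  have [d d0 hd] := derivable_cont dP e20.
  have d20 : 0 < d / 2 by rewrite divr_gt0.
  have d40 : 0 < d / 4 by rewrite divr_gt0.
  have [r [c [r0 c0 hr]]] := @Dle_lip D [set z0] oD (@compact_set1 _ z0)
    (fun z => fun e : z = z0 => eq_ind_r D Dz0 e).
  exists (Num.min r (Num.min (e / 2) (d / 4 / c))).
    by rewrite !lt_min r0 e20 divr_gt0.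
  exists (d / 2) => // z y /=; rewrite !lt_min => /and3P[zr ze zd] Dy zy.
  have [_ _ l] := hr z0 z0 z erefl ltac:(by rewrite subrr nm0 ltW) (ltW zr).
  have zd' : c * nm (z0 - z) <= d / 4.
    by rewrite nmC mulrC -ler_pdivlMr// ltW.
  have h := Dle_tri (Dle_le zd' l) zy.
  have {}h : nm (g y - g z0) < d.
    rewrite nmC; apply: le_lt_trans (h g (conj dg g1)) _; lra.
  have := hd _ h; rewrite pz (gP y Dy).1 => k.
  by have := nm_tri z0 y z; rewrite (nmC z0); lra.
Qed.

(** Continuity in time at each fixed point becomes joint continuity because every [psi s] contracts
    the metric: psi s w is compared with psi s z, and that with psi t z. The trajectories then have
    compact range. *)
Lemma traj_compact D K (a b : R) (psi : R -> C -> C) :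
  domain D -> simply_connected D -> D != setT -> compact K -> K `<=` D ->
  (forall t, a <= t <= b -> Hol D D (psi t)) ->
  (forall z t e, D z -> a <= t <= b -> 0 < e -> exists2 d : R, 0 < d &
    forall s, a <= s <= b -> `|s - t| < d -> nm (psi s z - psi t z) < e) ->
  exists K' : set C, [/\ compact K', K' `<=` D &
    forall t z, a <= t <= b -> K z -> K' (psi t z)].
Proof.
move=> domD scD DT cK KD hpsi cpsi; have [_ oD _] := domD.
suff [K' [cK' K'D h]] : exists K' : set C, [/\ compact K', K' `<=` D &
    forall p : R * C, (`[a, b] `*` K) p -> K' (psi p.1 p.2)].
  by exists K'; split => // t z ht Kz; apply: (h (t, z)); split.
apply: (@compact_induction _ (fun A : set (R * C) => exists K' : set C,
    [/\ compact K', K' `<=` D & forall p : R * C, A p -> K' (psi p.1 p.2)])).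
- by apply: compact_setX => //; exact: segment_compact.
- by exists set0; split=> //; exact: compact0.
- move=> A B [K1 [c1 D1 h1]] [K2 [c2 D2 h2]]; exists (K1 `|` K2); split.
  + exact: compactU.
  + by move=> z [/D1|/D2].
  + by move=> p [/h1|/h2]; [left|right].
- by move=> A B AB [K1 [c1 D1 h1]]; exists K1; split => // p /AB /h1.
- move=> [t z] [/= ht Kz]; rewrite in_itv /= in ht.
  have Dz := KD _ Kz; have Dy : D (psi t z) := HolDD (hpsi t ht) Dz.
  have [q q0 qD] := open_Sq oD Dy.
  have Y1 : [set psi t z] `<=` D by move=> _ ->.
  have [d d0 hd] := Dle_sep domD scD DT (@compact_set1 _ (psi t z)) Y1 q0.
  have [r1 [c1 [r10 c10 hr1]]] := @Dle_lip D [set z] oD (@compact_set1 _ z)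
    (fun z' => fun e : z' = z => eq_ind_r D Dz e).
  have [r2 [c2 [r20 c20 hr2]]] := Dle_lip oD (@compact_set1 _ (psi t z)) Y1.
  have d20 : 0 < d / 2 by rewrite divr_gt0.
  have m0 : 0 < Num.min r2 (d / 2 / c2) by rewrite lt_min r20 divr_gt0.
  have [eta eta0 heta] := cpsi z t _ Dz ht m0.
  have n0 : 0 < Num.min r1 (d / 2 / c1) by rewrite lt_min r10 divr_gt0.
  exists ([set s | `|s - t| < eta] `*` [set w | nm (w - z) < Num.min r1 (d / 2 / c1)]).
    exists ([set s | `|s - t| < eta], [set w | nm (w - z) < Num.min r1 (d / 2 / c1)]) => //.
    split; last exact: nbhs_nm.
    by apply/nbhs_ballP; exists eta => // s; rewrite /ball /= distrC.
  exists (Sq (psi t z) q); split=> //; first exact: compact_Sq.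
  move=> [s w] [[/= st wz] [/= hs Kw]]; rewrite in_itv /= in hs.
  apply: Sq_nm; apply: ltW; apply: hd => //.
    exact: HolDD (hpsi s hs) (KD _ Kw).
  move: wz; rewrite lt_min => /andP[w1 w2].
  have := heta s hs st; rewrite lt_min => /andP[s1 s2].
  have [_ _ l1] := hr1 z z w erefl ltac:(by rewrite subrr nm0 ltW) (ltW w1).
  have [_ _ l2] := hr2 (psi t z) (psi t z) (psi s z) erefl
    ltac:(by rewrite subrr nm0 ltW) (ltW s1).
  have -> : d = d / 2 + d / 2 by exact: splitr.
  apply: (@Dle_tri D (psi s z)).
    by apply: Dle_le l2; rewrite nmC mulrC -ler_pdivlMr// ltW.
  apply: (Dle_contract (hpsi s hs)).
  by apply: Dle_le l1; rewrite nmC mulrC -ler_pdivlMr// ltW.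
Qed.

End TestDistance.

(** * Monotonicity from Dini derivatives almost everywhere *)

Section DiniMonotonicity.
Context {R : realType}.
Local Notation mu := (@lebesgue_measure R).
Local Notation cmu := (@completed_lebesgue_measure R).
Implicit Types (a b t : R) (s : seq (R * R)) (f : R -> R).

(* s lists successive non-overlapping intervals of [a, t], the last one first *)
Fixpoint upto a t s : Prop :=
  if s is p :: s' then [/\ upto a p.1 s', p.1 <= p.2 & p.2 <= t] else a <= t.

Definition chain_sum s (phi : R -> R -> R) := \sum_(p <- s) phi p.1 p.2.

(** Absolute continuity bounded from above only: [phi] may be a signed increment, as for the
    distance to [U], or the modulus of one. Lists of successive intervals suit induction along the
    line and concatenation. *)
Definition chain_ac a b (phi : R -> R -> R) := forall e : R, 0 < e ->
  exists2 d : R, 0 < d & forall s, upto a b s ->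
    chain_sum s (fun x y => y - x) < d -> chain_sum s phi <= e.

Lemma upto_le a t t' s : upto a t s -> t <= t' -> upto a t' s.
Proof.
case: s => [|p s] /=; first exact: le_trans.
by move=> [h1 h2 h3] tt; split=> //; exact: le_trans tt.
Qed.

Lemma upto_bounds a t s : upto a t s -> a <= t.
Proof.
elim: s t => [//|p s IH] t /= [/IH h1 h2 h3].
by rewrite (le_trans h1)// (le_trans h2).
Qed.

Lemma chain_ac_small a b phi : chain_ac a b phi -> forall e : R, 0 < e ->
  exists2 d : R, 0 < d & forall x y, a <= x -> x <= y -> y <= b -> y - x < d ->
    phi x y <= e.
Proof.
move=> ac e e0; have [d d0 h] := ac e e0; exists d => // x y ax xy yb yxd.
have := h [:: (x, y)]; rewrite /chain_sum !big_seq1 /=; apply => //; split=> //.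
Qed.

Lemma chain_sum_le a b s (phi psi : R -> R -> R) : upto a b s ->
  (forall x y, a <= x -> x <= y -> y <= b -> phi x y <= psi x y) ->
  chain_sum s phi <= chain_sum s psi.
Proof.
rewrite /chain_sum; elim: s b => [|p s IH] b; first by rewrite !big_nil.
move=> /= [h1 h2 h3] le; rewrite !big_cons lerD//.
  by apply: le => //; exact: upto_bounds h1.
by apply: (IH p.1) => // x y ax xy yp; apply: le => //; rewrite (le_trans yp)// (le_trans h2).
Qed.

Lemma chain_ac_le a b (phi psi : R -> R -> R) :
  (forall x y, a <= x -> x <= y -> y <= b -> phi x y <= psi x y) ->
  chain_ac a b psi -> chain_ac a b phi.
Proof.
move=> le ac e e0; have [d d0 h] := ac e e0; exists d => // s us ls.
by apply: le_trans (h s us ls); exact: chain_sum_le us le.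
Qed.

Lemma chain_ac_sub a b a' b' phi : a <= a' -> b' <= b -> chain_ac a b phi ->
  chain_ac a' b' phi.
Proof.
move=> aa bb ac e e0; have [d d0 h] := ac e e0; exists d => // s us ls.
apply: h => //; apply: upto_le bb; elim: s b' us {ls} => [|p s IH] b' /=.
  exact: le_trans.
by move=> [/IH].
Qed.

(** A null set of the completed measure has zero outer measure, hence a countable cover by intervals
    of total length below [e / 2]. The union of the cover is Borel, and outer regularity enlarges it
    to an open set at the cost of another [e / 2]. *)
Lemma negligible_open (N : set R) (e : R) : cmu.-negligible N -> 0 < e ->
  exists W : set R, [/\ open W, N `<=` W & (mu W < e%:E)%E].
Proof.
move=> [A [mA A0 NA]] e0.
have e20 : 0 < e / 2 by rewrite divr_gt0.
have wA : ((wlength idfun)^*%mu A = 0 :> \bar R)%E := A0.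
have : ((wlength idfun)^*%mu A : \bar R) \is a fin_num by rewrite wA.
move/lb_ereal_inf_adherent => /(_ _ e20)[_/= [B AB <-] Be].
have {}Be : (\sum_(0 <= k <oo) wlength idfun (B k) < (e / 2)%:E)%E.
  by move: Be; rewrite [ereal_inf _]wA add0e.
pose V := \bigcup_k (B k).
have mB k : @measurable _ (measurableTypeR R) (B k).
  by apply: sub_sigma_algebra; have [/(_ k)] := AB.
have mV : @measurable _ (measurableTypeR R) V by exact: bigcupT_measurable.
have muV : (mu V < (e / 2)%:E)%E.
  apply: (le_lt_trans _ Be).
  apply: (le_trans (outer_measure_sigma_subadditive (wlength idfun)^*%mu B)).
  apply: lee_nneseries => // n _.
  by rewrite -((measurable_mu_extE (wlength idfun)) (B n))//; have [/(_ n)] := AB.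
have [W [oW VO Oe]] := lebesgue_regularity_outer mV (lt_trans muV (ltry _)) e20.
exists W; split=> //.
  by apply: subset_trans VO; apply: (subset_trans NA); case: AB.
have mO : @measurable _ (measurableTypeR R) W by exact: open_measurable.
have OE : V `|` (W `\` V) = W by rewrite setDUK.
rewrite -OE measureU//; last 2 first.
- exact: measurableD.
- by rewrite setDIK.
by rewrite [e]splitr EFinD lteD.
Qed.

Lemma chain_sum_open (W : set R) a t s : open W -> upto a t s ->
  (forall p, p \in s -> [set` `]p.1, p.2[] `<=` W) ->
  ((chain_sum s (fun x y => y - x))%:E <= mu (W `&` [set` `]-oo, t[]))%E.
Proof.
move=> oW; have mO : @measurable _ (measurableTypeR R) W by exact: open_measurable.
elim: s t => [|p s IH] t /=; first by rewrite /chain_sum big_nil.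
move=> [h1 h2 h3] sO.
have mI (x : R) : @measurable _ (measurableTypeR R) (W `&` [set` `]-oo, x[]).
  by apply: measurableI => //; exact: measurable_itv.
have mJ : @measurable _ (measurableTypeR R) [set` `]p.1, p.2[].
  exact: measurable_itv.
apply: (@le_trans _ _ (mu ((W `&` [set` `]-oo, p.1[]) `|` [set` `]p.1, p.2[]))).
  rewrite measureU//; last first.
    apply/seteqP; split=> // x [[_ /=]]; rewrite !in_itv /= => x1 /andP[x2 _].
    by move: (lt_trans x1 x2); rewrite ltxx.
  rewrite /chain_sum big_cons /= addrC EFinD leeD//.
    apply: IH => // q qs; apply: sO; by rewrite in_cons qs orbT.
  rewrite lebesgue_measure_itv /= lte_fin; case: ltP => //.
  by rewrite -subr_le0 lee_fin.
apply: le_measure; rewrite ?inE//.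
  exact: measurableU.
move=> x [[Ox /=]|].
  rewrite !in_itv /= => xp; split=> //; rewrite /= ?in_itv /=.
  by rewrite (lt_le_trans xp)// (le_trans h2).
move=> xp; split; first by apply: (sO p) => //; rewrite in_cons eqxx.
by move: xp; rewrite /= !in_itv /= => /andP[_ xp]; rewrite (lt_le_trans xp).
Qed.

Definition upper_dini_le0 f t := forall e : R, 0 < e -> exists2 d : R, 0 < d &
  forall h, 0 < h -> h < d -> f (t + h) - f t <= e * h.

(** The exceptional set is covered by an open [W] so small that increments of [f] over chains inside
    [W] add up to at most [e]. With [g t] the supremum of these sums up to [t], real induction
    proves f t <= f a + e (t - a) + g t: at exceptional points the growth of [f] is charged to [g],
    elsewhere to the slope [e]. *)
Lemma dini_le a b f : a <= b -> chain_ac a b (fun x y => f y - f x) ->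
  {ae cmu, forall t, a <= t < b -> upper_dini_le0 f t} -> f b <= f a.
Proof.
move=> ab ac N0.
suff main (e : R) : 0 < e -> f b <= f a + e * (b - a) + e.
  apply/ler_addgt0Pr => e e0; have k0 : 0 < b - a + 1 by rewrite ltr_wpDl ?subr_ge0.
  have := main (e / (b - a + 1)) (divr_gt0 e0 k0).
  rewrite -addrA -[X in _ + (_ + X)]mulr1 -mulrDr divfK//.
  by rewrite gt_eqF.
move=> e0; have [d d0 hd] := ac e e0.
pose N := ~` [set t | a <= t < b -> upper_dini_le0 f t].
have {}N0 : cmu.-negligible N := N0.
have [W [oW NO Od]] := negligible_open N0 d0.
pose V t := [set v | exists s, [/\ upto a t s,
  forall p, p \in s -> [set` `[p.1, p.2]] `<=` W & v = chain_sum s (fun x y => f y - f x)]].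
have V0 t : a <= t -> V t 0.
  by move=> at_; exists [::]; split => //; rewrite /chain_sum big_nil.
have Vb t v : t <= b -> V t v -> v <= e.
  move=> tb [s [us sO ->]]; apply: hd; first exact: upto_le us tb.
  rewrite -lte_fin; apply: le_lt_trans Od.
  apply: le_trans (chain_sum_open oW us _) _.
    move=> p ps; apply: subset_trans (sO p ps); exact: subset_itv_oo_cc.
  have mO : @measurable _ (measurableTypeR R) W by exact: open_measurable.
  apply: le_measure; rewrite ?inE//.
    by apply: measurableI => //; exact: measurable_itv.
pose g t := sup (V t).
have hV t : a <= t -> t <= b -> has_sup (V t).
  move=> at_ tb; split; first by exists 0; exact: V0.
  by exists e => v; exact: Vb.
have g_mono t t' : a <= t -> t <= t' -> t' <= b -> g t <= g t'.
  move=> at_ tt tb; apply: ge_sup; first by exists 0; exact: V0.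
  move=> v [s [us sO ->]]; apply: ub_le_sup; first exact: (hV _ (le_trans at_ tt) tb).2.
  by exists s; split => //; exact: upto_le us tt.
have g_ge0 t : a <= t -> t <= b -> 0 <= g t.
  by move=> at_ tb; apply: ub_le_sup; [exact: (hV _ at_ tb).2|exact: V0].
suff : f b <= f a + e * (b - a) + g b.
  move/le_trans; apply; rewrite lerD2l; apply: ge_sup; first by exists 0; exact: V0.
  by move=> v; exact: Vb.
apply: (@real_induction R a b (fun t => f t <= f a + e * (t - a) + g t)); last first.
- by rewrite ab lexx.
- move=> t /andP[at_ tb] IH; have Pt := IH t ltac:(by rewrite at_ lexx).
  (* At an exceptional [t] the interval [[t, x]] lies in [W] for [x] near [t] and can be added to
     any chain ending by [t], so [g] grows at least as much as [f]. *)
  have [Nt|nNt] := pselect (N t).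
    have [r /= r0 rO] : nbhs_ball t W.
      by apply/nbhs_ballP; apply: open_nbhs_nbhs; split => //; exact: NO.
    exists r => // x /andP[tx xr] xb.
    suff : g t <= g x - (f x - f t).
      have : e * (x - a) = e * (t - a) + e * (x - t) by ring.
      have : 0 <= e * (x - t) by rewrite mulr_ge0 ?subr_ge0// ltW.
      lra.
    apply: ge_sup; first by exists 0; exact: V0.
    move=> v [s [us sO ->]]; rewrite lerBrDr; apply: ub_le_sup.
      exact: (hV _ (le_trans at_ (ltW tx)) xb).2.
    exists ((t, x) :: s); split => /=.
    + by split=> //; exact: ltW.
    + move=> p; rewrite in_cons => /orP[/eqP->|/sO//] y /=.
      rewrite in_itv /= => /andP[y1 y2]; apply: rO.
      by rewrite /ball /= distrC ger0_norm ?subr_ge0//; lra.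
    + by rewrite /chain_sum big_cons /= addrC.
  have {}nNt : upper_dini_le0 f t.
    by move: nNt; rewrite /N /= notK; apply; rewrite at_.
  have [r r0 hr] := nNt e e0; exists r => // x /andP[tx xr] xb.
  have := hr (x - t); rewrite [t + (x - t)]addrC subrK subr_gt0 ltrBlDl => /(_ tx xr) h.
  have := g_mono t x at_ (ltW tx) xb.
  have : e * (x - a) = e * (t - a) + e * (x - t) by ring.
  lra.
- move=> t /andP[at_ tb] IH; have [->|ta] := eqVneq t a.
    by rewrite subrr mulr0 addr0 lerDl; exact: g_ge0.
  have {}ta : a < t by rewrite lt_neqAle eq_sym ta.
  apply/ler_addgt0Pr => e' e'0.
  have [r r0 hr] := chain_ac_small ac e'0.
  pose x := Num.max a (t - r / 2).
  have xt : x < t by rewrite gt_max ta ltrBlDr ltrDl divr_gt0.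
  have ax : a <= x by rewrite le_max lexx.
  have txr : t - x < r.
    have : t - r / 2 <= x by rewrite le_max lexx orbT.
    lra.
  have := hr x t ax (ltW xt) tb txr.
  have := IH x ltac:(by rewrite ax xt).
  have := g_mono x t ax (ltW xt) tb.
  have : e * (t - a) = e * (x - a) + e * (t - x) by ring.
  have : 0 <= e * (t - x) by rewrite mulr_ge0 ?subr_ge0// ltW.
  lra.
Qed.

End DiniMonotonicity.

(** * Flows of Herglotz vector fields *)

Section FlowDefs.
Context {R : realType}.
Local Notation C := (Cplane R).
Local Notation cmu := (@completed_lebesgue_measure R).

Definition right_deriv (u : R -> C) (t : R) (l : C) := forall e : R, 0 < e ->
  exists2 d : R, 0 < d & forall h, 0 < h -> h < d ->
    nm (u (t + h) - u t - h%:C * l) <= e * h.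

Definition right_derivR (G : R -> R) (t l : R) := forall e : R, 0 < e ->
  exists2 d : R, 0 < d & forall h, 0 < h -> h < d ->
    `|G (t + h) - G t - h * l| <= e * h.

(** An integral-free form of the bound |p(z, t)| <= m(t) on [K] with [m] integrable: [G] stands for
    a primitive of [m]. *)
Definition field_bound (K : set C) (a b : R) (p : C -> R -> C) (G m : R -> R) :=
  [/\ forall x y, a <= x -> x <= y -> y <= b -> G x <= G y,
      chain_ac a b (fun x y => G y - G x) &
      {ae cmu, forall t, a <= t < b ->
        right_derivR G t (m t) /\ forall z, K z -> nm (p z t) <= m t}].

(* The interface shared by evolution families and, after the time reversal
   t |-> c - t, by reverse evolution families. *)
Record flow (D : set C) (a b : R) (W : R -> R -> C -> C) (p : C -> R -> C) := {
  flow_hol : forall s t, a <= s -> s <= t -> t <= b -> Hol D D (W s t) ;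
  flow_id : forall s z, a <= s -> s <= b -> D z -> W s s z = z ;
  flow_comp : forall s t u z, a <= s -> s <= t -> t <= u -> u <= b -> D z ->
    W s u z = W t u (W s t z) ;
  flow_ac : forall z s, D z -> a <= s -> s <= b ->
    chain_ac s b (fun x y => nm (W s y z - W s x z)) ;
  flow_deriv : forall z s, D z -> a <= s -> s <= b ->
    {ae cmu, forall t, s <= t < b ->
      right_deriv (fun t => W s t z) t (- p (W s t z) t)} ;
  flow_gen : forall t, a <= t -> t <= b -> generators D (Hol D D) (p ^~ t) ;
  flow_bound : forall K, compact K -> K `<=` D ->
    exists G m, field_bound K a b p G m }.

Lemma ae_mono (P Q : R -> Prop) : (forall t, P t -> Q t) ->
  {ae cmu, forall t, P t} -> {ae cmu, forall t, Q t}.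
Proof. by move=> PQ; apply: negligibleS => t /= nQ Pt; apply: nQ; exact: PQ. Qed.

Lemma ae_mono2 (P Q S : R -> Prop) : (forall t, P t -> Q t -> S t) ->
  {ae cmu, forall t, P t} -> {ae cmu, forall t, Q t} -> {ae cmu, forall t, S t}.
Proof.
move=> PQS aP aQ; apply: negligibleS (negligibleU aP aQ) => t /= nS.
have [Pt|nP] := pselect (P t); last by left.
by right => Qt; apply: nS; exact: PQS.
Qed.

Lemma ae_all (P : R -> Prop) : (forall t, P t) -> {ae cmu, forall t, P t}.
Proof.
by move=> h; apply: (negligibleS _ (negligible_set0 cmu)) => t /= /(_ (h t)).
Qed.

Lemma ae_countable (T : countType) (P : T -> R -> Prop) :
  (forall x, {ae cmu, forall t, P x t}) -> {ae cmu, forall t, forall x, P x t}.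
Proof.
move=> h.
have N : cmu.-negligible (\bigcup_n [set t | exists2 x, unpickle n = Some x & ~ P x t]).
  apply: negligible_bigcup => n; case: (unpickle n) => [x|].
    by apply: negligibleS (h x) => t /= [y [<-]].
  apply: (negligibleS _ (negligible_set0 cmu)).
  by move=> t [y].
apply: negligibleS N => t /= /existsNP[x nPx].
by exists (pickle x) => //; exists x => //; rewrite pickleK.
Qed.

End FlowDefs.

(** * First order expansion of a flow at almost every time *)

Section FlowLocal.
Context {R : realType}.
Local Notation C := (Cplane R).
Local Notation cmu := (@completed_lebesgue_measure R).
Context (D : set C) (a b : R) (W : R -> R -> C -> C) (p : C -> R -> C).
Context (oD : open D) (fW : flow D a b W p).

Lemma flow_cont s t z (e : R) : D z -> a <= s -> s <= t -> t <= b -> 0 < e ->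
  exists2 d : R, 0 < d & forall x, s <= x <= b -> `|x - t| < d ->
    nm (W s x z - W s t z) < e.
Proof.
move=> Dz as_ st tb e0; have e20 : 0 < e / 2 by rewrite divr_gt0.
have sb := le_trans st tb.
have [d d0 h] := chain_ac_small (flow_ac fW Dz as_ sb) e20.
exists d => // x /andP[sx xb] xt.
suff : nm (W s x z - W s t z) <= e / 2 by lra.
have [tx|tx] := leP t x.
  apply: h => //; move: xt; rewrite ger0_norm ?subr_ge0//.
rewrite nmC; apply: h => //; first exact: ltW.
by move: xt; rewrite distrC ger0_norm// subr_ge0 ltW.
Qed.

(** While the trajectory stays in the disc of radius [r], its speed is at most [m], so [dini_le]
    makes [nm (W s x z - z) - G x] nonincreasing. Conversely G t - G s < r keeps it inside the disc;
    real induction breaks the circle. *)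
Lemma flow_step_bound (K : set C) G m s t z (r : R) :
  field_bound K a b p G m -> (forall y, nm (y - z) <= r -> K y) -> D z ->
  a <= s -> s <= t -> t <= b -> G t - G s < r ->
  nm (W s t z - z) <= G t - G s.
Proof.
move=> [Gm Gac Gae] Kr Dz as_ st tb Gr; have sb := le_trans st tb.
pose u x := W s x z.
have us : u s = z := flow_id fW as_ sb Dz.
suff : nm (u t - z) <= G t - G s by [].
apply: (@real_induction R s t (fun x => nm (u x - z) <= G x - G s)); last first.
- by rewrite st lexx.
- move=> x /andP[sx xt] IH.
  have ux : nm (u x - z) < r.
    have := IH x; rewrite sx lexx => /(_ isT) /le_lt_trans; apply.
    apply: le_lt_trans Gr; rewrite lerD2r; apply: Gm => //; last exact: ltW.
    exact: le_trans sx.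
  have rx : 0 < r - nm (u x - z) by rewrite subr_gt0.
  have xb : x <= b by rewrite (le_trans (ltW xt)).
  have [d d0 hd] := flow_cont Dz as_ sx xb rx.
  exists d => // y /andP[xy yd] yt.
  have sy : s <= y by rewrite (le_trans sx)// ltW.
  have yb : y <= b by exact: le_trans tb.
  have inK v : s <= v -> v <= y -> K (u v).
    move=> sv vy; apply: Kr.
    have [vx|xv] := leP v x.
      have := IH v; rewrite sv vx => /(_ isT) /le_trans; apply.
      apply: ltW; apply: le_lt_trans Gr.
      rewrite lerD2r; apply: Gm; [exact: le_trans sv|exact: le_trans (ltW xt)|by []].
    have := hd v; rewrite sv (le_trans vy yb) ger0_norm; last by rewrite subr_ge0 ltW.
    move=> /(_ isT) h; have {}h := h ltac:(lra).
    by have := nm_tri (u x) (u v) z; rewrite -/(u v) -/(u x) in h; lra.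
  suff : nm (u y - z) - G y <= nm (u s - z) - G s.
    by rewrite us subrr nm0; lra.
  apply: (@dini_le R s y (fun v => nm (u v - z) - G v)) => //.
    apply: (@chain_ac_le R s y _ (fun v v' => nm (u v' - u v))).
      move=> v v' sv vv' v'y; have := nm_tri (u v) (u v') z.
      have := Gm v v' (le_trans as_ sv) vv' (le_trans v'y yb); lra.
    exact: chain_ac_sub (lexx s) yb (flow_ac fW Dz as_ sb).
  apply: ae_mono2 (flow_deriv fW Dz as_ sb) Gae => v h1 h2 /andP[sv vy] e e0.
  have vb : v < b by exact: lt_le_trans yb.
  have e20 : 0 < e / 2 by rewrite divr_gt0.
  have [d1 d10 k1] := h1 ltac:(by rewrite sv) _ e20.
  have [gd gb] := h2 ltac:(by rewrite (le_trans as_ sv)).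
  have [d2 d20 k2] := gd _ e20.
  exists (Num.min d1 d2); first by rewrite lt_min d10.
  move=> h h0; rewrite lt_min => /andP[/(k1 h h0) {}k1 /(k2 h h0) {}k2].
  have pm := gb _ (inK v sv (ltW vy)).
  have K1 : nm (u (v + h) - u v) <= e / 2 * h + h * m v.
    have -> : u (v + h) - u v = (u (v + h) - u v - h%:C * - p (u v) v)
        + h%:C * - p (u v) v by rewrite subrK.
    rewrite (le_trans (nmD _ _))// lerD// nmM nmR gtr0_norm// nmN.
    by rewrite ler_pM2l.
  have := nm_tri (u v) (u (v + h)) z.
  move: k2; rewrite ler_norml => /andP[k2 _].
  have : e * h = e / 2 * h + e / 2 * h by rewrite -mulrDl -splitr.
  lra.
- move=> x /andP[sx xt] IH; have [->|xs] := eqVneq x s.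
    by rewrite us !subrr nm0.
  have {}xs : s < x by rewrite lt_neqAle eq_sym xs.
  have xb := le_trans xt tb.
  apply/ler_addgt0Pr => e e0.
  have [d d0 hd] := flow_cont Dz as_ sx xb e0.
  pose v := Num.max s (x - d / 2).
  have vx : v < x by rewrite gt_max xs ltrBlDr ltrDl divr_gt0.
  have sv : s <= v by rewrite le_max lexx.
  have xvd : x - v < d.
    have : x - d / 2 <= v by rewrite le_max lexx orbT.
    lra.
  have vb : v <= b by rewrite (le_trans (ltW vx)).
  have := hd v; rewrite sv vb distrC ger0_norm; last by rewrite subr_ge0 ltW.
  move=> /(_ isT xvd) h; rewrite nmC in h.
  have := IH v; rewrite sv vx => /(_ isT) k.
  have := nm_tri (u v) (u x) z.
  have := Gm v x (le_trans as_ sv) (ltW vx) xb.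
  by rewrite -/(u v) -/(u x) in h; lra.
Qed.

Definition consistent t := forall (K : set C) (e : R), compact K -> K `<=` D ->
  0 < e -> exists2 d : R, 0 < d & forall h z, 0 < h -> h < d -> K z ->
    nm (W t (t + h) z - z + h%:C * p z t) <= e * h.

Let ratc (q : rat * rat) : C := (ratr q.1)%:C + 'i * (ratr q.2)%:C.

Let ratc_dense (z : C) (e : R) : 0 < e -> exists q, nm (ratc q - z) < e.
Proof.
move=> e0.
have [q1 h1] : exists q, ratr q \in `]complex.Re z - e / 2, complex.Re z + e / 2[.
  by apply: rat_in_itvoo; lra.
have [q2 h2] : exists q, ratr q \in `]complex.Im z - e / 2, complex.Im z + e / 2[.
  by apply: rat_in_itvoo; lra.
exists (q1, q2); rewrite /ratc /= [X in _ - X]complexE.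
have -> : (ratr q1)%:C + 'i * (ratr q2)%:C - ((complex.Re z)%:C + 'i * (complex.Im z)%:C)
  = (ratr q1 - complex.Re z)%:C + 'i * (ratr q2 - complex.Im z)%:C :> C.
  by rewrite !rmorphB /=; ring.
rewrite (le_lt_trans (nmD _ _))// nmM nmi mul1r !nmR [e]splitr.
by move: h1 h2; rewrite !in_itv /= => h1 h2; apply: ltrD; rewrite ltr_norml; lra.
Qed.

(** Outside one null set, the trajectories with rational starting time s and point z0 are
    differentiable at [t], which gives the expansion of W t (t + h) at the points W s t z0. These
    come arbitrarily close to any point of [D], and the rescaled error [f h] is Lipschitz uniformly
    in [h]. Room for a starting time before [t] is the reason for [a < t]. *)
Lemma flow_consistent : {ae cmu, forall t, a < t < b -> consistent t}.
Proof.
pose good (q : (rat * rat) * rat) := Sq (ratc q.1) (ratr q.2) `<=` D.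
have exG (q : (rat * rat) * rat) : exists Gm : (R -> R) * (R -> R),
    good q -> field_bound (Sq (ratc q.1) (ratr q.2)) a b p Gm.1 Gm.2.
  have [gq|nq] := pselect (good q); last by exists (id, id).
  have [G [m h]] := flow_bound fW (@compact_Sq _ _ _) gq.
  by exists (G, m).
have [Gm hGm] := choice exG.
have ae1 : {ae cmu, forall t, forall q, good q -> a <= t < b ->
    right_derivR (Gm q).1 t ((Gm q).2 t) /\
    forall z, Sq (ratc q.1) (ratr q.2) z -> nm (p z t) <= (Gm q).2 t}.
  apply: ae_countable => q; have [gq|nq] := pselect (good q); last first.
    by apply: ae_all => t /nq.
  by have [_ _] := hGm q gq; apply: ae_mono => t h _.
have ae2 : {ae cmu, forall t, forall x : rat * (rat * rat),
    a <= ratr x.1 -> D (ratc x.2) -> ratr x.1 <= t < b ->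
    right_deriv (fun t => W (ratr x.1) t (ratc x.2)) t
      (- p (W (ratr x.1) t (ratc x.2)) t)}.
  apply: ae_countable => -[s z] /=.
  have [as_|] := leP a (ratr s); last first.
    by move=> h; apply: ae_all.
  have [Dz|nD] := pselect (D (ratc z)); last first.
    by apply: ae_all => t _ /nD.
  have [sb|bs] := leP (ratr s) b.
    by apply: ae_mono (flow_deriv fW Dz as_ sb) => t h _ _.
  apply: ae_all => t _ _ /andP[st tb].
  by move: (lt_trans (le_lt_trans st tb) bs); rewrite ltxx.
apply: ae_mono2 ae1 ae2 => t g1 g2 /andP[at_ tb] K e cK KD e0.
apply: (@compact_nm _ _ (fun A => exists2 d : R, 0 < d & forall h z, 0 < h ->
    h < d -> A z -> nm (W t (t + h) z - z + h%:C * p z t) <= e * h) cK).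
- by exists 1.
- move=> A B [d1 d10 h1] [d2 d20 h2]; exists (Num.min d1 d2).
    by rewrite lt_min d10.
  by move=> h z h0; rewrite lt_min => /andP[l1 l2] [Az|Bz]; [exact: h1|exact: h2].
- by move=> A B AB [d d0 h]; exists d => // k z k0 kd /AB; exact: h.
move=> z1 /KD Dz1; have [e1 e10 e1D] := open_nm oD Dz1.
have [q3 hq3] : exists q, ratr q \in `]e1 / 16, e1 / 8[.
  by apply: rat_in_itvoo; lra.
set r : R := ratr q3 in hq3; rewrite in_itv /= in hq3.
have r0 : 0 < r by lra.
have r80 : 0 < r / 8 by rewrite divr_gt0.
have [qc hc] := ratc_dense z1 r80; set c := ratc qc in hc.
have gq : good (qc, q3).
  move=> y /nm_Sq /= h; apply: e1D.
  by have := nm_tri c y z1; rewrite -/c -/r in h; lra.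
have fb := hGm _ gq; have [gd gb] := g1 _ gq ltac:(by rewrite tb ltW).
set G := (Gm _).1 in fb gd; set m := (Gm _).2 in fb gd gb.
rewrite /= -/c -/r in fb gb.
have m0 : 0 <= m t.
  apply: le_trans (gb c _); first exact: nm_ge0.
  by apply: Sq_nm; rewrite subrr nm0 ltW.
(* The difference quotient of [W] contributes [m t + 1], by [flow_step_bound] and the derivative of
   [G] taken with error 1; the field contributes [m t]. In [d2], the third term keeps the trajectory
   within [r / 2] of its start, hence inside the square. *)
pose M := 2 * m t + 1.
have M0 : 0 < M by rewrite /M; lra.
have [d1 d10 hd1] := gd 1 ltr01.
have bt0 : 0 < b - t by rewrite subr_gt0.
pose d2 := Num.min (Num.min d1 (b - t)) (r / 2 / (m t + 1)).
have d20 : 0 < d2 by rewrite /d2 !lt_min d10 bt0 divr_gt0//; lra.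
have Ginc h : 0 < h -> h < d2 ->
    [/\ t + h <= b, G (t + h) - G t <= (m t + 1) * h & (m t + 1) * h < r / 2].
  move=> h0; rewrite !lt_min => /andP[/andP[hd hb] hr]; split; first lra.
    by have := hd1 h h0 hd; rewrite ler_norml => /andP[_]; lra.
  by move: hr; rewrite ltr_pdivlMr; [rewrite mulrC|lra].
have inSq y z : nm (z - c) < r / 2 -> nm (y - z) <= r / 2 -> Sq c r y.
  move=> zc yz; apply: Sq_nm; have := nm_tri z y c; lra.
have inD z : nm (z - c) < r / 2 -> D z.
  by move=> zc; apply: gq; apply: (@inSq z z); rewrite // subrr nm0; lra.
pose f (h : R) (z : C) := (W t (t + h) z - z) * (h%:C)^-1 + p z t.
have hinv (h : R) : 0 < h -> nm ((h%:C : C)^-1) = h^-1.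
  by move=> h0; rewrite nmV nmR gtr0_norm.
have fM h z : 0 < h -> h < d2 -> nm (z - c) < r / 2 -> nm (f h z) <= M.
  move=> h0 hd zc; have [hb G1 G2] := Ginc h h0 hd.
  have Wz : nm (W t (t + h) z - z) <= G (t + h) - G t.
    apply: (flow_step_bound fb (r := r / 2) _ (inD z zc)).
    - by move=> y yz; exact: inSq zc yz.
    - exact: ltW.
    - by rewrite lerDl ltW.
    - by [].
    - lra.
  rewrite /f (le_trans (nmD _ _))// nmM hinv//.
  have pz : nm (p z t) <= m t by apply: gb; apply: (@inSq z z); rewrite // subrr nm0; lra.
  have : nm (W t (t + h) z - z) / h <= m t + 1 by rewrite ler_pdivrMr//; lra.
  by rewrite /M; lra.
have [v [_ [[pH _] _]]] := flow_gen fW (ltW at_) (ltW tb).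
have fd h z : 0 < h -> h < d2 -> nm (z - c) < r / 2 -> derivable (f h) z 1.
  move=> h0 hd zc; have [hb _ _] := Ginc h h0 hd.
  have Dz := inD z zc.
  have hol : Hol D D (W t (t + h)).
    by apply: (flow_hol fW) => //; [exact: ltW|rewrite lerDl ltW].
  apply: (@derivable_addC R (fun z => (W t (t + h) z - z) * (h%:C)^-1)
     (fun z => p z t) z); last exact (pH z Dz).
  apply: (@derivable_mulC R (fun z => W t (t + h) z - z) (fun=> (h%:C)^-1) z).
    exact (derivable_subC (hol.1 z Dz) (derivable_idC z)).
  exact (derivable_cstC _ z).
have r20 : 0 < r / 2 by rewrite divr_gt0.
pose B := 144 * M / (r / 2).
have B0 : 0 < B := divr_gt0 (mulr_gt0 (ltr0Sn _ _) M0) r20.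
have fL h y1 y2 : 0 < h -> h < d2 -> nm (y1 - c) < r / 4 -> nm (y2 - c) < r / 4 ->
    nm (f h y1 - f h y2) <= B * nm (y1 - y2).
  move=> h0 hd k1 k2; apply: (@cauchy_lipschitz _ (f h) c (r / 2) M r20).
  - by move=> z; exact: fd.
  - by move=> z; exact: fM.
  - lra.
  - lra.
(* Both z and [zeta] will be within [eta] of [z1], hence within [2 * eta] of each other: the
   Lipschitz bound then costs at most [e / 2], and the other half is the error at [zeta]. *)
pose eta := Num.min (r / 8) (e / 4 / B).
have eta0 : 0 < eta by rewrite lt_min r80 divr_gt0// divr_gt0.
have eta1 : eta <= r / 8 by rewrite ge_min lexx.
have eta2 : B * eta <= e / 4 by rewrite mulrC -ler_pdivlMr// ge_min lexx orbT.
have eta20 : 0 < eta / 2 by rewrite divr_gt0.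
have eta40 : 0 < eta / 4 by rewrite divr_gt0.
have [q0 hq0] := ratc_dense z1 eta20; set z0 := ratc q0 in hq0.
have z0c : nm (z0 - c) < r / 2.
  by move: (nm_tri z1 z0 c) hq0 hc eta1 r0; rewrite (nmC z1); clear -oD fW; lra.
have Dz0 := inD z0 z0c.
have [Gmono Gac _] := fb.
have [d3 d30 hd3] := chain_ac_small Gac eta40.
(* The starting time is so close to [t] that the trajectory of [z0] has moved by at most [eta / 4]
   when it reaches [zeta] at time [t]. *)
have [qs hqs] : exists q, ratr q \in `](Num.max a (t - d3)), t[.
  by apply: rat_in_itvoo; rewrite gt_max at_ ltrBlDr ltrDl.
move: hqs; rewrite in_itv /= gt_max => /andP[/andP[sa sd] st].
set s : R := ratr qs in sa sd st.
have Gs : G t - G s <= eta / 4.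
  by apply: hd3; [exact: ltW|exact: ltW|exact: ltW|move: sd; clear -oD fW; lra].
pose zeta := W s t z0.
have zz0 : nm (zeta - z0) <= eta / 4.
  apply: (le_trans _ Gs); apply: (flow_step_bound fb (r := r / 2) _ Dz0).
  - by move=> y yz; exact: inSq z0c yz.
  - exact: ltW.
  - exact: ltW.
  - exact: ltW.
  - by move: Gs eta1 r0; clear -oD fW; lra.
have zz1 : nm (zeta - z1) < eta.
  by move: (nm_tri z0 zeta z1) zz0 hq0 eta0; clear -oD fW; lra.
have e20 : 0 < e / 2 by rewrite divr_gt0.
have [d4 d40 hd4] := g2 (qs, q0) (ltW sa) Dz0 ltac:(by rewrite tb (ltW st)) _ e20.
exists eta => //; exists (Num.min d2 d4); first by rewrite lt_min d20.
move=> h z h0; rewrite lt_min => /andP[hd2 hd4'] /= zz.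
have hn0 : h%:C != 0 :> C.
  by rewrite -(rmorph0 (real_complex R)) (inj_eq (@complexI R)) gt_eqF.
have -> : W t (t + h) z - z + h%:C * p z t = h%:C * f h z.
  by rewrite /f; field.
rewrite nmM nmR gtr0_norm// mulrC ler_pM2r//.
have [hb _ _] := Ginc h h0 hd2.
have fz : nm (f h zeta) <= e / 2.
  have := hd4 h h0 hd4'; rewrite /= -/s -/z0 -/zeta.
  rewrite (flow_comp fW (ltW sa) (ltW st) _ hb Dz0); last by rewrite lerDl ltW.
  rewrite -/zeta.
  have -> : W t (t + h) zeta - zeta - h%:C * - p zeta t = h%:C * f h zeta.
    by rewrite /f; field.
  by rewrite nmM nmR gtr0_norm// mulrC ler_pM2r.
have zc1 : nm (z - c) < r / 4.
  by move: (nm_tri z1 z c) zz hc eta1; rewrite (nmC z1); clear -oD fW; lra.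
have zc2 : nm (zeta - c) < r / 4.
  by move: (nm_tri z1 zeta c) zz1 hc eta1; rewrite (nmC z1); clear -oD fW; lra.
have zz2 : nm (z - zeta) <= 2 * eta.
  by move: (nm_tri z1 z zeta) zz zz1; rewrite (nmC z1); clear -oD fW; lra.
have Bz : B * nm (z - zeta) <= e / 2.
  by rewrite -(ler_pM2l B0) in zz2; move: zz2 eta2; clear -oD fW; lra.
have := nmD (f h z - f h zeta) (f h zeta); rewrite subrK.
by move: (fL h z zeta h0 hd2 zc1 zc2) Bz fz; clear -oD fW; lra.
Qed.

End FlowLocal.

(** * Comparison of the flow with the semigroups generated at frozen times *)

Section FlowSemigroup.
Context {R : realType}.
Local Notation C := (Cplane R).
Local Notation cmu := (@completed_lebesgue_measure R).
Context (D : set C) (U : set (C -> C)).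
Context (domD : domain D) (scD : simply_connected D) (DT : D != setT).
Context (sgU : semigroup D U) (clU : topologically_closed D U).

Let oD : open D. Proof. by case: domD. Qed.

Lemma ae_neq (a : R) : {ae cmu, forall t, t <> a}.
Proof.
exists [set a]; split.
- apply: sub_caratheodory; exact: (@measurable_set1 R a).
- exact: (@lebesgue_measure_set1 R a).
- by move=> t /= /contrapT.
Qed.

(** Continuity at time 0 propagates to every time: for s > t, v s z is the image under v t of v (s -
    t) z, which is close to z, and v t contracts the metric. The case s < t is symmetric. *)
Lemma one_parameter_cont (V : set (C -> C)) v z t (e : R) : V `<=` Hol D D ->
  one_parameter_semigroup D V v -> D z -> 0 <= t -> 0 < e ->
  exists2 d : R, 0 < d & forall s, 0 <= s -> `|s - t| < d ->
    nm (v s z - v t z) < e.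
Proof.
move=> VH [Vv v0 vD vid] Dz t0 e0.
have Hv s : 0 <= s -> Hol D D (v s) by move=> /Vv/VH.
have Y1 : [set v t z] `<=` D by move=> _ ->; exact: HolDD (Hv t t0) Dz.
have Z1 : [set z] `<=` D by move=> _ ->.
have [d d0 hd] := Dle_sep domD scD DT (@compact_set1 _ (v t z)) Y1 e0.
have [r [c [r0 c0 hr]]] := Dle_lip oD (@compact_set1 _ z) Z1.
have m0 : 0 < Num.min r (d / c) by rewrite lt_min r0 divr_gt0.
have [x x0 hx] := family_cvg_nm vid (@compact_set1 _ z) Z1 m0.
have near s : 0 < s -> s < x -> Dle D z (v s z) d.
  move=> s0 sx; have := hx s s0 sx z erefl; rewrite lt_min => /andP[h1 h2].
  have [_ _ l] := hr z z (v s z) erefl ltac:(by rewrite subrr nm0 ltW) (ltW h1).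
  by apply: Dle_le l; rewrite nmC mulrC -ler_pdivlMr// ltW.
exists x => // s s0 st.
have [->|ne] := eqVneq s t; first by rewrite subrr nm0.
apply: hd => //; first exact: HolDD (Hv s s0) Dz.
have [ts|ts] := ltP t s.
  have -> : s = t + (s - t) by rewrite addrC subrK.
  rewrite -vD// ?subr_ge0 ?(ltW ts)//; apply: (Dle_contract (Hv t t0)).
  by apply: near; [rewrite subr_gt0|move: st; rewrite ger0_norm// subr_ge0 ltW].
have {ne}ts : s < t by rewrite lt_neqAle ne.
have {1}-> : t = s + (t - s) by rewrite addrC subrK.
rewrite -vD// ?subr_ge0 ?(ltW ts)//; apply: (Dle_contract (Hv s s0)).
apply: Dle_sym; apply: near; first by rewrite subr_gt0.
by move: st; rewrite distrC ger0_norm// subr_ge0 ltW.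
Qed.

(** Both maps equal id - h p(., t) up to o(h) on [K]; [Dle_lip] converts the Euclidean error, split
    into two shares [e / (2 * c)], into the contracted metric. *)
Lemma step_vs_semigroup (V : set (C -> C)) v (p : C -> R -> C)
    (W : R -> R -> C -> C) t (K : set C) (e : R) :
  one_parameter_semigroup D V v -> infinitesimal_generator D v (p ^~ t) ->
  consistent D W p t -> compact K -> K `<=` D -> 0 < e ->
  exists2 d : R, 0 < d & forall h z, 0 < h -> h < d -> K z ->
    Dle D (v h z) (W t (t + h) z) (e * h).
Proof.
move=> [_ _ _ vid] [_ vp] cons cK KD e0.
have [r [c [r0 c0 hr]]] := Dle_lip oD cK KD.
have e'0 : 0 < e / (2 * c) by rewrite divr_gt0// mulr_gt0.
have r20 : 0 < r / 2 by rewrite divr_gt0.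
have [d1 d10 h1] := cons K _ cK KD e'0.
have [d2 d20 h2] := family_cvg_nm vp cK KD e'0.
have [d3 d30 h3] := family_cvg_nm vid cK KD r20.
have d40 : 0 < r / 2 / (e / c) by rewrite !divr_gt0.
exists (Num.min (Num.min d1 d2) (Num.min d3 (r / 2 / (e / c)))).
  by rewrite !lt_min d10 d20 d30 d40.
move=> h z hp; rewrite !lt_min => /andP[/andP[hd1 hd2] /andP[hd3 hd4]] Kz.
have k1 := h1 h z hp hd1 Kz.
have k3 := h3 h hp hd3 z Kz.
have hn0 : h%:C != 0 :> C.
  by rewrite -(rmorph0 (real_complex R)) (inj_eq (@complexI R)) gt_eqF.
have k2 : nm (v h z - z + h%:C * p z t) <= e / (2 * c) * h.
  have -> : v h z - z + h%:C * p z t = - (h%:C * ((z - v h z) / h%:C - p z t)).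
    by field.
  by rewrite nmN nmM nmR gtr0_norm// mulrC ler_pM2r// ltW// h2.
have k : nm (v h z - W t (t + h) z) <= e / c * h.
  have -> : v h z - W t (t + h) z = (v h z - z + h%:C * p z t) -
     (W t (t + h) z - z + h%:C * p z t) by ring.
  have -> : e / c * h = e / (2 * c) * h + e / (2 * c) * h.
    by field; rewrite gt_eqF.
  by rewrite (le_trans (nmB _ _))// lerD.
have ke : e / c * h < r / 2 by rewrite mulrC -ltr_pdivlMr// divr_gt0.
have [||_ _ l] := hr z (v h z) (W t (t + h) z) Kz.
- by lra.
- have := nm_tri (v h z) (W t (t + h) z) z; rewrite (nmC (W t (t + h) z) (v h z)); lra.
apply: Dle_le l.
have -> : e * h = c * (e / c * h) by field; rewrite gt_eqF.
by rewrite ler_pM2l.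
Qed.

Lemma generator_of_small_steps (p : C -> R -> C) (W : R -> R -> C -> C) t (d0 : R) :
  generators D (Hol D D) (p ^~ t) -> consistent D W p t -> 0 < d0 ->
  (forall h, 0 < h -> h < d0 -> U (W t (t + h))) -> generators D U (p ^~ t).
Proof.
move=> [v [ov iv]] cons d00 UW; exists v; split => //.
have [Hv v0 vD vid] := ov; split => // tau tau0.
have [_ Uid Ucomp] := sgU; have [UH _ _] := sgU.
apply: (closure_nm clU); first exact: Hv.
move=> K e cK KD e0; have [->|taun] := eqVneq tau 0.
  by exists id => // z Kz; rewrite v0 ?subrr ?nm0//; exact: KD.
have {taun}taup : 0 < tau by rewrite lt_neqAle eq_sym taun.
have [K' [cK' KD' hK']] : exists K' : set C, [/\ compact K', K' `<=` D &
    forall t z, 0 <= t <= tau -> K z -> K' (v t z)].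
  apply: traj_compact => //.
    by move=> x /andP[x0 _]; exact: Hv.
  move=> z x e' Dz /andP[x0 _] e'0.
  have [d dp hd] := one_parameter_cont (@subset_refl _ _) ov Dz x0 e'0.
  by exists d => // s /andP[s0 _]; exact: hd.
have [d dp hd] := Dle_sep domD scD DT cK' KD' e0.
(* With error rate [d / tau], the [n] steps of length [tau / n] accumulate exactly the tolerance
   [d]. *)
have [d1 d1p h1] := step_vs_semigroup ov iv cons cK' KD' (divr_gt0 dp taup).
have m0 : 0 < Num.min d1 d0 / tau by rewrite divr_gt0// lt_min d1p.
pose n := (Num.bound (Num.min d1 d0 / tau)^-1).+1.
have n0 : 0 < n%:R :> R by rewrite ltr0n.
pose eta := tau / n%:R.
have eta0 : 0 < eta by rewrite divr_gt0.
have : eta < Num.min d1 d0.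
  rewrite /eta mulrC -ltr_pdivlMr// -[ltRHS]invrK ltf_pV2 ?posrE ?invr_gt0//.
  by rewrite (lt_trans (archi_boundP _)) ?ltr_nat// invr_ge0 ltW.
rewrite lt_min => /andP[eta1 eta2].
pose F := W t (t + eta).
have UF : U F by exact: UW.
have UFk k : U (iter k F) by elim: k => [//|k IH]; exact: (Ucomp F (iter k F)).
have main k z : (k <= n)%N -> K z ->
    Dle D (iter k F z) (v (k%:R * eta) z) (k%:R * (d / tau * eta)).
  move=> + Kz; elim: k => [_|k IH kn].
    by rewrite !mul0r v0; [exact: Dle_refl|exact: KD].
  have keta : 0 <= k%:R * eta by rewrite mulr_ge0 ?ler0n// ltW.
  have ktau : k%:R * eta <= tau.
    by rewrite mulrCA ler_piMr ?(ltW taup)// ler_pdivrMr// mul1r ler_nat ltnW.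
  have -> : k.+1%:R * eta = eta + k%:R * eta by rewrite -natr1; ring.
  rewrite -vD//; [|exact: ltW|exact: KD].
  have -> : k.+1%:R * (d / tau * eta) = k%:R * (d / tau * eta) + d / tau * eta.
    by rewrite -natr1; ring.
  (* The accumulated error is passed through [F], which contracts it. The new error is made at a
     point of the exact trajectory, hence in the compact set [K'] where the comparison is
     uniform. *)
  apply: (@Dle_tri _ D (F (v (k%:R * eta) z))).
    exact: (Dle_contract (UH _ UF) (IH (ltnW kn))).
  by apply/Dle_sym/h1 => //; apply: hK' => //; rewrite keta.
exists (iter n F) => // z Kz; apply: hd.
- by apply: hK' => //; rewrite tau0 lexx.
- exact: HolDD (UH _ (UFk n)) (KD _ Kz).
have := main n z (leqnn _) Kz.
have -> : n%:R * eta = tau by rewrite /eta mulrC divfK// gt_eqF.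
have -> : n%:R * (d / tau * eta) = d.
  by rewrite /eta; field; rewrite !gt_eqF.
exact: Dle_sym.
Qed.

Lemma flow_generators a b W p : flow D a b W p ->
  (forall s t, a <= s -> s <= t -> t <= b -> U (W s t)) ->
  {ae cmu, forall t, a < t < b -> generators D U (p ^~ t)}.
Proof.
move=> fW UW; apply: ae_mono (flow_consistent oD fW) => t ct /andP[at_ tb].
apply: (@generator_of_small_steps p W t (b - t)).
- exact: (flow_gen fW (ltW at_) (ltW tb)).
- by apply: ct; rewrite at_.
- by rewrite subr_gt0.
- move=> h h0 hb; apply: UW; [exact: ltW|by rewrite lerDl ltW|lra].
Qed.

Lemma chain_ac_scale (a b c : R) phi : 0 < c -> chain_ac a b phi ->
  chain_ac a b (fun x y => c * phi x y).
Proof.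
move=> c0 ac e e0; have [d d0 hd] := ac _ (divr_gt0 e0 c0).
exists d => // s us ls; have := hd s us ls.
by rewrite ler_pdivlMr// mulrC /chain_sum mulr_sumr.
Qed.

Lemma flow_in_semigroup a b W p : flow D a b W p ->
  {ae cmu, forall t, a < t < b -> generators D U (p ^~ t)} ->
  forall s t, a <= s -> s <= t -> t <= b -> U (W s t).
Proof.
move=> fW gen s t as_ st tb.
have [UH Uid Ucomp] := sgU.
have HW x : s <= x -> x <= t -> Hol D D (W s x).
  by move=> sx xt; apply: (flow_hol fW) => //; exact: le_trans tb.
apply: (closure_nm clU); first exact: HW.
move=> K e cK KD e0.
have [K' [cK' KD' hK']] : exists K' : set C, [/\ compact K', K' `<=` D &
    forall x z, s <= x <= t -> K z -> K' (W s x z)].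
  apply: traj_compact => //; first by move=> x /andP[sx xt]; exact: HW.
  move=> z x e' Dz /andP[sx xt] e'0.
  have [d dp hd] := flow_cont fW Dz as_ sx (le_trans xt tb) e'0.
  by exists d => // y /andP[sy yt]; apply: hd; rewrite sy (le_trans yt).
have [d dp hd] := Dle_sep domD scD DT cK' KD' e0.
(* E x is the distance from W s x to U, uniformly on K. *)
pose S x := [set e : R | 0 <= e /\ exists2 F, U F &
   forall z, K z -> Dle D (F z) (W s x z) e].
pose E x := inf (S x).
(* Test functions are bounded by 1, so any two points of [D] are at distance at most 2; this makes
   the infimum meaningful. *)
have S2 x : s <= x -> x <= t -> S x 2.
  move=> sx xt; split => //; exists id => // z Kz f [_ f1].
  rewrite (le_trans (nmB _ _))// (_ : 2 = 1 + 1 :> R)// lerD// f1//.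
    exact: KD.
  exact: HolDD (HW x sx xt) (KD _ Kz).
have hS x : s <= x -> x <= t -> has_inf (S x).
  by move=> sx xt; split; [exists 2; exact: S2|exists 0 => y []].
have E2 x : s <= x -> x <= t -> E x <= 2.
  by move=> sx xt; apply: ge_inf; [exact: (hS x sx xt).2|exact: S2].
have E0 x : s <= x -> x <= t -> 0 <= E x.
  by move=> sx xt; apply: lb_le_inf; [exists 2; exact: S2|move=> y []].
have Estep x y F1 (q : R) : s <= x -> x <= y -> y <= t -> 0 <= q -> U F1 ->
    (forall z, K' z -> Dle D (F1 z) (W x y z) q) -> E y - E x <= q.
  move=> sx xy yt q0 UF1 hF1.
  rewrite lerBlDl -lerBlDr; have xt := le_trans xy yt.
  apply: lb_le_inf; first by exists 2; exact: S2.
  move=> q' [q'0 [F UF hF]]; rewrite lerBlDr.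
  apply: ge_inf; first exact: (hS y (le_trans sx xy) yt).2.
  split; first exact: addr_ge0.
  exists (F1 \o F); first exact: Ucomp.
  move=> z Kz /=.
  rewrite (flow_comp fW as_ sx xy (le_trans yt tb) (KD _ Kz)).
  apply: (@Dle_tri _ D (F1 (W s x z))).
    exact: (Dle_contract (UH _ UF1) (hF z Kz)).
  by apply: hF1; apply: hK' => //; rewrite sx.
have Es : E s <= 0.
  apply: ge_inf; first exact: (hS s (lexx s) st).2.
  split => //; exists id => // z Kz.
  by rewrite (flow_id fW as_ (le_trans st tb) (KD _ Kz)); exact: Dle_refl.
have [K1 [cK1 KD1 [r1 r10 hr1]]] := compact_nbhd oD cK' KD'.
have [G [m fb]] := flow_bound fW cK1 KD1.
have [Gm Gac _] := fb.
have [r2 [c [r20 c0 hr2]]] := Dle_lip oD cK' KD'.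
pose r := Num.min r1 r2; have r0 : 0 < r by rewrite lt_min r10.
(* The slope [c] serves while [G] grows by less than [r]. Beyond that, the trivial bound 2 on the
   increment of [E] is at most [2 / r] times the growth. *)
pose L := Num.max c (2 / r); have L0 : 0 < L by rewrite lt_max c0.
have Elip x y : s <= x -> x <= y -> y <= t -> E y - E x <= L * (G y - G x).
  move=> sx xy yt; have ax := le_trans as_ sx; have yb := le_trans yt tb.
  have Gxy := Gm x y ax xy yb.
  have [Gr|rG] := ltP (G y - G x) r; last first.
    apply: (@le_trans _ _ 2).
      have := E2 y (le_trans sx xy) yt; have := E0 x sx (le_trans xy yt); lra.
    apply: (@le_trans _ _ (2 / r * r)); first by rewrite divfK// gt_eqF.
    apply: ler_pM => //; first by rewrite divr_ge0// ltW.
      exact: ltW.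
    by rewrite le_max lexx orbT.
  apply: (Estep x y id) => //.
    by rewrite mulr_ge0 ?(ltW L0)// subr_ge0.
  move=> z Kz; move: Gr; rewrite lt_min => /andP[Gr1 Gr2].
  have Wz : nm (W x y z - z) <= G y - G x.
    apply: (flow_step_bound fW fb _ (KD' _ Kz) ax xy yb Gr1) => w.
    exact: hr1 Kz.
  have [|_ _ l] := hr2 z z (W x y z) Kz ltac:(by rewrite subrr nm0 ltW).
    by apply: le_trans Wz _; exact: ltW.
  apply: Dle_le l; rewrite nmC; apply: ler_pM => //; [exact: ltW|exact: nm_ge0|].
  by rewrite le_max lexx.
have Et : E t <= E s.
  apply: (@dini_le R s t E st).
    apply: (@chain_ac_le R s t _ (fun x y => L * (G y - G x))) => //.
    by apply: chain_ac_scale => //; exact: chain_ac_sub as_ tb Gac.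
  (* The initial time is discarded because the expansion is available only at times strictly after
     [a]. *)
  have good := ae_mono2 (fun x h1 h2 => conj h1 h2) (flow_consistent oD fW) (ae_neq s).
  apply: ae_mono2 good gen => x [cx xs] gx /andP[sx xt] q q0.
  have {}sx : s < x by rewrite lt_neqAle sx andbT eq_sym; apply/eqP.
  have ab : a < x < b by rewrite (le_lt_trans as_ sx) (lt_le_trans xt tb).
  have [v [ov iv]] := gx ab.
  have [d1 d1p h1] := step_vs_semigroup ov iv (cx ab) cK' KD' q0.
  exists (Num.min d1 (t - x)); first by rewrite lt_min d1p subr_gt0.
  move=> h h0; rewrite lt_min => /andP[hd1 hxt].
  have [Uv _ _ _] := ov.
  apply: (Estep x (x + h) (v h)).
  - exact: ltW.
  - by rewrite lerDl ltW.
  - lra.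
  - by rewrite mulr_ge0// ltW.
  - by apply: Uv; exact: ltW.
  - by move=> z Kz; exact: h1.
have dE : 0 < d - E t by lra.
have [q [q0 [F UF hF]] qd] := inf_adherent dE (hS t st (lexx t)).
exists F => // z Kz; apply: hd.
- by apply: hK' => //; rewrite st lexx.
- exact: HolDD (UH _ UF) (KD _ Kz).
apply: Dle_sym; apply: Dle_le (hF z Kz).
by move: qd; rewrite -/(E t); lra.
Qed.

End FlowSemigroup.

(** * Integral majorants and time reversal *)

Section Primitive.
Context {R : realType}.
Local Notation mu := (@lebesgue_measure R).
Local Notation cmu := (@completed_lebesgue_measure R).
Local Notation lebesgueType := (caratheodory_type (@wlength R idfun)^*%mu).

Lemma negligible_completed (N : set R) : mu.-negligible N -> cmu.-negligible N.
Proof. by move=> [A [mA A0 NA]]; exists A; split => //; exact: sub_caratheodory. Qed.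

Lemma completed_measurable_core (A : set lebesgueType) : measurable A ->
  exists X : set (measurableTypeR R), [/\ measurable X, X `<=` A &
    cmu.-negligible (A `\` X)].
Proof.
move=> mA; have : (completed_algebra_gen mu) A.
  by rewrite -g_sigma_completed_algebra_genE completed_caratheodory_measurable.
move=> [X mX [N nN XN]]; exists X; split => //.
  by rewrite -XN => x; left.
apply: negligible_completed; apply: negligibleS nN.
by rewrite -XN => x [[//|]].
Qed.

(** The intervals of a chain are merged into one set, whose measure is their total length and over
    which the integral is the sum of increments; absolute continuity of the integral then applies.
    The derivative is stated on both sides so that it survives time reversal. *)
Lemma lebesgue_primitive (m : R -> R) (a b : R) : (forall x, 0 <= m x) ->
  mu.-integrable setT (EFin \o m) ->
  exists G : R -> R, [/\ forall x y, x <= y -> G x <= G y,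
    chain_ac a b (fun x y => G y - G x) &
    {ae cmu, forall t, forall e : R, 0 < e -> exists2 d : R, 0 < d &
      forall h, `|h| < d -> `|G (t + h) - G t - h * m t| <= e * `|h|}].
Proof.
move=> m0 im; pose G x := (\int[mu]_(t in [set` `]-oo, x]]) m t)%R.
have mI (x y : R) : @measurable _ (measurableTypeR R) [set` `]x, y]].
  exact: measurable_itv.
have GB x y : x <= y -> G y - G x = (\int[mu]_(t in [set` `]x, y]]) m t)%R.
  move=> xy; apply: Rintegral_itvB => //.
  by apply: integrableS im => //; exact: measurable_itv.
exists G; split.
- by move=> x y xy; rewrite -subr_ge0 GB//; exact: Rintegral_ge0.
- move=> e e0; have [d [d0 hd]] := integral_normr_continuous im e0.
  exists d => // s us ls.
  suff [A [mA _ muA <-]] : exists A : set (measurableTypeR R),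
      [/\ measurable A, A `<=` [set` `]-oo, b]],
          mu A = (chain_sum s (fun x y => y - x))%:E &
          (\int[mu]_(t in A) m t)%R = chain_sum s (fun x y => G y - G x)].
    have /(hd A mA)/ltW : (mu A < d%:E)%E by rewrite muA lte_fin.
    by under eq_Rintegral do rewrite ger0_norm//.
  elim: s b us {ls} => [|p s IH] t.
    move=> _; exists set0; rewrite /chain_sum !big_nil; split => //.
      by rewrite measure0.
    exact: Rintegral_set0.
  move=> /= [/IH [A [mA Ap muA iA]] p12 pt].
  exists (A `|` [set` `]p.1, p.2]]).
  have dj : [disjoint A & [set` `]p.1, p.2]]].
    apply/disj_setPS => x [/Ap /=]; rewrite !in_itv /= => x1 /andP[x2 _].
    by move: (lt_le_trans x2 x1); rewrite ltxx.
  split.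
  + exact: measurableU.
  + move=> x [/Ap|] /=; rewrite !in_itv /=.
      by move=> x1; rewrite (le_trans x1)// (le_trans p12).
    by move=> /andP[_ x1]; rewrite (le_trans x1).
  + transitivity (mu A + mu [set` `]p.1, p.2]])%E.
      by apply: measureU => //; apply/eqP; rewrite -disj_set2E.
    rewrite muA lebesgue_measure_itv /= lte_fin /chain_sum big_cons.
    rewrite addrC EFinD; congr (_ + _)%E.
    case: ltP => // h; have -> : p.1 = p.2 by apply/eqP; rewrite eq_le p12 h.
    by rewrite subrr.
  + rewrite Rintegral_setU//; last first.
      by apply: integrableS im => //; exact: measurableU.
    by rewrite iA -GB// /chain_sum big_cons addrC.
- have loc : locally_integrable setT m by apply: open_integrable_locally => //; exact: openT.
  have int (y : R) : mu.-integrable [set` `]-oo, y]] (EFin \o m).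
    by apply: integrableS im => //; exact: measurable_itv.
  have := FTC1Ny int loc.
  move=> h; apply: negligible_completed; apply: negligibleS h => t /= nh [dG Gm].
  apply: nh => e e0.
  have cG : (fun h => h^-1 *: ((G \o shift t) (h *: 1) - G t)) @ 0^' --> 'D_1 G t := dG.
  rewrite -derive1E Gm in cG.
  have : nbhs (m t) (ball (m t) e) by exact: nbhsx_ballx.
  move=> /cG W.
  have {W} : nbhs (0 : R) [set h | h != 0 ->
      ball (m t) e (h^-1 *: ((G \o shift t) (h *: 1) - G t))] by exact: W.
  move=> /nbhs_ballP[d /= d0 dP]; exists d => // h hd.
  have [->|h0] := eqVneq h 0; first by rewrite addr0 subrr mul0r subrr normr0 mulr0.
  have := dP h; rewrite /ball /= sub0r normrN => /(_ hd h0).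
  rewrite -[h *: 1]/(h * 1) mulr1 -[_ *: _]/(_ * _) [h + t]addrC => le.
  have -> : G (t + h) - G t - h * m t = - (h * (m t - h^-1 * (G (t + h) - G t))).
    by field.
  by rewrite normrN normrM mulrC ler_pM2r ?normr_gt0// ltW.
Qed.

End Primitive.

(** * Replacing a Lebesgue integrable bound by a Borel one *)

Section BorelMajorant.
Context {R : realType}.
Local Notation mu := (@lebesgue_measure R).
Local Notation cmu := (@completed_lebesgue_measure R).
Local Notation lebesgueType := (caratheodory_type (@wlength R idfun)^*%mu).

(** The second bound feeds the induction for the first: if n < y, the count so far is at most n,
    hence at most y, and one more term keeps it below y + 1. *)
Lemma count_lt_le (y : R) n : 0 <= y ->
  \sum_(0 <= k < n) (k%:R < y)%R%:R <= y + 1 :> R /\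
  \sum_(0 <= k < n) (k%:R < y)%R%:R <= n%:R :> R.
Proof.
move=> y0; elim: n => [|n [IH1 IH2]]; first by rewrite big_geq// lexx addr_ge0.
rewrite big_nat_recr//=; case: ltP => h /=; rewrite ?addr0.
  split; first by rewrite lerD2r (le_trans IH2)// ltW.
  have -> : n.+1%:R = n%:R + 1 :> R by rewrite natr1.
  by rewrite lerD2r.
by split => //; rewrite (le_trans IH2)// ler_nat.
Qed.

Lemma count_lt_ge (y : R) n : y <= n%:R -> 0 <= y ->
  y <= \sum_(0 <= k < n) (k%:R < y)%R%:R.
Proof.
elim: n => [|n IH] yn y0; first by rewrite big_geq.
rewrite big_nat_recr//=; have [yn'|ny] := leP y n%:R.
  by rewrite addr0; exact: IH.
have -> : \sum_(0 <= k < n) (k%:R < y)%R%:R = n%:R :> R.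
  transitivity (\sum_(0 <= k < n) (1 : R)); last by rewrite sumr_const_nat subn0.
  rewrite big_nat_cond [RHS]big_nat_cond; apply: eq_bigr => k /andP[/andP[_ kn] _].
  by rewrite (le_lt_trans _ ny)// ler_nat ltnW.
by rewrite natr1.
Qed.

(* m t counts the n such that M t > n, each of these sets being first shrunk to
   a Borel set; hence m <= M + 1 everywhere and M <= m almost everywhere. *)
Lemma borel_majorant (a b : R) (M : R -> R) :
  (forall x, x \in `[a, b] -> 0 <= M x) ->
  cmu.-integrable [set` `[a, b]] (EFin \o M) ->
  exists m : R -> R, [/\ forall x, 0 <= m x, mu.-integrable setT (EFin \o m) &
    {ae cmu, forall t, a <= t <= b -> M t <= m t}].
Proof.
move=> M0 iM.
have mI : @measurable _ lebesgueType [set` `[a, b]].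
  by apply: sub_caratheodory; exact: measurable_itv.
have mM : @measurable_fun _ _ lebesgueType R [set` `[a, b]] M.
  by apply/measurable_EFinP; exact: measurable_int iM.
pose A (n : nat) : set lebesgueType := [set` `[a, b]] `&` [set x | n%:R < M x].
have mA n : measurable (A n).
  have -> : A n = [set` `[a, b]] `&` M @^-1` [set` `]n%:R, +oo[].
    by rewrite /A; congr (_ `&` _); apply/seteqP; split => x /=; rewrite in_itv /= andbT.
  by apply: mM => //; exact: measurable_itv.
have [X hX] := choice (fun n => completed_measurable_core (mA n)).
have mX n : @measurable _ (measurableTypeR R) (X n) by have [] := hX n.
have XA n : X n `<=` A n by have [] := hX n.
pose q x := (\sum_(n <oo) (\1_(X n) x)%:E)%E : \bar R.
have q0 x : (0 <= q x)%E by apply: nneseries_ge0 => n _ _; rewrite lee_fin.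
have qle x : x \in `[a, b] -> (q x <= (M x + 1)%:E)%E.
  move=> hx; apply: lime_le; first exact: is_cvg_nneseries.
  apply: nearW => n; rewrite sumEFin lee_fin.
  apply: le_trans (count_lt_le n (M0 x hx)).1; apply: ler_sum => k _.
  rewrite indicE; case: (boolP (x \in X k)) => // /set_mem/XA[_ /= ->] //.
have q_out x : x \notin `[a, b] -> q x = 0%E.
  move=> hx; apply: eseries0 => n _ _; rewrite indicE.
  case: (boolP (x \in X n)) => // /set_mem/XA[/= hx' _].
  by move: hx; rewrite hx'.
have qfin x : q x \is a fin_num.
  rewrite ge0_fin_numE//; have [/qle h|/q_out ->] := boolP (x \in `[a, b]); last by rewrite ltry.
  exact: le_lt_trans h (ltry _).
have mq : measurable_fun setT (q : measurableTypeR R -> \bar R).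
  apply: (@ge0_emeasurable_sum _ _ _ setT (fun n x => (\1_(X n) x)%:E) xpredT) => //.
  move=> n _; apply/measurable_EFinP; exact: measurable_indic.
have mqc : measurable_fun setT (q : lebesgueType -> \bar R).
  by move=> _ Y mY; apply: sub_caratheodory; exact: (mq measurableT Y mY).
(* The two measures agree on the Borel sets [X n], so the integrals of [q] agree term by term; the
   one for the completed measure is dominated by that of [M + 1] over [[a, b]]. *)
have iq : (\int[mu]_x q x < +oo)%E.
  have -> : (\int[mu]_x q x = \int[cmu]_x q x)%E.
    have mXc n : @measurable _ lebesgueType (X n) by exact: sub_caratheodory (mX n).
    have i1 n : measurable_fun setT (fun x : measurableTypeR R => (\1_(X n) x : R)%:E).
      by apply/measurable_EFinP; exact: measurable_indic.
    have i2 n : measurable_fun setT (fun x : lebesgueType => (\1_(X n) x : R)%:E).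
      by apply/measurable_EFinP; exact: measurable_indic.
    have i0 n x : setT x -> (0 <= (\1_(X n) x : R)%:E)%E by rewrite lee_fin.
    rewrite /q (integral_nneseries mu measurableT i1 i0).
    rewrite (@integral_nneseries _ lebesgueType R cmu setT measurableT _ i2 i0).
    apply: eq_eseriesr => n _.
    rewrite (integral_indic mu measurableT (mX n)).
    by rewrite (@integral_indic _ lebesgueType R cmu setT measurableT (X n) (mXc n)).
  have -> : (\int[cmu]_x q x = \int[cmu]_(x in [set` `[a, b]]) q x)%E.
    rewrite [RHS]integral_mkcond; apply: eq_integral => x _.
    rewrite patchE; case: ifPn => // /negP hx; rewrite q_out//.
    by apply/negP => h; apply: hx; rewrite inE.
  have i1 : cmu.-integrable [set` `[a, b]] (EFin \o (fun x => M x + 1)).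
    have -> : EFin \o (fun x => M x + 1) = ((EFin \o M) \+ (fun _ => 1%:E))%E by [].
    apply: integrableD => //.
    apply/integrableP; split; first exact: measurable_cst.
    rewrite integral_cst//= normr1 mul1e.
    have -> : cmu [set` `[a, b]] = mu [set` `[a, b]] by [].
    by rewrite lebesgue_measure_itv /=; case: ifP => _; rewrite ltry.
  have [mi1 fi1] := integrableP _ _ _ i1.
  apply: le_lt_trans fi1.
  apply: (@ge0_le_integral _ lebesgueType R cmu [set` `[a, b]] mI q _ (fun x _ => q0 x)).
  - exact: measurable_funS mqc.
  - exact: measurableT_comp.
  - by move=> x hx; rewrite (le_trans (qle x hx))// lee_fin ler_norm.
exists (fine \o q); split.
- by move=> x; rewrite fine_ge0.
- apply/integrableP; split.
    by apply/measurable_EFinP; exact: measurableT_comp.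
  apply: le_lt_trans iq; rewrite le_eqVlt; apply/orP; left; apply/eqP.
  apply: eq_integral => x _ /=; rewrite ger0_norm ?fine_ge0// fineK//.
- have neg : cmu.-negligible (\bigcup_n (A n `\` X n)).
    by apply: negligible_bigcup => n; have [] := hX n.
  apply: negligibleS neg => t /= /not_implyP[ht nM].
  apply: contrapT => nU; apply: nM.
  have tab : t \in `[a, b] by rewrite in_itv.
  have tX n : (n%:R < M t) -> X n t.
    move=> h; apply: contrapT => nX; apply: nU; exists n => //.
  rewrite -lee_fin fineK//.
  pose n := Num.bound (M t).
  have Mn : M t <= n%:R by rewrite ltW// archi_boundP// M0.
  apply: le_trans (_ : (\sum_(0 <= k < n) (\1_(X k) t)%:E <= _)%E); last first.
    by apply: nneseries_lim_ge => k _ _; rewrite lee_fin.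
  rewrite sumEFin lee_fin (le_trans (count_lt_ge Mn (M0 t tab)))//.
  apply: ler_sum => k _; rewrite indicE; case: (ltP k%:R (M t)) => //= h.
  by rewrite mem_set//; exact: tX.
Qed.

End BorelMajorant.

(** * Time reversal of null sets and of absolute continuity *)

Section Reflection.
Context {R : realType}.
Local Notation C := (Cplane R).
Local Notation mu := (@lebesgue_measure R).
Local Notation cmu := (@completed_lebesgue_measure R).

Lemma lebesgue_measure_reflect (c : R) (A : set (measurableTypeR R)) :
  measurable A -> mu ((fun x => c - x) @^-1` A) = mu A.
Proof.
move=> mA; pose r (x : measurableTypeR R) : measurableTypeR R := c - x.
have mr : measurable_fun setT r by apply: measurable_funB => //.
symmetry; apply: (@lebesgue_measure_unique R (pushforward mu r)) => // X.
move=> /ocitvP[->|[[x y] /= xy ->]]; first by rewrite !measure0.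
rewrite /pushforward.
have -> : r @^-1` [set` `]x, y]] = [set` `[c - y, c - x[].
  by apply/seteqP; split => t /=; rewrite !in_itv /= /r; lra.
by rewrite !lebesgue_measure_itv /= !lte_fin ltrD2l ltrN2; case: ifP => // _;
  rewrite -!EFinB; congr (_%:E); ring.
Qed.

(** The exceptional set need not be Borel. It is first enclosed in a countable intersection of open
    sets of measure tending to 0, a Borel null set to which invariance under reflection applies. *)
Lemma ae_reflect (c : R) (P : R -> Prop) : {ae cmu, forall t, P t} ->
  {ae cmu, forall t, P (c - t)}.
Proof.
move=> N0; pose N := ~` [set t | P t]; have {}N0 : cmu.-negligible N := N0.
have e0 n : 0 < n.+1%:R^-1 :> R by rewrite invr_gt0.
have [W hW] := choice (fun n => negligible_open N0 (e0 n)).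
have mW n : @measurable _ (measurableTypeR R) (W n).
  by apply: open_measurable; have [] := hW n.
pose B := \bigcap_n W n.
have mB : @measurable _ (measurableTypeR R) B by exact: bigcapT_measurable.
have B0 : mu B = 0%E.
  apply/eqP; rewrite -measure_le0; apply/lee_addgt0Pr => e ep; rewrite add0e.
  have [n ne] : exists n, n.+1%:R^-1 < e.
    exists (Num.bound e^-1); rewrite -[ltRHS]invrK ltf_pV2 ?posrE ?invr_gt0//.
    by rewrite (lt_trans (archi_boundP _)) ?ltr_nat// invr_ge0 ltW.
  apply: (@le_trans _ _ (mu (W n))).
    by apply: le_measure; rewrite ?inE//; exact: bigcap_inf.
  by have [_ _ /ltW h] := hW n; rewrite (le_trans h)// lee_fin ltW.
apply: negligible_completed; exists ((fun x => c - x) @^-1` B); split.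
- have mr : measurable_fun setT ((fun x => c - x) : measurableTypeR R -> measurableTypeR R).
    by apply: measurable_funB.
  by rewrite -[X in measurable X]setTI; exact: mr.
- by rewrite -B0; exact: lebesgue_measure_reflect.
- by move=> t /= nP n _; have [_ NW _] := hW n; exact: NW.
Qed.

Lemma upto_rcons (a t x y : R) (s : seq (R * R)) : a <= x -> x <= y ->
  upto y t s -> upto a t (rcons s (x, y)).
Proof.
move=> ax xy; elim: s t => [|p s IH] t /=; first by move=> yt; split.
by move=> [/IH].
Qed.

Definition reflect_chain (c : R) (s : seq (R * R)) :=
  rev [seq (c - p.2, c - p.1) | p <- s].

Lemma upto_reflect (a t c : R) s : upto a t s ->
  upto (c - t) (c - a) (reflect_chain c s).
Proof.
rewrite /reflect_chain; elim: s t => [|p s IH] t /=; first by rewrite lerD2l lerN2.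
move=> [/IH h1 h2 h3]; rewrite rev_cons; apply: upto_rcons => //;
by rewrite lerD2l lerN2.
Qed.

Lemma chain_sum_reflect (c : R) s (phi : R -> R -> R) :
  chain_sum (reflect_chain c s) phi = chain_sum s (fun x y => phi (c - y) (c - x)).
Proof.
rewrite /chain_sum /reflect_chain.
rewrite -[LHS](perm_big _ (_ : perm_eq [seq (c - p.2, c - p.1) | p <- s] _)).
  by rewrite big_map.
by rewrite perm_sym perm_rev.
Qed.

Lemma chain_ac_reflect (a b c : R) (phi : R -> R -> R) : chain_ac a b phi ->
  chain_ac (c - b) (c - a) (fun x y => phi (c - y) (c - x)).
Proof.
move=> ac e e0; have [d d0 hd] := ac e e0; exists d => // s us ls.
rewrite -chain_sum_reflect; apply: hd.
  by have := upto_reflect c us; rewrite !opprB !addrA !(addrC c) !addrK.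
rewrite chain_sum_reflect /chain_sum; apply: le_lt_trans ls.
by rewrite le_eqVlt; apply/orP; left; apply/eqP; apply: eq_bigr => p _; ring.
Qed.

Lemma upto_nth (a t : R) (s : seq (R * R)) i p0 : upto a t s -> (i < size s)%N ->
  [/\ a <= (nth p0 s i).1, (nth p0 s i).1 <= (nth p0 s i).2 & (nth p0 s i).2 <= t].
Proof.
elim: s i t => [//|p s IH] [|i] t /= [h1 h2 h3].
  by move=> _; split => //; exact: upto_bounds h1.
move=> /(IH _ _ h1)[k1 k2 k3]; split => //.
by rewrite (le_trans k3)// (le_trans h2).
Qed.

Lemma upto_nth_lt (a t : R) (s : seq (R * R)) i j p0 : upto a t s ->
  (i < j)%N -> (j < size s)%N -> (nth p0 s j).2 <= (nth p0 s i).1.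
Proof.
elim: s i j t => [//|p s IH] [|i] [|j] t //= [h1 h2 h3].
  by move=> _ /(upto_nth p0 h1)[].
move=> ij js; exact: (IH i j p.1 h1 ij js).
Qed.

Lemma chain_ac_absolutely_continuous (a b : R) (u : R -> C) :
  absolutely_continuous a b u -> chain_ac a b (fun x y => nm (u y - u x)).
Proof.
move=> ac e e0; have [d d0 hd] := ac e e0; exists d => // s us ls.
pose p0 : R * R := (0, 0).
have sumE (phi : R -> R -> R) : chain_sum s phi =
    \sum_(i < size s) phi (nth p0 s i).1 (nth p0 s i).2.
  by rewrite /chain_sum (big_nth p0) big_mkord.
have := hd (size s) (fun i => (nth p0 s i).1) (fun i => (nth p0 s i).2).
have tr : trivIset setT (fun i : 'I_(size s) => [set` `](nth p0 s i).1, (nth p0 s i).2[]).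
  move=> i j _ _ [x [/=]]; rewrite !in_itv /= => /andP[i1 i2] /andP[j1 j2].
  apply/val_inj; have [ij|ji|//] := ltngtP i j; exfalso.
    have := upto_nth_lt p0 us ij (ltn_ord j).
    by rewrite leNgt (lt_trans i1 j2).
  have := upto_nth_lt p0 us ji (ltn_ord i).
  by rewrite leNgt (lt_trans j1 i2).
move=> /(_ (fun i => upto_nth p0 us (ltn_ord i)) tr).
have ls' : \sum_(i < size s) ((nth p0 s i).2 - (nth p0 s i).1) < d.
  by rewrite -(sumE (fun x y => y - x)).
move=> /(_ ls'); under eq_bigr do rewrite normE.
by rewrite -rmorph_sum ltcR (sumE (fun x y => nm (u y - u x))) => /ltW.
Qed.

(** Covers trajectories starting at the final time of a flow, for which the associated field may
    provide no solution. *)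
Lemma chain_ac_point (a : R) (phi : R -> R -> R) : phi a a = 0 ->
  chain_ac a a phi.
Proof.
move=> p0; apply: (@chain_ac_le R a a _ (fun x y => 0)).
  move=> x y ax xy ya; have xa : x = a by apply/eqP; rewrite eq_le ax (le_trans xy).
  by have -> : y = a by [apply/eqP; rewrite eq_le ya -xa xy]; rewrite xa p0.
by move=> e e0; exists 1 => // s _ _; rewrite /chain_sum big1 ?ltW.
Qed.

Lemma has_derivative_nm (u : R -> C) (t : R) (l : C) : has_derivative u t l ->
  forall e : R, 0 < e -> exists2 d : R, 0 < d & forall h, `|h| < d ->
    nm (u (t + h) - u t - h%:C * l) <= e * `|h|.
Proof.
move=> du e e0.
have W : nbhs (0 : R) [set h | h != 0 -> nm ((u (t + h) - u t) / h%:C - l) < e].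
  exact: (du _ (nbhs_nm l e0)).
move/nbhs_ballP : W => [d /= d0 dP]; exists d => // h hd.
have [->|h0] := eqVneq h 0.
  by rewrite addr0 subrr rmorph0 mul0r subrr nm0 normr0 mulr0.
have := dP h; rewrite /ball /= sub0r normrN => /(_ hd h0) le.
have hC : h%:C != 0 :> C.
  by rewrite -(rmorph0 (real_complex R)) (inj_eq (@complexI R)).
have -> : u (t + h) - u t - h%:C * l = h%:C * ((u (t + h) - u t) / h%:C - l).
  by field.
by rewrite nmM nmR mulrC ler_pM2r ?normr_gt0// ltW.
Qed.

End Reflection.

(** * The theorem *)

Section EvolutionFlows.
Context {R : realType}.
Local Notation C := (Cplane R).
Local Notation cmu := (@completed_lebesgue_measure R).
Context (D : set C) (T : \bar R) (I : set R) (hI : time_interval T I).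

Lemma time_interval_ge0 t : I t -> 0 <= t.
Proof. by case: hI => _ [[_ ->]|->] []. Qed.

Lemma time_interval_le t x : I t -> 0 <= x -> x <= t -> I x.
Proof.
case: hI => _ [[_ ->]|->] [t0 tT] x0 xt; split => //.
  by apply: le_trans tT; rewrite lee_fin.
by apply: le_lt_trans tT; rewrite lee_fin.
Qed.

Lemma time_interval_lt t x : I t -> x < t -> (x%:E < T)%E.
Proof.
case: hI => _ [[_ ->]|->] [t0 tT] xt.
  by apply: lt_le_trans tT; rewrite lte_fin.
by apply: lt_trans tT; rewrite lte_fin.
Qed.

Lemma herglotz_bound (p : C -> R -> C) (b : R) (K : set C) :
  herglotz_vector_field D I p -> I b -> compact K -> K `<=` D ->
  exists G m : R -> R, [/\ forall x y, x <= y -> G x <= G y,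
    chain_ac 0 b (fun x y => G y - G x),
    {ae cmu, forall t, forall e : R, 0 < e -> exists2 d : R, 0 < d &
      forall h, `|h| < d -> `|G (t + h) - G t - h * m t| <= e * `|h|} &
    {ae cmu, forall t, 0 <= t <= b -> forall z, K z -> nm (p z t) <= m t}].
Proof.
move=> [_ _ hb] Ib cK KD; have [M [M0 [mM iM] bM]] := hb K cK KD.
have sub : [set` `[0, b]] `<=` I.
  by move=> x /=; rewrite in_itv /= => /andP[x0 xb]; exact: time_interval_le Ib x0 xb.
have [|m [m0 im mMm]] := @borel_majorant R 0 b M _ (iM _ _ sub).
  by move=> x hx; apply: M0; exact: sub.
have [G [Gm Gac Gd]] := lebesgue_primitive 0 b m0 im.
exists G, m; split => //.
apply: ae_mono2 bM mMm => t bt Mt tb z Kz; apply: le_trans (Mt tb).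
rewrite -lecR -normE; apply: bt => //; apply: sub; by rewrite /= in_itv.
Qed.

Lemma evolution_flow (w : R -> R -> C -> C) (p : C -> R -> C) (b : R) :
  evolution_family D I w -> associated_field D T I w p -> I b ->
  flow D 0 b w p.
Proof.
move=> [wH w0 wC _] [hp wsol] Ib.
have IB x : 0 <= x -> x <= b -> I x by exact: time_interval_le.
split.
- move=> s t s0 st tb; apply: wH => //; apply: IB => //.
    exact: le_trans tb.
  exact: le_trans st.
- by move=> s z s0 sb; apply: w0; exact: IB.
- move=> s t u z s0 st tu ub; have t0 := le_trans s0 st.
  have tb := le_trans tu ub.
  apply: wC => //; apply: IB => //; [exact: le_trans tb|exact: le_trans tu].
- move=> z s Dz s0 sb; have [->|sb'] := eqVneq s b.
    by apply: chain_ac_point; rewrite subrr nm0.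
  have {}sb' : s < b by rewrite lt_neqAle sb'.
  have [_ ac _ _] := wsol z s Dz s0 (time_interval_lt Ib sb').
  apply: chain_ac_absolutely_continuous; apply: ac => x /=; rewrite in_itv /=.
  by move=> /andP[sx xb]; split => //; apply: IB => //; exact: le_trans sx.
- move=> z s Dz s0 sb; have [->|sb'] := eqVneq s b.
    by apply: ae_all => t /andP[h1 /(le_lt_trans h1)]; rewrite ltxx.
  have {}sb' : s < b by rewrite lt_neqAle sb'.
  have [_ _ de _] := wsol z s Dz s0 (time_interval_lt Ib sb').
  apply: ae_mono de => t dt /andP[st tb] e e0.
  have Jt : I t /\ s <= t by split => //; apply: IB; [exact: le_trans st|exact: ltW].
  have [d d0 hd] := has_derivative_nm (dt Jt) e0.
  exists d => // h h0 hh; have := hd h; rewrite gtr0_norm// => /(_ hh).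
  exact.
- by move=> t t0 tb; case: hp => hg _ _; apply: hg; exact: IB.
- move=> K cK KD; have [G [m [Gm Gac Gd bm]]] := herglotz_bound hp Ib cK KD.
  exists G, m; split => //; first by move=> x y _ xy _; exact: Gm.
  apply: ae_mono2 Gd bm => t gd gb /andP[t0 tb]; split; last first.
    by apply: gb; rewrite t0 ltW.
  move=> e e0; have [d d0 hd] := gd e e0; exists d => // h h0 hh.
  by have := hd h; rewrite gtr0_norm// => /(_ hh).
Qed.

(** Reflecting both times and exchanging them turns the reverse composition rule into the forward
    one, and dv/ds = p into the equation with -p required of a flow. *)
Lemma reverse_evolution_flow (w : R -> R -> C -> C) (p : C -> R -> C) (c : R) :
  reverse_evolution_family D I w -> reverse_associated_field D I w p -> I c ->
  flow D 0 c (fun s t => w (c - t) (c - s)) (fun z t => p z (c - t)).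
Proof.
move=> [wH w0 wC _] [hp wsol] Ic.
have IB x : 0 <= x -> x <= c -> I (c - x).
  move=> x0 xc; apply: (time_interval_le Ic); first by rewrite subr_ge0.
  by rewrite lerBlDl lerDr.
have flip (x y : R) : x <= y -> c - y <= c - x by rewrite lerD2l lerN2.
split.
- move=> s t s0 st tb; apply: wH; [apply: IB|apply: IB|exact: flip] => //.
    exact: le_trans st.
  exact: le_trans tb.
- by move=> s z s0 sb; apply: w0; exact: IB.
- move=> s t u z s0 st tu ub; have t0 := le_trans s0 st.
  have tb := le_trans tu ub.
  apply: wC; [apply: IB|apply: IB|apply: IB|exact: flip|exact: flip] => //.
    exact: le_trans tu.
  exact: le_trans tb.
- move=> z s Dz s0 sc; have [->|sc'] := eqVneq s c.
    by apply: chain_ac_point; rewrite subrr nm0.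
  have cs0 : c - s != 0 by rewrite subr_eq0 eq_sym.
  have [[_ ac _ _] _] := wsol z (c - s) Dz (IB s s0 sc) cs0.
  have := chain_ac_reflect c (chain_ac_absolutely_continuous (ac _ _ (@subset_refl _ _))).
  rewrite subr0 subKr; apply: chain_ac_le => x y _ _ _.
  by rewrite nmC.
- move=> z s Dz s0 sc; have [->|sc'] := eqVneq s c.
    by apply: ae_all => t /andP[h1 /(le_lt_trans h1)]; rewrite ltxx.
  have cs0 : c - s != 0 by rewrite subr_eq0 eq_sym.
  have [[_ _ de _] _] := wsol z (c - s) Dz (IB s s0 sc) cs0.
  apply: ae_mono (ae_reflect c de) => t dt /andP[st tc] e e0.
  have Jt : [set` `[0, c - s]] (c - t).
    by rewrite /= in_itv /= subr_ge0 (ltW tc) flip.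
  have [d d0 hd] := has_derivative_nm (dt Jt) e0.
  exists d => // h h0 hh; have := hd (- h); rewrite normrN gtr0_norm// => /(_ hh).
  rewrite rmorphN mulNr mulrN (_ : c - t - h = c - (t + h)); first exact.
  by ring.
- by move=> t t0 tb; case: hp => hg _ _; apply: hg; exact: IB.
- move=> K cK KD; have [G [m [Gm Gac Gd bm]]] := herglotz_bound hp Ic cK KD.
  (* The sign restores monotonicity after reflection and makes this a primitive of the reflected
     [m]. *)
  exists (fun x => - G (c - x)), (fun x => m (c - x)); split.
  + by move=> x y _ xy _; rewrite lerN2; apply: Gm; exact: flip.
  + have := chain_ac_reflect c Gac; rewrite subr0 subrr.
    by apply: chain_ac_le => x y _ _ _; rewrite opprK addrC.
  apply: ae_mono2 (ae_reflect c Gd) (ae_reflect c bm) => t gd gb /andP[t0 tc].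
  split; last by apply: gb; rewrite subr_ge0 (ltW tc) lerBlDl lerDr.
  move=> e e0; have [d d0 hd] := gd e e0; exists d => // h h0 hh.
  have := hd (- h); rewrite normrN gtr0_norm// => /(_ hh).
  rewrite -normrN; congr (_ <= _); congr (`| _ |).
  by rewrite (_ : c - t - h = c - (t + h)); ring.
Qed.

(** Rational right endpoints in [I] exhaust it up to its two ends, and only countably many null sets
    are involved. *)
Lemma ae_time_interval (P : R -> Prop) :
  (forall b, I b -> {ae cmu, forall t, 0 < t < b -> P t}) ->
  {ae cmu, forall t, I t -> P t}.
Proof.
move=> h.
have h1 : {ae cmu, forall t, forall q : rat, I (ratr q) -> 0 < t < ratr q -> P t}.
  apply: ae_countable => q; have [Iq|nI] := pselect (I (ratr q)); last first.
    by apply: ae_all => t /nI.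
  by apply: ae_mono (h _ Iq) => t ht _.
(* A closed right end has no later time in [I], so it is discarded along with 0. For [T = +oo],
   [fine T] is 0 and nothing more is lost. *)
have h2 := ae_mono2 (fun x a b => conj a b) (ae_neq 0) (ae_neq (fine T)).
apply: ae_mono2 h1 h2 => t ht [t0 tT] It.
have tp : 0 < t by rewrite lt_neqAle eq_sym (time_interval_ge0 It) andbT; apply/eqP.
have tT' : (t%:E < T)%E.
  case: hI => T0 [[_ IE]|IE]; rewrite IE in It; case: It => _ //.
  rewrite le_eqVlt => /orP[/eqP E|//]; exfalso; apply: tT.
  by rewrite -E.
have Iq q : t < ratr q -> ((ratr q)%:E < T)%E -> P t.
  move=> tq qT; apply: (ht q); last by rewrite tp.
  case: hI => _ [[_ ->]|->]; split; rewrite ?(le_trans (ltW tp) (ltW tq))//.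
  exact: ltW.
case: (T) tT' Iq => [r| |] //= tr Iq.
  have [q] := rat_in_itvoo tr; rewrite in_itv /= => /andP[tq qr].
  by apply: (Iq q tq); rewrite lte_fin.
have [q] := rat_in_itvoo (ltr_pwDr (@ltr01 R) (lexx t)).
by rewrite in_itv /= => /andP[tq _]; apply: (Iq q tq); rewrite ltry.
Qed.

End EvolutionFlows.

Theorem theorem2 (R : realType) (D : set (Cplane R))
    (U : set (Cplane R -> Cplane R)) (T : \bar R) (I : set R)
    (w : R -> R -> Cplane R -> Cplane R) (phi : Cplane R -> R -> Cplane R)
    (domD : domain D) (scD : simply_connected D) (properD : D != setT)
    (sgU : semigroup D U) (clU : topologically_closed D U)
    (hI : time_interval T I)
    (hw : evolution_family D I w /\ associated_field D T I w phi \/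
          reverse_evolution_family D I w /\ reverse_associated_field D I w phi) :
  (forall s t : R, I s -> I t -> s <= t -> U (w s t)) <->
  {ae @completed_lebesgue_measure R,
    forall t : R, I t -> generators D U (phi ^~ t)}.
Proof.
have sub b x : I b -> 0 <= x -> x <= b -> I x by exact: (time_interval_le hI).
case: hw => [[hE hA]|[hE hA]]; split=> [Uw|gen].
- apply: (ae_time_interval hI) => b Ib.
  apply: (flow_generators domD scD properD sgU clU (evolution_flow hI hE hA Ib)).
  move=> s t s0 st tb; apply: Uw => //; apply: (sub b) => //.
    exact: le_trans tb.
  exact: le_trans st.
- move=> s t Is It st.
  apply: (flow_in_semigroup domD scD properD sgU clU (evolution_flow hI hE hA It)) => //.
    apply: ae_mono gen => x gx /andP[x0 xt]; apply: gx.
    by apply: (sub t) => //; exact: ltW.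
  exact: (time_interval_ge0 hI Is).
- apply: (ae_time_interval hI) => c Ic.
  have h := flow_generators domD scD properD sgU clU (reverse_evolution_flow hI hE hA Ic).
  apply: ae_mono (ae_reflect c (h _)) => [t gt /andP[t0 tc]|s t s0 st tc].
    by move: gt; rewrite subKr; apply; lra.
  apply: Uw; last by rewrite lerD2l lerN2.
    by apply: (sub c) => //; lra.
  by apply: (sub c) => //; lra.
- move=> s t Is It st; have s0 := time_interval_ge0 hI Is.
  have h := flow_in_semigroup domD scD properD sgU clU (reverse_evolution_flow hI hE hA It).
  (* With [c = t], the flow from time 0 to time [t - s] is exactly [w s t]. *)
  have := h _ 0 (t - s) (lexx 0); rewrite subr0 subKr; apply.
  + apply: ae_mono (ae_reflect t gen) => x gx /andP[x0 xt]; apply: gx.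
    by apply: (sub t) => //; lra.
  + by rewrite subr_ge0.
  + by rewrite lerBlDl lerDr.
Qed.
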